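(* Let $\mathcal F=\emptyset$, $\kappa=4$, and let $\gamma(H)=0$ for every graph $H$ of order 4 except $\gamma(P_3\cup K_1)=1$, where $P_3\cup K_1$ is the disjoint union of a path on three vertices and a single vertex. Let $B=K_2\cup K_2$ be the disjoint union of two edges. Then the corresponding problem is perfectly $B$-stable; moreover $\lim_{n\to\infty}\lambda(n,\mathcal G)=3/8$ (which equals the inducibility of the paw graph, a triangle with a pendant edge) and the unique maximiser of $\lambda(B(\mathbf a))$ over $\mathbf a\in\mathbb S_4$ is the vector with each entry $1/4$.
   Context: All graphs are finite and simple; ''subgraph'' means induced subgraph. $P(F,G)$ is the number of $v(F)$-subsets of $V(G)$ inducing a copy of $F$, $p(F,G)=P(F,G)/\binom{v(G)}{v(F)}$. Admissible graphs are those containing no member of $\mathcal F$ as induced subgraph (here all graphs); $\mathcal G$ is the class of admissible graphs. $\Lambda(G)=\sum_H\gamma(H)P(H,G)$ over isomorphism classes $H$ of order-$\kappa$ graphs, $\lambda(G)=\Lambda(G)/\binom{v(G)}\kappa$, $\lambda(n,\mathcal G)=\max\{\lambda(G):G\in\mathcal G,v(G)=n\}$. The inducibility of a graph $F$ is $\lim_{n\to\infty}\max\{p(F,G):v(G)=n\}$. For a graph $B$ on $[m]$ and disjoint sets $V_1,\dots,V_m$, the blow-up $B(V_1,\dots,V_m)$ has vertex set $\bigcup V_i$, with $u\in V_i,w\in V_j$ adjacent iff $ij\in E(B)$; $B()$ is the family of all blow-ups. $\mathbb S_m$ is the simplex of probability vectors in $\mathbb R^m$; $\lambda(B(\mathbf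 a))=\lim_{n}\lambda(B(V_{1,n},\dots,V_{m,n}))$ with $|V_{i,n}|=a_in+O(1)$. $\delta_{\mathrm{edit}}(G,B())$ is the minimal number of adjacency changes turning $G$ (order $n$) into a blow-up of $B$, divided by $\binom n2$. Perfectly $B$-stable: there is $C>0$ with $\delta_{\mathrm{edit}}(G,B())\le C(\lambda(n,\mathcal G)-\lambda(G))$ for all admissible $G$ of order $n\ge C$. *)

(* Defs.v *)
From HB Require Import structures.
From mathcomp Require Import all_boot all_order all_algebra.
From mathcomp Require Import boolp classical_sets reals topology normedtype.
From mathcomp Require Import sequences.

Set Implicit Arguments.
Unset Strict Implicit.
Unset Printing Implicit Defensive.

Import Order.TTheory GRing.Theory Num.Theory.
Import numFieldNormedType.Exports.

Local Open Scope ring_scope.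

Record sgraph (T : finType) := SGraph {
  edges : {set {set T}};
  _ : [forall e in edges, #|e| == 2%N] }.

HB.instance Definition _ (T : finType) := [isSub for @edges T].
HB.instance Definition _ (T : finType) := [Finite of sgraph T by <:].

Definition adj (T : finType) (G : sgraph T) (u v : T) : bool :=
  [set u; v]%SET \in edges G.

Definition edges_of_rel (T : finType) (r : rel T) : {set {set T}} :=
  [set [set p.1; p.2] | p : T * T & (p.1 != p.2) && r p.1 p.2]%SET.

Lemma edges_of_relP (T : finType) (r : rel T) :
  [forall e in edges_of_rel r, #|e| == 2%N].
Proof.
apply/forallP => e; apply/implyP => /imsetP[[u v]].
by rewrite inE /= => /andP[uv _] ->; rewrite cards2 uv.
Qed.

(* Loops are dropped and r is symmetrised, see adj_graph_of_rel. *)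
Definition graph_of_rel (T : finType) (r : rel T) : sgraph T :=
  SGraph (edges_of_relP r).

Lemma adjC (T : finType) (G : sgraph T) (u v : T) : adj G u v = adj G v u.
Proof. by rewrite /adj finset.setUC. Qed.

Lemma adjxx (T : finType) (G : sgraph T) (u : T) : adj G u u = false.
Proof.
apply/negP => uuG; have /forallP/(_ [set u; u]%SET) := valP G.
by move/implyP => /(_ uuG); rewrite cards2 eqxx.
Qed.

Lemma adj_graph_of_rel (T : finType) (r : rel T) (u v : T) :
  adj (graph_of_rel r) u v = (u != v) && (r u v || r v u).
Proof.
apply/imsetP/andP => [[[x y]]|[uv /orP[ruv|rvu]]].
- rewrite inE /= => /andP[xy rxy] e.
  have uv : u != v.
    by apply: contra_neq xy => uv; move/(congr1 (fun A : {set T} => #|A|)): e;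
      rewrite !cards2 uv eqxx; case: eqP.
  have hu : u \in [set x; y]%SET by rewrite -e !inE eqxx.
  have hv : v \in [set x; y]%SET by rewrite -e !inE eqxx orbT.
  move: hu hv uv; rewrite !inE => /orP[]/eqP-> /orP[]/eqP->;
    by rewrite ?eqxx // rxy ?orbT => ->.
- by exists (u, v) => //; rewrite inE /= uv.
- by exists (v, u); rewrite ?inE /= 1?eq_sym ?uv // finset.setUC.
Qed.

Section InducedCopies.
Variables S T : finType.
Implicit Types (F : sgraph S) (G : sgraph T).

Definition induced_embedding F G (f : {ffun S -> T}) : bool :=
  injectiveb f && [forall u, forall v, adj G (f u) (f v) == adj F u v].

Definition induces_copy F G (X : {set T}) : bool :=
  [exists f, induced_embedding F G f && (f @: [set: S] == X)%SET].

Definition iso F G : bool := induces_copy F G [set: T]%SET.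

(* A set inducing a copy of F automatically has #|S| elements. *)
Definition nb_copies F G : nat := #|[set X | induces_copy F G X]%SET|.

Definition density (R : realType) F G : R :=
  (nb_copies F G)%:R / ('C(#|T|, #|S|))%:R.

End InducedCopies.

Lemma isoP (S T : finType) (F : sgraph S) (G : sgraph T) :
  reflect (exists2 f : S -> T,
             bijective f & forall u v, adj G (f u) (f v) = adj F u v)
          (iso F G).
Proof.
apply: (iffP existsP) => [[f /andP[/andP[/injectiveP fi /forallP fa] /eqP fT]]|].
  exists f => [|u v]; last by move/forallP: (fa u) => /(_ v)/eqP.
  apply: inj_card_bij => //.
  by rewrite -[leqRHS]cardsT -(card_imset _ fi) fT cardsT.
case=> f fb fa; exists [ffun x => f x]; apply/andP; split.
  apply/andP; split.
    by apply/injectiveP => x y; rewrite !ffunE; exact: (bij_inj fb).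
  by apply/forallP => u; apply/forallP => v; rewrite !ffunE fa.
apply/eqP/setP => y; rewrite inE; apply/imsetP.
by case: fb => g fK gK; exists (g y); rewrite ?inE // ffunE gK.
Qed.

Lemma iso_sym (S T : finType) (F : sgraph S) (G : sgraph T) :
  iso F G = iso G F.
Proof.
apply/isoP/isoP => -[f [g fK gK] fa]; exists g; try by exists f.
- by move=> u v; rewrite -fa !gK.
- by move=> u v; rewrite -fa !gK.
Qed.

Lemma iso_trans (S T U : finType) (F : sgraph S) (G : sgraph T) (H : sgraph U) :
  iso F G -> iso G H -> iso F H.
Proof.
move=> /isoP[f fb fa] /isoP[g gb ga]; apply/isoP; exists (g \o f).
  exact: bij_comp.
by move=> u v; rewrite /= ga fa.
Qed.

Record problem (R : realType) := Problem {
  forbidden : set {n : nat & sgraph 'I_n};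
  kappa : nat;
  gamma : sgraph 'I_kappa -> R;
  _ : forall H H', iso H H' -> gamma H = gamma H' }.

Section Problem.
Variables (R : realType) (pb : problem R).

Definition admissible (T : finType) (G : sgraph T) : Prop :=
  forall F, forbidden pb F -> nb_copies (tagged F) G = 0%N.

(* One representative of each isomorphism class of graphs of order k. *)
Definition iso_representatives (k : nat) : {set sgraph 'I_k} :=
  transversal (equivalence_partition (@iso 'I_k 'I_k) [set: sgraph 'I_k]%SET)
    [set: sgraph 'I_k]%SET.

Definition Lambda (T : finType) (G : sgraph T) : R :=
  \sum_(H in iso_representatives (kappa pb)) gamma H * (nb_copies H G)%:R.

Definition lambda (T : finType) (G : sgraph T) : R :=
  Lambda G / ('C(#|T|, kappa pb))%:R.

(* The supremum of a finite set, hence a maximum when some graph of order n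
   is admissible. *)
Definition lambda_max (n : nat) : R :=
  sup [set lambda G | G in [set G : sgraph 'I_n | admissible G]]%classic.

End Problem.

Definition max_density (R : realType) (S : finType) (F : sgraph S) (n : nat) : R :=
  sup [set density R F G | G in [set: sgraph 'I_n]]%classic.

Definition has_inducibility (R : realType) (S : finType) (F : sgraph S) (l : R) :
  Prop := (max_density R F n @[n --> \oo] --> l)%classic.

Section Blowup.
Variables (m : nat) (B : sgraph 'I_m).

(* The parts are V_i = c @^-1: [set i]; they may be empty. *)
Definition blowup (T : finType) (c : T -> 'I_m) : sgraph T :=
  graph_of_rel (fun u v => adj B (c u) (c v)).

Definition is_blowup (T : finType) (G : sgraph T) : bool :=
  [exists c : {ffun T -> 'I_m}, G == blowup c].

(* Vertices (i, x) with x < s i: the i-th part has size s i. *)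
Definition blowup_sizes (s : 'I_m -> nat) : sgraph {i : 'I_m & 'I_(s i)} :=
  blowup (@tag 'I_m (fun i => 'I_(s i))).

Definition nb_edits (T : finType) (G G' : sgraph T) : nat :=
  #|((edges G :\: edges G') :|: (edges G' :\: edges G))%SET|.

(* nb_edits never exceeds 'C(#|T|, 2), so this default value has no influence
   as soon as there is a blow-up of B on T, e.g. when 0 < m. *)
Definition edit_distance (R : realType) (T : finType) (G : sgraph T) : R :=
  (\big[minn/'C(#|T|, 2)]_(G' : sgraph T | is_blowup G') nb_edits G G')%:R
    / ('C(#|T|, 2))%:R.

End Blowup.

Definition perfectly_stable (R : realType) (pb : problem R) (m : nat)
    (B : sgraph 'I_m) : Prop :=
  exists2 C : R, 0 < C &
    forall (n : nat) (G : sgraph 'I_n), C <= n%:R -> admissible pb G ->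
      edit_distance B R G <= C * (lambda_max pb n - lambda pb G).

Definition simplex (R : realType) (m : nat) : set 'rV[R]_m :=
  [set a | (forall i, 0 <= a 0 i) /\ \sum_i a 0 i = 1]%classic.

(* l is the limit of lambda along all sequences of blow-ups of B whose i-th part
   has size a_i n + O(1). *)
Definition has_blowup_lambda (R : realType) (pb : problem R) (m : nat)
    (B : sgraph 'I_m) (a : 'rV[R]_m) (l : R) : Prop :=
  forall s : nat -> 'I_m -> nat,
    (forall i, exists c : R, forall n, `|(s n i)%:R - a 0 i * n%:R| <= c) ->
    (lambda pb (blowup_sizes B (s n)) @[n --> \oo] --> l)%classic.

(* Arbitrary when the limit does not exist. *)
Definition blowup_lambda (R : realType) (pb : problem R) (m : nat)
    (B : sgraph 'I_m) (a : 'rV[R]_m) : R :=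
  xget 0 [set l | has_blowup_lambda pb B a l]%classic.

Definition unique_maximiser (R : realType) (V : Type) (D : set V) (f : V -> R)
    (u : V) : Prop :=
  D u /\ forall a, D a -> a <> u -> f a < f u.

Definition graph4 (s : seq (nat * nat)) : sgraph 'I_4 :=
  graph_of_rel (fun u v : 'I_4 => (val u, val v) \in s).

Definition P3_K1 : sgraph 'I_4 := graph4 [:: (0, 1); (1, 2)]%N.
Definition K2_K2 : sgraph 'I_4 := graph4 [:: (0, 1); (2, 3)]%N.
Definition paw : sgraph 'I_4 := graph4 [:: (0, 1); (1, 2); (0, 2); (2, 3)]%N.

Section InducibilityProblem.
Variables (R : realType) (k : nat) (F : sgraph 'I_k).

Lemma iso_weight_invariant (H H' : sgraph 'I_k) :
  iso H H' -> (iso H F)%:R = (iso H' F)%:R :> R.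
Proof.
move=> HH'; congr (nat_of_bool _)%:R; apply/idP/idP; last exact: iso_trans.
by apply: iso_trans; rewrite iso_sym.
Qed.

(* No forbidden graph, weight 1 on the isomorphism class of F, 0 elsewhere. *)
Definition inducibility_problem : problem R :=
  Problem set0 iso_weight_invariant.

End InducibilityProblem.

(* Main.v *)
(* Write e for the adjacency relation of a graph of order n. A flag-algebra
   certificate on five vertices bounds the number of copies of P3 + K1 by
   n^4/64 + O(n^3) and leaves a sum of squares as slack. If the count is nearly
   extremal, the slack is small: P4, the paw and the diamond are rare, and every
   K2 + K1 extends almost as in a balanced blow-up of K2 + K2. An averaging
   argument then picks edges xy and wc, with no edge between them, such that the
   neighbourhoods of x, y, w and c 4-colour the graph with few mismatches, that
   is, pairs whose adjacency differs from that in the blow-up.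

   For linear stability, take a colouring with the fewest mismatches. Its classes
   have about n/4 vertices. Giving a vertex of maximum mismatch degree d the
   neighbourhood prescribed by its colour creates at least c n^2 d copies, since
   the colour of the vertex is the best among the four. Each such step loses at
   most 2d mismatches of a minimal colouring, so repeating it until none is left
   yields a blow-up with at least c n^2/2 copies more per initial mismatch. *)
From Stdlib Require BinInt.
Import BinNums.
Require Import Defs.
From mathcomp Require Import all_boot all_order all_algebra.
From mathcomp Require Import ring lra zify ssrZ.

Set Implicit Arguments.
Unset Strict Implicit.
Unset Printing Implicit Defensive.

Import Order.TTheory GRing.Theory Num.Theory.

Local Open Scope ring_scope.

(** * A flag-algebra certificate *)

Section Certificate.
Local Open Scope Z_scope.
Import BinInt.

(** The certificate bounds the count by [n^4/32], which blow-ups match only up to a term of order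
    [n^3]; alone it cannot give an edit distance linear in [lambda_max - lambda]. It is used for the
    rough structure, and the linear bound comes from comparing the graph with a blow-up on the same
    vertices, where no such term intervenes. Each step of that comparison gains order [n^2 d]. Its
    errors, degenerate tuples apart, contain two mismatches, one at the changed vertex and one
    elsewhere; few mismatches in total and the maximality of [d] make them negligible.

    Two counts are needed. [hom_count] lets the ends of the path coincide: the certificate holds for
    it with no error term, and on a blow-up it is a polynomial in the class sizes. [inj_count]
    counts genuine copies: its tuples have distinct entries, so the effect of changing one vertex
    splits according to the position of that vertex. The two differ by at most [n^3]. *)

Definition Z_of_bool (b : bool) : Z := if b then 1 else 0.

(* The weight of a vertex v added to three roots, as a function of the adjacency
   of v to each root. *)
Definition table3 := bool -> bool -> bool -> Z.

Definition pattern (p q r : bool) : table3 :=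
  fun a b c => Z_of_bool [&& a == p, b == q & c == r].

Definition comb (s : seq (Z * table3)) : table3 :=
  fun a b c => foldr Z.add 0 [seq p.1 * p.2 a b c | p <- s].

Definition K2K1_type (a b c : bool) := [&& a, ~~ b & ~~ c].
Definition P3_type (a b c : bool) := [&& a, ~~ b & c].
Definition K3_type (a b c : bool) := [&& a, b & c].

Let n1 := pattern true false false.
Let n2 := pattern false true false.
Let n3 := pattern false false true.
Let n12 := pattern true true false.
Let n13 := pattern true false true.
Let n23 := pattern false true true.
Let n123 := pattern true true true.
Let n0 := pattern false false false.

(** In a balanced blow-up of K2 + K2, let xy be an edge and z a vertex adjacent to neither end. The
    four classes, of size n/4 each, consist of the vertices adjacent only to x, only to y, only to
    z, and to none of the three. Hence the next four combinations vanish there: the first two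
    compare classes, while [path_ext] and [all_ext] count extensions to a P4 and to a paw. Triangles
    do not occur, so [two_ext] is free. *)
Definition diff12 := comb [:: (1, n1); (-1, n2)].
Definition diff30 := comb [:: (1, n3); (-1, n0)].
Definition path_ext := comb [:: (1, n13); (1, n23)].
Definition all_ext := comb [:: (1, n123)].
Definition two_ext := comb [:: (1, n12); (1, n13); (1, n23)].
Let one_ext := comb [:: (1, n1); (1, n2); (1, n3)].

(* The multipliers come from a semidefinite program whose solution was rounded to
   rationals; scale clears the denominators. The first five squares, of weight
   one after rescaling, are not needed for the bound itself: they are the slack
   from which the structure of near-extremal graphs is read off. *)
Definition scale : Z := 495.

Definition typed_squares : seq (Z * (bool -> bool -> bool -> bool) * table3) :=
  [:: (scale, K2K1_type, diff12); (scale, K2K1_type, diff30);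
      (scale, K2K1_type, path_ext); (scale, K2K1_type, all_ext);
      (scale, K3_type, two_ext);
      (245025, K2K1_type, diff12); (585, K2K1_type, diff30);
      (45165, K2K1_type, path_ext);
      (105, K2K1_type, comb [:: (60, diff30); (-8, path_ext); (33, all_ext)]);
      (1080, K2K1_type, comb [:: (1, diff30); (-1, path_ext)]);
      (1283040, P3_type, comb [:: (1, n1); (-1, n3)]);
      (330, K3_type, comb [:: (3, one_ext); (-10, two_ext)]);
      (2145, K3_type, two_ext);
      (36630, K3_type, comb [:: (1, n1); (-1, n2); (1, n23); (-1, n13)]);
      (36630, K3_type, comb [:: (1, n1); (-1, n3); (1, n23); (-1, n12)]);
      (36630, K3_type, comb [:: (1, n2); (-1, n3); (1, n13); (-1, n12)])].

Let flag (k : nat) (e : bool) : table3 :=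
  fun a b c => Z_of_bool ((addn a b == k) && (c == e)).
(** As the squares of a tight certificate must, [h1], [h2] and [h3] vanish on the balanced blow-up:
    there the flags (0, false), (0, true), (1, false), (1, true), (2, false), (2, true) have rooted
    densities 7/16, 1/8, 1/4, 1/8, 1/16 and 0. *)
Let h1 := comb [:: (1, flag 1 false); (-1, flag 0 true); (-1, flag 1 true)].
Let h2 := comb [:: (2, flag 2 false); (1, flag 0 true); (-1, flag 1 false)].
Let h3 := comb [:: (2, flag 0 false); (2, flag 2 true); (-1, flag 0 true);
                   (-3, flag 1 false)].

(* Here a table is applied to the edges rx, ry and xy, where r is the root. *)
Definition rooted_squares : seq (Z * table3) :=
  [:: (110, comb [:: (8, h1); (-13, h2); (9, h3)]);
      (1507, comb [:: (4, h1); (-5, h2)]); (528, h1); (4125, h2)].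

(* A function of the ten edges of a graph on five vertices. *)
Definition form10 := bool -> bool -> bool -> bool -> bool ->
                     bool -> bool -> bool -> bool -> bool -> Z.

(** The square of a sum over extensions is a double sum. In a typed square the roots are 0, 1, 2 and
    the two extending vertices are 3 and 4; in a rooted square the root is 0 and the two pairs are
    12 and 34. Since 2304 = 32 * 72, nonnegativity of the total means at most [n^4/32] labelled
    copies. *)
Definition certificate : form10 := fun b01 b02 b03 b04 b12 b13 b14 b23 b24 b34 =>
  scale * 72
  - scale * (2304 * Z_of_bool [&& b01, b12, ~~ b02, ~~ b03, ~~ b13 & ~~ b23])
  - (foldr Z.add 0 [seq p.1.1 * (Z_of_bool (p.1.2 b01 b02 b12) *
                     (p.2 b03 b13 b23 * p.2 b04 b14 b24)) | p <- typed_squares]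
     + foldr Z.add 0 [seq p.1 * (p.2 b01 b02 b12 * p.2 b03 b04 b34)
                     | p <- rooted_squares]).

Definition swap01 (f : form10) : form10 := fun b01 b02 b03 b04 b12 b13 b14 b23 b24 b34 =>
  f b01 b12 b13 b14 b02 b03 b04 b23 b24 b34.
Definition swap12 (f : form10) : form10 := fun b01 b02 b03 b04 b12 b13 b14 b23 b24 b34 =>
  f b02 b01 b03 b04 b12 b23 b24 b13 b14 b34.
Definition swap23 (f : form10) : form10 := fun b01 b02 b03 b04 b12 b13 b14 b23 b24 b34 =>
  f b01 b03 b02 b04 b13 b12 b14 b23 b34 b24.
Definition swap34 (f : form10) : form10 := fun b01 b02 b03 b04 b12 b13 b14 b23 b24 b34 =>
  f b01 b02 b04 b03 b12 b14 b13 b24 b23 b34.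
Definition add10 (f g : form10) : form10 := fun b01 b02 b03 b04 b12 b13 b14 b23 b24 b34 =>
  f b01 b02 b03 b04 b12 b13 b14 b23 b24 b34 + g b01 b02 b03 b04 b12 b13 b14 b23 b24 b34.

Definition sym2 (f : form10) : form10 := add10 f (swap01 f).
Definition sym3 (f : form10) : form10 := add10 f (sym2 (swap12 f)).
Definition sym4 (f : form10) : form10 := add10 f (sym3 (swap23 f)).
Definition sym5 (f : form10) : form10 := add10 f (sym4 (swap34 f)).

(** Each [sym] factor sums over coset representatives of one symmetric group in the next, so the
    product runs over the 120 relabellings of five vertices with 4 + 3 + 2 + 1 swap operators
    instead of 120 explicit terms. *)
Definition symmetrise (f : form10) : form10 := sym5 (sym4 (sym3 (sym2 f))).

Definition all_bool (P : bool -> bool) := P true && P false.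

Lemma all_boolP (P : bool -> bool) : all_bool P -> forall b, P b.
Proof. by case/andP=> ? ? []. Qed.

(** All 1024 assignments of the ten edges are evaluated in binary integers. A tuple with repeated
    vertices also yields such an assignment, so the inequality may be summed over all of [V^5]
    without a correction term. *)
Lemma symmetrised_certificate_ge0 b01 b02 b03 b04 b12 b13 b14 b23 b24 b34 :
  0 <=? symmetrise certificate b01 b02 b03 b04 b12 b13 b14 b23 b24 b34.
Proof.
move: b34; apply: all_boolP; move: b24; apply: all_boolP.
move: b23; apply: all_boolP; move: b14; apply: all_boolP.
move: b13; apply: all_boolP; move: b12; apply: all_boolP.
move: b04; apply: all_boolP; move: b03; apply: all_boolP.
move: b02; apply: all_boolP; move: b01; apply: all_boolP.
by vm_compute.
Qed.

End Certificate.

Section SumOfSquares.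
Variables (R : realFieldType) (V : finType) (e : rel V).
Hypothesis esym : symmetric e.

Definition real_of_Z (z : Z) : R := (int_of_Z z)%:~R.

Lemma real_of_ZD x y : real_of_Z (BinInt.Z.add x y) = real_of_Z x + real_of_Z y.
Proof. by rewrite /real_of_Z -rmorphD -rmorphD. Qed.

Lemma real_of_ZB x y : real_of_Z (BinInt.Z.sub x y) = real_of_Z x - real_of_Z y.
Proof. by rewrite /real_of_Z -rmorphB -rmorphB. Qed.

Lemma real_of_ZM x y : real_of_Z (BinInt.Z.mul x y) = real_of_Z x * real_of_Z y.
Proof. by rewrite /real_of_Z -rmorphM -rmorphM. Qed.

Lemma real_of_Z_bool b : real_of_Z (Z_of_bool b) = b%:R.
Proof. by case: b. Qed.

Lemma real_of_Z_ge0 z : BinInt.Z.leb Z0 z -> 0 <= real_of_Z z.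
Proof. by rewrite /real_of_Z ler0z; case: z. Qed.

Lemma real_of_Z_sum (I : Type) (F : I -> Z) (s : seq I) :
  real_of_Z (foldr BinInt.Z.add Z0 [seq F i | i <- s]) =
  \sum_(i <- s) real_of_Z (F i).
Proof.
by elim: s => [|i s IHs]; rewrite ?big_nil //= big_cons real_of_ZD IHs.
Qed.

Definition form_sum (f : form10) : R :=
  \sum_x0 \sum_x1 \sum_x2 \sum_x3 \sum_x4
    real_of_Z (f (e x0 x1) (e x0 x2) (e x0 x3) (e x0 x4) (e x1 x2) (e x1 x3)
                 (e x1 x4) (e x2 x3) (e x2 x4) (e x3 x4)).

Lemma form_sumD f g : form_sum (add10 f g) = form_sum f + form_sum g.
Proof.
rewrite /form_sum -big_split; apply: eq_bigr => x0 _; rewrite -big_split.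
apply: eq_bigr => x1 _; rewrite -big_split; apply: eq_bigr => x2 _.
rewrite -big_split; apply: eq_bigr => x3 _; rewrite -big_split.
by apply: eq_bigr => x4 _; exact: real_of_ZD.
Qed.

Lemma form_sum_swap01 f : form_sum (swap01 f) = form_sum f.
Proof.
rewrite /form_sum exchange_big; apply: eq_bigr => x0 _; apply: eq_bigr => x1 _.
apply: eq_bigr => x2 _; apply: eq_bigr => x3 _; apply: eq_bigr => x4 _.
by rewrite /swap01 (esym x1 x0).
Qed.

Lemma form_sum_swap12 f : form_sum (swap12 f) = form_sum f.
Proof.
apply: eq_bigr => x0 _; rewrite exchange_big; apply: eq_bigr => x1 _.
apply: eq_bigr => x2 _; apply: eq_bigr => x3 _; apply: eq_bigr => x4 _.
by rewrite /swap12 (esym x2 x1).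
Qed.

Lemma form_sum_swap23 f : form_sum (swap23 f) = form_sum f.
Proof.
apply: eq_bigr => x0 _; apply: eq_bigr => x1 _; rewrite exchange_big.
apply: eq_bigr => x2 _; apply: eq_bigr => x3 _; apply: eq_bigr => x4 _.
by rewrite /swap23 (esym x3 x2).
Qed.

Lemma form_sum_swap34 f : form_sum (swap34 f) = form_sum f.
Proof.
apply: eq_bigr => x0 _; apply: eq_bigr => x1 _; apply: eq_bigr => x2 _.
rewrite exchange_big; apply: eq_bigr => x3 _; apply: eq_bigr => x4 _.
by rewrite /swap34 (esym x4 x3).
Qed.

Lemma form_sum_sym2 f : form_sum (sym2 f) = 2 * form_sum f.
Proof. by rewrite /sym2 form_sumD form_sum_swap01; ring. Qed.

Lemma form_sum_sym3 f : form_sum (sym3 f) = 3 * form_sum f.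
Proof. by rewrite /sym3 form_sumD form_sum_sym2 form_sum_swap12; ring. Qed.

Lemma form_sum_sym4 f : form_sum (sym4 f) = 4 * form_sum f.
Proof. by rewrite /sym4 form_sumD form_sum_sym3 form_sum_swap23; ring. Qed.

Lemma form_sum_sym5 f : form_sum (sym5 f) = 5 * form_sum f.
Proof. by rewrite /sym5 form_sumD form_sum_sym4 form_sum_swap34; ring. Qed.

Lemma form_sum_symmetrise f : form_sum (symmetrise f) = 120 * form_sum f.
Proof. by rewrite /symmetrise form_sum_sym5 form_sum_sym4 form_sum_sym3 form_sum_sym2;
  ring. Qed.

Lemma form_sum_certificate_ge0 : 0 <= form_sum certificate.
Proof.
rewrite -(pmulr_rge0 _ (ltr0n _ 120)) -form_sum_symmetrise; do 5 apply: sumr_ge0 => ? _.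
exact/real_of_Z_ge0/symmetrised_certificate_ge0.
Qed.

Definition ext (l : table3) (x y z : V) : R :=
  \sum_v real_of_Z (l (e x v) (e y v) (e z v)).

(* Degenerate tuples with x = z are counted too. *)
Definition hom_count : R :=
  \sum_x \sum_y \sum_z \sum_w
    [&& e x y, e y z, ~~ e x z, ~~ e x w, ~~ e y w & ~~ e z w]%:R.

Definition typed_sum (t : bool -> bool -> bool -> bool) (F : V -> V -> V -> R) : R :=
  \sum_x \sum_y \sum_z (t (e x y) (e x z) (e y z))%:R * F x y z.

Lemma typed_sum_ge0 t F : (forall x y z, 0 <= F x y z) -> 0 <= typed_sum t F.
Proof. by move=> F0; do 3 apply: sumr_ge0 => ? _; rewrite mulr_ge0. Qed.

Definition Sum5 (F : V -> V -> V -> V -> V -> R) : R :=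
  \sum_x0 \sum_x1 \sum_x2 \sum_x3 \sum_x4 F x0 x1 x2 x3 x4.

Lemma Sum5D F G :
  Sum5 (fun x0 x1 x2 x3 x4 => F x0 x1 x2 x3 x4 + G x0 x1 x2 x3 x4) =
  Sum5 F + Sum5 G.
Proof.
rewrite /Sum5 -big_split; apply: eq_bigr => x0 _; rewrite -big_split.
apply: eq_bigr => x1 _; rewrite -big_split; apply: eq_bigr => x2 _.
by rewrite -big_split; apply: eq_bigr => x3 _; rewrite -big_split.
Qed.

Lemma Sum5Z c F :
  Sum5 (fun x0 x1 x2 x3 x4 => c * F x0 x1 x2 x3 x4) = c * Sum5 F.
Proof.
rewrite /Sum5 mulr_sumr; apply: eq_bigr => x0 _; rewrite mulr_sumr.
apply: eq_bigr => x1 _; rewrite mulr_sumr; apply: eq_bigr => x2 _.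
by rewrite mulr_sumr; apply: eq_bigr => x3 _; rewrite mulr_sumr.
Qed.

Lemma Sum5_exchange (I : Type) (s : seq I) F :
  Sum5 (fun x0 x1 x2 x3 x4 => \sum_(i <- s) F i x0 x1 x2 x3 x4) =
  \sum_(i <- s) Sum5 (F i).
Proof.
rewrite /Sum5 [RHS]exchange_big; apply: eq_bigr => x0 _.
rewrite [RHS]exchange_big; apply: eq_bigr => x1 _.
rewrite [RHS]exchange_big; apply: eq_bigr => x2 _.
rewrite [RHS]exchange_big; apply: eq_bigr => x3 _.
by rewrite [RHS]exchange_big.
Qed.

Lemma Sum5_1 : Sum5 (fun _ _ _ _ _ => 1) = #|V|%:R ^+ 5.
Proof. by rewrite /Sum5 !sumr_const -!mulrnA -natrX !expnS expn0 muln1 !mulnA. Qed.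

Lemma form_sum_certificate :
  form_sum certificate =
    real_of_Z scale * (72 * #|V|%:R ^+ 5)
    - real_of_Z scale * (2304 * (#|V|%:R * hom_count))
    - (\sum_(p <- typed_squares) real_of_Z p.1.1 *
         typed_sum p.1.2 (fun x y z => ext p.2 x y z ^+ 2)
       + \sum_(p <- rooted_squares) real_of_Z p.1 *
           \sum_r (\sum_x \sum_y real_of_Z (p.2 (e r x) (e r y) (e x y))) ^+ 2).
Proof.
have -> : form_sum certificate =
  Sum5 (fun x0 x1 x2 x3 x4 =>
    (real_of_Z scale * (72 * 1) + (- real_of_Z scale) * (2304 * [&& e x0 x1, e x1 x2,
      ~~ e x0 x2, ~~ e x0 x3, ~~ e x1 x3 & ~~ e x2 x3]%:R)
     + (-1) * ((\sum_(p <- typed_squares) real_of_Z p.1.1 *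
          ((p.1.2 (e x0 x1) (e x0 x2) (e x1 x2))%:R *
            (real_of_Z (p.2 (e x0 x3) (e x1 x3) (e x2 x3)) *
             real_of_Z (p.2 (e x0 x4) (e x1 x4) (e x2 x4)))))
      + \sum_(p <- rooted_squares) real_of_Z p.1 *
           (real_of_Z (p.2 (e x0 x1) (e x0 x2) (e x1 x2)) *
            real_of_Z (p.2 (e x0 x3) (e x0 x4) (e x3 x4)))))).
  do 5 apply: eq_bigr => ? _.
  rewrite /certificate real_of_ZB [X in X - _]real_of_ZB [X in _ - X]real_of_ZD.
  rewrite !mulNr mul1r; congr (_ - _ - (_ + _)).
  - by rewrite real_of_ZM mulr1.
  - by rewrite !real_of_ZM real_of_Z_bool.
  - rewrite real_of_Z_sum; apply: eq_bigr => p _.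
    by rewrite real_of_ZM real_of_ZM real_of_ZM real_of_Z_bool.
  - rewrite real_of_Z_sum; apply: eq_bigr => p _.
    by rewrite real_of_ZM real_of_ZM.
rewrite !Sum5D !Sum5Z Sum5_1 !Sum5D !Sum5_exchange mulNr mulN1r.
congr (_ - _ * (_ * _) - (_ + _)).
- rewrite /Sum5 /hom_count mulr_sumr; apply: eq_bigr => x0 _.
  rewrite mulr_sumr; apply: eq_bigr => x1 _; rewrite mulr_sumr.
  apply: eq_bigr => x2 _; rewrite mulr_sumr; apply: eq_bigr => x3 _.
  by rewrite sumr_const cardT mulr_natl.
- apply: eq_bigr => p _; rewrite Sum5Z; congr (_ * _).
  do 3 apply: eq_bigr => ? _; rewrite expr2 /ext mulr_suml mulr_sumr.
  by apply: eq_bigr => x3 _; rewrite mulr_sumr mulr_sumr.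
- apply: eq_bigr => p _; rewrite Sum5Z; congr (_ * _).
  apply: eq_bigr => r _; rewrite expr2 mulr_suml; apply: eq_bigr => x1 _.
  rewrite mulr_suml; apply: eq_bigr => x2 _; rewrite mulr_sumr.
  by apply: eq_bigr => x3 _; rewrite mulr_sumr.
Qed.

Lemma rooted_squares_ge0 (s : seq (Z * table3)) :
  all (fun p => BinInt.Z.leb Z0 p.1) s ->
  0 <= \sum_(p <- s) real_of_Z p.1 *
         \sum_r (\sum_x \sum_y real_of_Z (p.2 (e r x) (e r y) (e x y))) ^+ 2.
Proof.
elim: s => [|p s IHs] /=; first by rewrite big_nil.
case/andP=> p0 s0; rewrite big_cons addr_ge0 ?IHs //.
by rewrite mulr_ge0 ?real_of_Z_ge0 // sumr_ge0 // => r _; exact: sqr_ge0.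
Qed.

Lemma typed_squares_ge0 (s : seq (Z * (bool -> bool -> bool -> bool) * table3)) :
  all (fun p => BinInt.Z.leb Z0 p.1.1) s ->
  0 <= \sum_(p <- s) real_of_Z p.1.1 *
         typed_sum p.1.2 (fun x y z => ext p.2 x y z ^+ 2).
Proof.
elim: s => [|p s IHs] /=; first by rewrite big_nil.
case/andP=> p0 s0; rewrite big_cons addr_ge0 ?IHs //.
by rewrite mulr_ge0 ?real_of_Z_ge0 // typed_sum_ge0 // => *; exact: sqr_ge0.
Qed.

Theorem hom_count_sos :
  typed_sum K2K1_type (fun x y z => ext diff12 x y z ^+ 2)
  + typed_sum K2K1_type (fun x y z => ext diff30 x y z ^+ 2)
  + typed_sum K2K1_type (fun x y z => ext path_ext x y z ^+ 2)
  + typed_sum K2K1_type (fun x y z => ext all_ext x y z ^+ 2)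
  + typed_sum K3_type (fun x y z => ext two_ext x y z ^+ 2)
  <= 72 * #|V|%:R ^+ 5 - 2304 * (#|V|%:R * hom_count).
Proof.
have := form_sum_certificate_ge0; rewrite form_sum_certificate.
have := @rooted_squares_ge0 rooted_squares isT; move: (\sum_(p <- rooted_squares) _)
  => r r0.
(* The first five squares stay as slack; the others are discarded as nonnegative. *)
rewrite -(cat_take_drop 5 typed_squares) big_cat /=.
have := @typed_squares_ge0 (drop 5 typed_squares) isT.
move: (\sum_(p <- drop 5 typed_squares) _) => d d0.
rewrite 5!big_cons big_nil addr0 /= -!mulrDr -mulrBr.
set c := real_of_Z scale; have c0 : 0 < c by rewrite /c /real_of_Z ltr0z.
move=> h; rewrite -subr_ge0 -(pmulr_rge0 _ c0); lra.
Qed.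

End SumOfSquares.

(** * The sums of squares and what they penalise *)

Section FourfoldSums.
Variables (R : realFieldType) (V : finType).

Definition Sum4 (F : V -> V -> V -> V -> R) : R :=
  \sum_x \sum_y \sum_z \sum_w F x y z w.

Lemma Sum4_swap01 F : Sum4 (fun x y z w => F y x z w) = Sum4 F.
Proof. by rewrite /Sum4 exchange_big. Qed.

Lemma Sum4_swap12 F : Sum4 (fun x y z w => F x z y w) = Sum4 F.
Proof. by apply: eq_bigr => x _; rewrite exchange_big. Qed.

Lemma Sum4_swap23 F : Sum4 (fun x y z w => F x y w z) = Sum4 F.
Proof. by do 2 apply: eq_bigr => ? _; rewrite exchange_big. Qed.

Lemma Sum4D F G :
  Sum4 (fun x y z w => F x y z w + G x y z w) = Sum4 F + Sum4 G.
Proof.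
rewrite /Sum4 -big_split; apply: eq_bigr => x _; rewrite -big_split.
by apply: eq_bigr => y _; rewrite -big_split; apply: eq_bigr => z _; exact: big_split.
Qed.

Lemma ler_Sum4 F G : (forall x y z w, F x y z w <= G x y z w) -> Sum4 F <= Sum4 G.
Proof. by move=> FG; do 4 apply: ler_sum => ? _. Qed.

Lemma eq_Sum4 F G : (forall x y z w, F x y z w = G x y z w) -> Sum4 F = Sum4 G.
Proof. by move=> FG; do 4 apply: eq_bigr => ? _. Qed.

End FourfoldSums.

Section NearExtremal.
Variables (R : realFieldType) (V : finType) (e : rel V).
Hypothesis esym : symmetric e.

Local Notation n := (#|V|%:R : R).
Local Notation cnt P := (\sum_(v : V) (P v)%:R : R).

Definition adj_pattern (p q r : bool) (x y z v : V) :=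
  [&& e x v == p, e y v == q & e z v == r].

Local Notation pat p q r x y z := (cnt (adj_pattern p q r x y z)).

Lemma ext_diff12 x y z :
  ext R e diff12 x y z = pat true false false x y z - pat false true false x y z.
Proof.
rewrite /ext -sumrB; apply: eq_bigr => v _; rewrite /adj_pattern.
by case: (e x v); case: (e y v); case: (e z v); rewrite ?subr0 ?sub0r ?subrr.
Qed.

Lemma ext_diff30 x y z :
  ext R e diff30 x y z = pat false false true x y z - pat false false false x y z.
Proof.
rewrite /ext -sumrB; apply: eq_bigr => v _; rewrite /adj_pattern.
by case: (e x v); case: (e y v); case: (e z v); rewrite ?subr0 ?sub0r ?subrr.
Qed.

Lemma ext_path_ext x y z :
  ext R e path_ext x y z = pat true false true x y z + pat false true true x y z.
Proof.
rewrite /ext -big_split; apply: eq_bigr => v _; rewrite /adj_pattern.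
by case: (e x v); case: (e y v); case: (e z v); rewrite /= ?addr0 ?add0r.
Qed.

Lemma ext_all_ext x y z : ext R e all_ext x y z = pat true true true x y z.
Proof.
rewrite /ext; apply: eq_bigr => v _; rewrite /adj_pattern.
by case: (e x v); case: (e y v); case: (e z v).
Qed.

Lemma ext_two_ext x y z :
  ext R e two_ext x y z = pat true true false x y z + pat true false true x y z
    + pat false true true x y z.
Proof.
rewrite /ext -!big_split; apply: eq_bigr => v _; rewrite /adj_pattern.
by case: (e x v); case: (e y v); case: (e z v); rewrite /= ?addr0 ?add0r.
Qed.

(** Instead of Cauchy-Schwarz, [2 * (eps * n) * |F| <= F^2 + (eps * n)^2] is summed over the at most
    [n^3] triples. *)
Lemma typed_sum_L1 (eps : R) t F : 0 < eps -> 0 < n ->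
  typed_sum e t (fun x y z => F x y z ^+ 2) <= eps ^+ 2 * n ^+ 5 ->
  typed_sum e t (fun x y z => `|F x y z|) <= eps * n ^+ 4.
Proof.
move=> eps0 n0 hF.
have c0 : 0 < eps * n by exact: mulr_gt0.
rewrite -(ler_pM2l c0) -(ler_pM2l (ltr0n R 2)).
have -> : 2 * (eps * n * (eps * n ^+ 4)) =
  eps ^+ 2 * n ^+ 5 + (eps * n) ^+ 2 * n ^+ 3 by ring.
apply: le_trans (lerD hF (lexx _)).
have -> : (eps * n) ^+ 2 * n ^+ 3 = \sum_(x : V) \sum_(y : V) \sum_(z : V) (eps * n) ^+ 2.
  by rewrite !sumr_const -!mulrnA -[RHS]mulr_natr -natrX !expnS expn0 muln1 !mulnA.
rewrite /typed_sum -big_split !mulr_sumr; apply: ler_sum => x _.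
rewrite -big_split !mulr_sumr; apply: ler_sum => y _.
rewrite -big_split !mulr_sumr; apply: ler_sum => z _ /=.
case: (t _ _ _); last by rewrite !mul0r !mulr0 add0r sqr_ge0.
rewrite !mul1r; have := sqr_ge0 (`|F x y z| - eps * n).
by rewrite sqrrB real_normK ?num_real //; lra.
Qed.

Section Penalties.
Variable eps : R.
Hypothesis eps_gt0 : 0 < eps.
Hypothesis n_gt0 : 0 < n.
Hypothesis near_extremal :
  72 * n ^+ 5 - 2304 * (n * hom_count R e) <= eps ^+ 2 * n ^+ 5.

Lemma sos_parts :
  [/\ typed_sum e K2K1_type (fun x y z => `|ext R e diff12 x y z|) <= eps * n ^+ 4,
      typed_sum e K2K1_type (fun x y z => `|ext R e diff30 x y z|) <= eps * n ^+ 4,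
      typed_sum e K2K1_type (fun x y z => `|ext R e path_ext x y z|) <= eps * n ^+ 4,
      typed_sum e K2K1_type (fun x y z => `|ext R e all_ext x y z|) <= eps * n ^+ 4
    & typed_sum e K3_type (fun x y z => `|ext R e two_ext x y z|) <= eps * n ^+ 4].
Proof.
have := le_trans (hom_count_sos R esym) near_extremal.
have sq0 t (F : V -> V -> V -> R) : 0 <= typed_sum e t (fun x y z => F x y z ^+ 2).
  by apply: typed_sum_ge0 => *; exact: sqr_ge0.
have := sq0 K2K1_type (ext R e diff12); have := sq0 K2K1_type (ext R e diff30).
have := sq0 K2K1_type (ext R e path_ext); have := sq0 K2K1_type (ext R e all_ext).
have := sq0 K3_type (ext R e two_ext) => *.
split; apply: typed_sum_L1 => //; lra.
Qed.

Definition P4_at p q r s :=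
  [&& e p q, e q r, e r s, ~~ e p r, ~~ e p s & ~~ e q s].

Definition paw_at x y v z :=
  [&& e x y, e x v, e y v, e v z, ~~ e x z & ~~ e y z].

Definition diamond_at x y v z :=
  [&& e x y, e x v, e y v, e x z, e y z & ~~ e v z].

(** If v is adjacent to z and x but not to y, then y, x, v, z is a P4; this is one of the two
    patterns of [path_ext]. *)
Lemma P4_count : Sum4 (fun p q r s => (P4_at p q r s)%:R) <= eps * n ^+ 4.
Proof.
case: sos_parts => _ _ h _ _; apply: le_trans h.
rewrite -Sum4_swap01 -Sum4_swap23.
apply: ler_sum => x _; apply: ler_sum => y _; apply: ler_sum => z _.
rewrite ext_path_ext ger0_norm; last first.
  by rewrite addr_ge0 // sumr_ge0.
rewrite mulrDr -[leLHS]addr0 lerD ?mulr_ge0 ?sumr_ge0 // mulr_sumr.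
apply: ler_sum => v _; rewrite /P4_at /adj_pattern /K2K1_type -natrM mulnb ler_nat.
rewrite (esym y x) (esym v z).
by case: (e x y); case: (e x v); case: (e z v); case: (e y v); case: (e y z);
  case: (e x z).
Qed.

Lemma paw_count : Sum4 (fun x y v z => (paw_at x y v z)%:R) <= eps * n ^+ 4.
Proof.
case: sos_parts => _ _ _ h _; apply: le_trans h; rewrite -Sum4_swap23.
apply: ler_sum => x _; apply: ler_sum => y _; apply: ler_sum => z _.
rewrite ext_all_ext ger0_norm ?sumr_ge0 // mulr_sumr.
apply: ler_sum => v _; rewrite /paw_at /adj_pattern /K2K1_type -natrM mulnb ler_nat.
rewrite (esym v z).
by case: (e x y); case: (e x v); case: (e z v); case: (e y v); case: (e y z);
  case: (e x z).
Qed.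

Lemma diamond_count : Sum4 (fun x y v z => (diamond_at x y v z)%:R) <= eps * n ^+ 4.
Proof.
case: sos_parts => _ _ _ _ h; apply: le_trans h.
apply: ler_sum => x _; apply: ler_sum => y _; apply: ler_sum => z _.
rewrite ext_two_ext ger0_norm; last by rewrite !addr_ge0 // sumr_ge0.
rewrite -addrA mulrDr -[leLHS]addr0 lerD ?mulr_ge0 ?addr_ge0 ?sumr_ge0 //.
rewrite mulr_sumr.
apply: ler_sum => v _; rewrite /diamond_at /adj_pattern /K3_type -natrM mulnb ler_nat.
by case: (e x y); case: (e x z); case: (e y z); case: (e x v); case: (e y v);
  case: (e z v).
Qed.

End Penalties.
End NearExtremal.

Section FourPerm.
Variables (R : realFieldType) (V : finType).
Implicit Type F : V -> V -> V -> V -> R.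

Lemma Sum4_2301 F : Sum4 (fun x y v w => F v w x y) = Sum4 F.
Proof.
rewrite (Sum4_swap12 (fun x v y w => F v w x y)).
rewrite (Sum4_swap01 (fun v x y w => F v w x y)).
by rewrite (Sum4_swap23 (fun v x w y => F v w x y)) (Sum4_swap12 F).
Qed.

Lemma Sum4_2310 F : Sum4 (fun x y v w => F v w y x) = Sum4 F.
Proof. by rewrite (Sum4_2301 (fun x y v w => F x y w v)) Sum4_swap23. Qed.

Lemma Sum4_3201 F : Sum4 (fun x y v w => F w v x y) = Sum4 F.
Proof. by rewrite (Sum4_2301 (fun x y v w => F y x v w)) Sum4_swap01. Qed.

Lemma Sum4_3210 F : Sum4 (fun x y v w => F w v y x) = Sum4 F.
Proof. by rewrite (Sum4_2301 (fun x y v w => F y x w v)) Sum4_swap01 Sum4_swap23. Qed.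

Lemma Sum4_2013 F : Sum4 (fun x y v w => F v x y w) = Sum4 F.
Proof.
by rewrite (Sum4_swap12 (fun x v y w => F v x y w)) (Sum4_swap01 F).
Qed.

Lemma Sum4_3012 F : Sum4 (fun x y v w => F w x y v) = Sum4 F.
Proof.
by rewrite (Sum4_swap23 (fun x y w v => F w x y v)) (Sum4_2013 F).
Qed.

Lemma sum_constV (c : R) : \sum_(v : V) c = #|V|%:R * c.
Proof. by rewrite sumr_const mulr_natl. Qed.

Lemma Sum5_const234 (G : V -> V -> R) :
  Sum5 (fun x y _ _ _ => G x y) = #|V|%:R ^+ 3 * \sum_x \sum_y G x y.
Proof.
rewrite /Sum5 mulr_sumr; apply: eq_bigr => x _; rewrite mulr_sumr.
by apply: eq_bigr => y _; rewrite !sum_constV; ring.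
Qed.

Lemma Sum5_const34 (G : V -> V -> V -> R) :
  Sum5 (fun x y z _ _ => G x y z) = #|V|%:R ^+ 2 * \sum_x \sum_y \sum_z G x y z.
Proof.
rewrite /Sum5 mulr_sumr; apply: eq_bigr => x _; rewrite mulr_sumr.
apply: eq_bigr => y _; rewrite mulr_sumr.
by apply: eq_bigr => z _; rewrite !sum_constV; ring.
Qed.

Lemma Sum5_swap23 (G : V -> V -> V -> V -> V -> R) :
  Sum5 (fun x y z w c => G x y w z c) = Sum5 G.
Proof. by do 2 apply: eq_bigr => ? _; rewrite exchange_big. Qed.

Lemma Sum5_swap34 (G : V -> V -> V -> V -> V -> R) :
  Sum5 (fun x y z w c => G x y z c w) = Sum5 G.
Proof. by do 3 apply: eq_bigr => ? _; rewrite exchange_big. Qed.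

Lemma Sum5_swap12 (G : V -> V -> V -> V -> V -> R) :
  Sum5 (fun x y z w c => G x z y w c) = Sum5 G.
Proof. by apply: eq_bigr => ? _; rewrite exchange_big. Qed.

Lemma Sum5_swap01 (G : V -> V -> V -> V -> V -> R) :
  Sum5 (fun x y z w c => G y x z w c) = Sum5 G.
Proof. by rewrite /Sum5 exchange_big. Qed.

Lemma Sum5_const24 (G : V -> V -> V -> R) :
  Sum5 (fun x y _ w _ => G x y w) = #|V|%:R ^+ 2 * \sum_x \sum_y \sum_z G x y z.
Proof. by rewrite (Sum5_swap23 (fun x y w _ _ => G x y w)) Sum5_const34. Qed.

Lemma Sum5_const23 (G : V -> V -> V -> R) :
  Sum5 (fun x y _ _ c => G x y c) = #|V|%:R ^+ 2 * \sum_x \sum_y \sum_z G x y z.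
Proof. by rewrite (Sum5_swap34 (fun x y _ c _ => G x y c)) Sum5_const24. Qed.

Lemma Sum5_const12 (G : V -> V -> V -> R) :
  Sum5 (fun x _ _ w c => G w c x) = #|V|%:R ^+ 2 * \sum_x \sum_y \sum_z G x y z.
Proof.
rewrite (Sum5_swap23 (fun x _ w _ c => G w c x)).
rewrite (Sum5_swap34 (fun x _ w c _ => G w c x)).
rewrite (Sum5_swap12 (fun x w _ c _ => G w c x)).
rewrite (Sum5_swap23 (fun x w c _ _ => G w c x)).
rewrite (Sum5_swap01 (fun w x c _ _ => G w c x)).
by rewrite (Sum5_swap12 (fun w c x _ _ => G w c x)) Sum5_const34.
Qed.

Lemma Sum5_const012 (G : V -> V -> R) :
  Sum5 (fun _ _ _ w c => G w c) = #|V|%:R ^+ 3 * \sum_x \sum_y G x y.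
Proof.
rewrite (Sum5_const12 (fun w c _ => G w c)) [_ ^+ 3]exprSr -mulrA; congr (_ * _).
rewrite mulr_sumr; apply: eq_bigr => x _; rewrite mulr_sumr.
by apply: eq_bigr => y _; rewrite sum_constV.
Qed.

Lemma ler_Sum5 (F G : V -> V -> V -> V -> V -> R) :
  (forall x y z w c, F x y z w c <= G x y z w c) -> Sum5 F <= Sum5 G.
Proof. by move=> FG; do 5 apply: ler_sum => ? _. Qed.

End FourPerm.

Section Base.
Variables (R : realFieldType) (V : finType) (e : rel V).
Hypothesis esym : symmetric e.
Local Notation n := (#|V|%:R : R).

Variable eps : R.
Hypothesis eps_gt0 : 0 < eps.
Hypothesis n_gt0 : 0 < n.
Hypothesis near_extremal :
  72 * n ^+ 5 - 2304 * (n * hom_count R e) <= eps ^+ 2 * n ^+ 5.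

(** Seen from an edge xy of a blow-up of K2 + K2, [a] is the class of y, [b] the class of x and [o]
    the other component. The pairs listed are those that contradict this picture; common neighbours
    of x and y are left to [common_nbrs]. *)
Definition wrong_at (x y v w : V) :=
  let a v := e x v && ~~ e y v in
  let b v := ~~ e x v && e y v in
  let o v := ~~ e x v && ~~ e y v in
  [|| [&& a v, a w & e v w], [&& b v, b w & e v w], [&& a v, b w & ~~ e v w],
      [&& b v, a w & ~~ e v w], [&& a v || b v, o w & e v w]
    | [&& o v, a w || b w & e v w]].

Definition wrong_pairs x y : R := \sum_v \sum_w (wrong_at x y v w)%:R.

(** A wrong pair spans with xy a paw, if it is an edge inside [a] or [b], and a P4 otherwise. The
    eight summands are the placements of these graphs. *)
Lemma wrong_pairs_sum :
  \sum_x \sum_y (e x y)%:R * wrong_pairs x y <= 8 * (eps * n ^+ 4).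
Proof.
have p4 := P4_count esym eps_gt0 n_gt0 near_extremal.
have paw := paw_count esym eps_gt0 n_gt0 near_extremal.
have -> : \sum_x \sum_y (e x y)%:R * wrong_pairs x y =
    Sum4 (fun x y v w => (e x y && wrong_at x y v w)%:R) :> R.
  apply: eq_bigr => x _; apply: eq_bigr => y _; rewrite mulr_sumr.
  apply: eq_bigr => v _; rewrite mulr_sumr; apply: eq_bigr => w _.
  by rewrite -natrM mulnb.
apply: (@le_trans _ _ (Sum4 (fun x y v w =>
   (paw_at e v w x y)%:R + (paw_at e v w y x)%:R + (P4_at e v x y w)%:R
   + (P4_at e w x y v)%:R + (P4_at e w v x y)%:R + (P4_at e w v y x)%:R
   + (P4_at e v w x y)%:R + (P4_at e v w y x)%:R : R))).
  apply: ler_Sum4 => x y v w; rewrite -!natrD ler_nat.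
  rewrite /paw_at /P4_at /wrong_at.
  rewrite (esym v x) (esym w x) (esym v y) (esym w y) (esym w v) (esym y x).
  by case: (e x y); case: (e x v); case: (e x w); case: (e y v); case: (e y w);
     case: (e v w).
rewrite !Sum4D.
rewrite (Sum4_2301 (fun x y v w => (paw_at e x y v w)%:R)).
rewrite (Sum4_2310 (fun x y v w => (paw_at e x y v w)%:R)).
rewrite (Sum4_2013 (fun x y v w => (P4_at e x y v w)%:R)).
rewrite (Sum4_3012 (fun x y v w => (P4_at e x y v w)%:R)).
rewrite (Sum4_3201 (fun x y v w => (P4_at e x y v w)%:R)).
rewrite (Sum4_3210 (fun x y v w => (P4_at e x y v w)%:R)).
rewrite (Sum4_2301 (fun x y v w => (P4_at e x y v w)%:R)).
rewrite (Sum4_2310 (fun x y v w => (P4_at e x y v w)%:R)).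
lra.
Qed.

Definition common_nbrs x y : R := \sum_v (e x v && e y v)%:R.

(** Let xyz be an induced path and v a common neighbour of x and y. If v is adjacent to z the four
    vertices span a diamond, otherwise a paw. Triangles as such are not penalised by the slack,
    which is why the edge xy is averaged together with a path through it. *)
Lemma common_nbrs_sum :
  \sum_x \sum_y \sum_z (P3_type (e x y) (e x z) (e y z))%:R * common_nbrs x y
  <= 2 * (eps * n ^+ 4).
Proof.
have dia := diamond_count esym eps_gt0 n_gt0 near_extremal.
have paw := paw_count esym eps_gt0 n_gt0 near_extremal.
have -> : \sum_x \sum_y \sum_z (P3_type (e x y) (e x z) (e y z))%:R * common_nbrs x y =
    Sum4 (fun x y z v => (P3_type (e x y) (e x z) (e y z) && (e x v && e y v))%:R) :> R.
  do 3 apply: eq_bigr => ? _; rewrite mulr_sumr.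
  by apply: eq_bigr => v _; rewrite -natrM mulnb.
apply: (@le_trans _ _ (Sum4 (fun x y z v =>
   (diamond_at e v y x z)%:R + (paw_at e x v y z)%:R : R))).
  apply: ler_Sum4 => x y z v; rewrite -!natrD ler_nat /diamond_at /paw_at /P3_type.
  rewrite (esym v x) (esym v y) (esym y x).
  by case: (e x y); case: (e x z); case: (e y z); case: (e x v); case: (e y v);
     case: (e v z).
rewrite Sum4D (_ : Sum4 (fun x y z v => (diamond_at e v y x z)%:R) =
  Sum4 (fun x y v z => (diamond_at e x y v z)%:R)); last first.
  rewrite (Sum4_swap23 (fun x y v z => (diamond_at e v y x z)%:R)).
  rewrite (Sum4_swap12 (fun x v y z => (diamond_at e v y x z)%:R)).
  rewrite (Sum4_swap01 (fun v x y z => (diamond_at e v y x z)%:R)).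
  by rewrite (Sum4_swap12 (fun v y x z => (diamond_at e v y x z)%:R)).
rewrite (_ : Sum4 (fun x y z v => (paw_at e x v y z)%:R) =
  Sum4 (fun x y v z => (paw_at e x y v z)%:R)); last first.
  rewrite (Sum4_swap23 (fun x y v z => (paw_at e x v y z)%:R)).
  by rewrite (Sum4_swap12 (fun x v y z => (paw_at e x v y z)%:R)).
lra.
Qed.

(** The colouring is read off from the edges xy and wc. The vertex z is there only to make xyz an
    induced path, so that [common_nbrs_sum] applies to xy. *)
Definition base (x y z w c : V) :=
  [&& e x y, e y z, ~~ e x z, e w c, ~~ e x w, ~~ e y w, ~~ e x c & ~~ e y c].

Definition penalty (x y w c : V) : R :=
  wrong_pairs x y + wrong_pairs w c
  + n * (common_nbrs x y + `|ext R e diff12 x y w| + `|ext R e diff30 x y w|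
         + `|ext R e diff30 x y c| + `|ext R e diff30 w c x| + `|ext R e path_ext x y c|).

(** The constant is 8 for each of the two [wrong_pairs], 2 for [common_nbrs] and 1 for each of the
    five extension terms. *)
Lemma penalty_sum :
  Sum5 (fun x y z w c => (base x y z w c)%:R * penalty x y w c) <= 23 * eps * n ^+ 7.
Proof.
case: (sos_parts esym eps_gt0 n_gt0 near_extremal) => d12 d30 pe _ _.
have wp := wrong_pairs_sum; have cn := common_nbrs_sum.
have wp0 x y : 0 <= wrong_pairs x y by do 2 apply: sumr_ge0 => ? _.
have cn0 x y : 0 <= common_nbrs x y by apply: sumr_ge0 => ? _.
apply: (@le_trans _ _ (Sum5 (fun x y z w c =>
    (e x y)%:R * wrong_pairs x y + (e w c)%:R * wrong_pairs w c
    + n * ((P3_type (e x y) (e x z) (e y z))%:R * common_nbrs x y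
    + (K2K1_type (e x y) (e x w) (e y w))%:R * `|ext R e diff12 x y w|
    + (K2K1_type (e x y) (e x w) (e y w))%:R * `|ext R e diff30 x y w|
    + (K2K1_type (e x y) (e x c) (e y c))%:R * `|ext R e diff30 x y c|
    + (K2K1_type (e w c) (e w x) (e c x))%:R * `|ext R e diff30 w c x|
    + (K2K1_type (e x y) (e x c) (e y c))%:R * `|ext R e path_ext x y c|)))).
  apply: ler_Sum5 => x y z w c; have [|_] := boolP (base x y z w c).
    rewrite /base; case/and5P=> -> -> /negbTE-> -> /and4P[/negbTE xw /negbTE-> /negbTE
      xc /negbTE->].
    by rewrite (esym w x) (esym c x) xw xc /= !mul1r.
  by rewrite mul0r addr_ge0 ?addr_ge0 ?mulr_ge0 ?addr_ge0 ?mulr_ge0 // ltW.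
rewrite !Sum5D Sum5Z !Sum5D.
rewrite Sum5_const234 Sum5_const012 Sum5_const34.
rewrite (Sum5_const24 (fun x y w => (K2K1_type (e x y) (e x w) (e y w))%:R * `|ext R e
  diff12 x y w|)).
rewrite (Sum5_const24 (fun x y w => (K2K1_type (e x y) (e x w) (e y w))%:R * `|ext R e
  diff30 x y w|)).
rewrite (Sum5_const23 (fun x y w => (K2K1_type (e x y) (e x w) (e y w))%:R * `|ext R e
  diff30 x y w|)).
rewrite (Sum5_const23 (fun x y w => (K2K1_type (e x y) (e x w) (e y w))%:R * `|ext R e
  path_ext x y w|)).
rewrite (Sum5_const12 (fun x y w => (K2K1_type (e x y) (e x w) (e y w))%:R * `|ext R e
  diff30 x y w|)).
move: d12; rewrite /typed_sum; set s1 := (X in is_true (X <= _) -> _) => d12.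
move: d30; rewrite /typed_sum; set s2 := (X in is_true (X <= _) -> _) => d30.
move: pe; rewrite /typed_sum; set s3 := (X in is_true (X <= _) -> _) => pe.
move: wp; rewrite /typed_sum; set s4 := (X in is_true (X <= _) -> _) => wp.
move: cn; rewrite /typed_sum; set s5 := (X in is_true (X <= _) -> _) => cn.
have n3 : 0 <= n ^+ 3 by rewrite exprn_ge0 // ltW.
apply: (@le_trans _ _ (n ^+ 3 * (s4 + s4 + s5 + s1 + s2 + s2 + s2 + s3))).
  by rewrite -/s1 -/s2 -/s3 -/s4 -/s5 le_eqVlt; apply/orP; left; apply/eqP; ring.
have -> : 23 * eps * n ^+ 7 = n ^+ 3 * (23 * (eps * n ^+ 4)) by ring.
by rewrite ler_wpM2l //; lra.
Qed.

End Base.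

(** * Colourings and near-extremal graphs *)

Lemma adj_K2_K2 (i j : 'I_4) :
  adj K2_K2 i j = ((val i, val j) \in [:: (0, 1); (1, 0); (2, 3); (3, 2)]%N).
Proof.
rewrite adj_graph_of_rel.
by case: i => [[|[|[|[|//]]]] ?]; case: j => [[|[|[|[|//]]]] ?].
Qed.

Section Colouring.
Variables (R : realFieldType) (V : finType) (e : rel V).
Hypothesis esym : symmetric e.
Local Notation n := (#|V|%:R : R).

Definition mismatch (col : V -> 'I_4) (v w : V) : bool :=
  e v w != adj K2_K2 (col v) (col w).

Definition mismatches (col : V -> 'I_4) : nat := \sum_v \sum_w mismatch col v w.

(* The arguments are the adjacencies of a vertex to x, y, w and c, where xy and
   wc are edges with no edge between them. *)
Definition colour4 (a b c d : bool) : 'I_4 :=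
  if a (+) b then inord b else inord (d && ~~ c).+2.

(** Pairs meeting the colours 0 and 1 are judged by the edge xy, pairs inside the colours 2 and 3 by
    the edge wc. A bad vertex fits none of the four classes and gets 2 or 3 by default. *)
Lemma mismatch_colour4 (x y w c v v' : V) :
  let col v := colour4 (e x v) (e y v) (e w v) (e c v) in
  let bad v := (e x v && e y v) || [&& ~~ e x v, ~~ e y v & e w v == e c v] in
  (mismatch col v v' <=
     bad v + bad v' + wrong_at e x y v v' + wrong_at e w c v v')%N.
Proof.
rewrite /mismatch /wrong_at /colour4 adj_K2_K2 /=.
by case: (e v v'); case: (e x v); case: (e y v); case: (e x v'); case: (e y v');
  case: (e w v); case: (e c v); case: (e w v'); case: (e c v');
  rewrite //= !inordK.
Qed.

Lemma bad_count (x y w c : V) :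
  \sum_v ((e x v && e y v) || [&& ~~ e x v, ~~ e y v & e w v == e c v])%:R
  <= 3 * (common_nbrs R e x y + `|ext R e diff12 x y w| + `|ext R e diff30 x y w|
         + `|ext R e diff30 x y c| + `|ext R e diff30 w c x| + `|ext R e path_ext x y c|).
Proof.
(* Among the vertices adjacent to neither x nor y, let p be the number adjacent to both w and c, and
   q the number adjacent to none. The last line equals p - q. The bracket before it is at least q
   minus the number of common neighbours of x and y, so twice the bracket turns p - q into at least
   p + q, up to common neighbours. The resulting inequality holds vertex by vertex. *)
apply: (@le_trans _ _ (3 * common_nbrs R e x y
   + 2 * (ext R e diff12 x y w - ext R e diff30 w c x + ext R e path_ext x y c)
   + 2^-1 * (ext R e diff30 x y w + ext R e diff30 x y c))); last first.
  have := ler_norm (ext R e diff12 x y w); have := ler_norm (ext R e path_ext x y c).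
  have := ler_norm (ext R e diff30 x y w); have := ler_norm (ext R e diff30 x y c).
  have := ler_norm (- ext R e diff30 w c x); rewrite normrN.
  have := normr_ge0 (ext R e diff12 x y w); have := normr_ge0 (ext R e path_ext x y c).
  have := normr_ge0 (ext R e diff30 x y w); have := normr_ge0 (ext R e diff30 x y c).
  have := normr_ge0 (ext R e diff30 w c x).
  lra.
rewrite ext_diff12 !ext_diff30 ext_path_ext /common_nbrs.
set rhs := (X in _ <= X).
pose p a b c x y z v : R := (adj_pattern e a b c x y z v)%:R.
have -> : rhs = \sum_v (3 * (e x v && e y v)%:R
    + 2 * (p true false false x y w v - p false true false x y w v
           - (p false false true w c x v - p false false false w c x v)
           + (p true false true x y c v + p false true true x y c v))
    + 2^-1 * (p false false true x y w v - p false false false x y w v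
              + (p false false true x y c v - p false false false x y c v))).
  by rewrite !big_split /= -!mulr_sumr !(big_split, sumrN).
rewrite {}/p /adj_pattern.
apply: ler_sum => v _.
by case: (e x v); case: (e y v); case: (e w v); case: (e c v) => /=; lra.
Qed.

Variable eps : R.
Hypothesis eps_gt0 : 0 < eps.
Hypothesis n_gt0 : 0 < n.
Hypothesis near_extremal :
  72 * n ^+ 5 - 2304 * (n * hom_count R e) <= eps ^+ 2 * n ^+ 5.

(** Many induced paths xyz have many vertices w and c adjacent to neither x nor y. Since [diff30] is
    small on average, about as many c are adjacent to w as are not, so about half of these pairs wc
    are edges. *)
Lemma base_sum : eps <= 1 ->
  n ^+ 5 <= 64 * 128 * Sum5 (fun x y z w c => (base e x y z w c)%:R)
            + 64 * 64 * (eps * n ^+ 5).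
Proof.
move=> eps1; case: (sos_parts esym eps_gt0 n_gt0 near_extremal) => _ d30 _ _ _.
pose O (x y : V) : R := \sum_c (~~ e x c && ~~ e y c)%:R.
pose P3 x y z : R := (P3_type (e x y) (e x z) (e y z))%:R.
have n5 : 0 < n ^+ 5 by rewrite exprn_gt0.
have nT : n ^+ 5 <= 64 * (n * hom_count R e).
  have : eps ^+ 2 * n ^+ 5 <= 1 * n ^+ 5.
    by rewrite ler_wpM2r ?expr_le1 // ltW.
  move: near_extremal n5; move: (n ^+ 5) (n * _) => a b; lra.
(* Cauchy-Schwarz in tangent form: [O^2 >= (n/32) O - (n/64)^2], and the sum of [O] over induced
   paths is at least [hom_count], hence at least [n^4/64]. *)
have O2 : n ^+ 5 <= 64 * 64 * \sum_x \sum_y \sum_z P3 x y z * O x y ^+ 2.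
  have : \sum_x \sum_y \sum_z (n / 32 * (P3 x y z * \sum_w [&& ~~ e x w, ~~ e y w
    & ~~ e z w]%:R) - (n / 64) ^+ 2)
     <= \sum_x \sum_y \sum_z P3 x y z * O x y ^+ 2.
    do 3 apply: ler_sum => ? _; rewrite /P3; case: (P3_type _ _ _); last first.
      by rewrite !mul0r mulr0 sub0r oppr_le0 sqr_ge0.
    rewrite !mul1r; set r := \sum_w _; set o := O _ _.
    have ro : r <= o.
      by apply: ler_sum => w _; rewrite ler_nat; case: (e _ w); case: (e _ w);
        case: (e _ w).
    have : n / 32 * r <= n / 32 * o by rewrite ler_wpM2l // ltW // divr_gt0.
    have := sqr_ge0 (o - n / 64); rewrite sqrrB; lra.
  under eq_bigr do under eq_bigr do rewrite sumrB sum_constV -mulr_sumr.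
  under eq_bigr do rewrite sumrB sum_constV -mulr_sumr.
  rewrite sumrB sum_constV -mulr_sumr.
  have -> : \sum_x \sum_y \sum_z P3 x y z * \sum_w [&& ~~ e x w, ~~ e y w & ~~ e z w]%:R
    = hom_count R e.
    do 3 apply: eq_bigr => ? _; rewrite mulr_sumr; apply: eq_bigr => w _.
    rewrite /P3 /P3_type -natrM mulnb; congr (nat_of_bool _)%:R.
    by rewrite -!andbA; case: (e _ _); rewrite //= andbCA.
  have -> : n * (n * (n * (n / 64) ^+ 2)) = n ^+ 5 / 64 / 64 by field.
  lra.
pose D x y w : R := (K2K1_type (e x y) (e x w) (e y w))%:R * `|ext R e diff30 x y w|.
(* For fixed x, y, z, w, the c not adjacent to x or y number [O x y], and those adjacent to w exceed
   half of them up to half of [|diff30|]. *)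
have : Sum4 (fun x y z w => P3 x y z * ((~~ e x w && ~~ e y w)%:R * O x y) - D x y w)
   <= 2 * Sum5 (fun x y z w c => (base e x y z w c)%:R).
  rewrite /Sum4 /Sum5 mulr_sumr; apply: ler_sum => x _; rewrite mulr_sumr.
  apply: ler_sum => y _; rewrite mulr_sumr; apply: ler_sum => z _.
  rewrite mulr_sumr; apply: ler_sum => w _.
  have [|] := boolP [&& e x y, e y z, ~~ e x z, ~~ e x w & ~~ e y w].
    case/and5P=> xy yz xz xw yw.
    rewrite /P3 /D /P3_type /K2K1_type /base xy yz xz xw yw /= !mul1r.
    have := ler_norm (- ext R e diff30 x y w); rewrite normrN.
    rewrite ext_diff30 => h; rewrite lerBlDr -lerBlDl.
    apply: le_trans h; rewrite opprB.
    rewrite /O mulr_sumr -!sumrB; apply: ler_sum => c _; rewrite /adj_pattern.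
    by case: (e x c); case: (e y c); case: (e w c) => /=; lra.
  move=> h; apply: (@le_trans _ _ 0); last by rewrite mulr_ge0 // sumr_ge0.
  rewrite subr_le0 (_ : P3 x y z * _ = 0) ?mulr_ge0 //.
  rewrite /P3 /P3_type; move: h; case: (e x y); case: (e y z); case: (e x z);
    by case: (e x w); case: (e y w); rewrite /= ?(mul0r, mulr0).
have -> : Sum4 (fun x y z w => P3 x y z * ((~~ e x w && ~~ e y w)%:R * O x y) - D x y w) =
    (\sum_x \sum_y \sum_z P3 x y z * O x y ^+ 2) - n * typed_sum e K2K1_type (fun x y
      w => `|ext R e diff30 x y w|).
  rewrite /Sum4 /typed_sum mulr_sumr -sumrB; apply: eq_bigr => x _.
  rewrite mulr_sumr -sumrB; apply: eq_bigr => y _.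
  rewrite -sum_constV -sumrB; apply: eq_bigr => z _.
  by rewrite sumrB -mulr_sumr -mulr_suml expr2.
have : n * typed_sum e K2K1_type (fun x y w => `|ext R e diff30 x y w|) <= eps * n ^+ 5.
  have -> : eps * n ^+ 5 = n * (eps * n ^+ 4) by ring.
  by rewrite ler_wpM2l // ltW.
move: O2; lra.
Qed.

Lemma near_extremal_colouring : eps <= (128 * 128)^-1 ->
  exists col, (mismatches col)%:R <= 144 * 128 * 128 * eps * n ^+ 2.
Proof.
move=> epsK.
have n5 : 0 < n ^+ 5 by rewrite exprn_gt0.
have eps1 : eps <= 1 by apply: le_trans epsK _; rewrite invf_le1 ?mulr_gt0 //; lra.
have bs := base_sum eps1.
have pe : 64 * 64 * (eps * n ^+ 5) <= n ^+ 5 / 4.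
  have : (eps * n ^+ 5) <= (128 * 128)^-1 * n ^+ 5 by rewrite ler_wpM2r // ltW.
  lra.
(* Averaging: at least [3/4 * n^5 / 8192] base tuples exist, so if all had a larger penalty the
   total would be at least [36 * eps * n^7], against the bound with 23. The final constant is 144 =
   6 * 24, as each bad vertex spoils at most 2n ordered pairs and [bad_count] costs a factor 3. *)
have [[x [y [z [w [c [xyzwc pxy]]]]]]|no] := boolp.pselect (exists x y z w c,
    base e x y z w c /\ penalty R e x y w c <= 24 * 128 * 128 * eps * n ^+ 2).
  pose col v := colour4 (e x v) (e y v) (e w v) (e c v); exists col.
  pose bad v := (e x v && e y v) || [&& ~~ e x v, ~~ e y v & e w v == e c v].
  have : (mismatches col)%:R <=
      2 * (n * \sum_v (bad v)%:R) + wrong_pairs R e x y + wrong_pairs R e w c.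
    apply: (@le_trans _ _ (\sum_v \sum_v' ((bad v)%:R + (bad v')%:R
       + (wrong_at e x y v v')%:R + (wrong_at e w c v v')%:R))).
      rewrite /mismatches natr_sum; apply: ler_sum => v _.
      rewrite natr_sum; apply: ler_sum => v' _.
      by rewrite -!natrD ler_nat; exact: mismatch_colour4.
    under eq_bigr do rewrite !big_split /= sum_constV.
    rewrite !big_split /= sum_constV -mulr_sumr.
    by rewrite le_eqVlt; apply/orP; left; apply/eqP; rewrite /wrong_pairs; ring.
  have := bad_count x y w c; rewrite -(ler_pM2l n_gt0) -/bad.
  move: pxy; rewrite /penalty.
  have : 0 <= wrong_pairs R e x y by do 2 apply: sumr_ge0 => ? _.
  have : 0 <= wrong_pairs R e w c by do 2 apply: sumr_ge0 => ? _.
  lra.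
have : 24 * 128 * 128 * eps * n ^+ 2 * Sum5 (fun x y z w c => (base e x y z w c)%:R)
    <= 23 * eps * n ^+ 7.
  apply: le_trans (penalty_sum esym eps_gt0 n_gt0 near_extremal).
  rewrite -Sum5Z; apply: ler_Sum5 => x y z w c.
  have [bxy|] := boolP (base _ _ _ _ _ _); last by rewrite mulr0 mul0r.
  rewrite mulr1 mul1r leNgt; apply/negP => /ltW h.
  by apply: no; exists x, y, z, w, c.
move: (Sum5 _) bs => b bs h; exfalso.
have en2 : 0 < eps * n ^+ 2 by rewrite mulr_gt0 // exprn_gt0.
have : eps * n ^+ 2 * (24 * 128 * 128 * b) <= eps * n ^+ 2 * (23 * n ^+ 5).
  move: h; have -> : 23 * eps * n ^+ 7 = eps * n ^+ 2 * (23 * n ^+ 5) by ring.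
  by apply: le_trans; rewrite le_eqVlt; apply/orP; left; apply/eqP; ring.
rewrite ler_pM2l //; lra.
Qed.

End Colouring.

(** * The local inequality at a vertex *)

(* The value of degree_gain, defined below, for four classes of size one and a
   vertex that misses a fraction u of the class it should see and sees fractions
   q, r and t of the other three. *)
Definition degree_loss (R : realFieldType) (u q r t : R) : R :=
  3 * u + 2 * q + r + t
  - t ^+ 2 / 2 - r ^+ 2 / 2 - 2 * q * t - 2 * q * r - 3 / 2 * q ^+ 2
  - 3 * u * t - 3 * u * r - 3 * u * q - u ^+ 2 / 2
  + t ^+ 3 / 2 + r * t ^+ 2 / 2 + r ^+ 2 * t / 2 + r ^+ 3 / 2
  + 3 / 2 * q * t ^+ 2 - 2 * q * r * t + 3 / 2 * q * r ^+ 2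
  + 3 / 2 * q ^+ 2 * t + 3 / 2 * q ^+ 2 * r + q ^+ 3 / 2
  - 3 / 2 * u * t ^+ 2 + 2 * u * r * t - 3 / 2 * u * r ^+ 2
  + 2 * u * q * t + 2 * u * q * r - u * q ^+ 2 / 2
  + 3 / 2 * u ^+ 2 * t + 3 / 2 * u ^+ 2 * r + u ^+ 2 * q / 2 - u ^+ 3 / 2.

(** The last three hypotheses say, with slack 1/20 for unequal classes, that no other colour suits
    the vertex better. Some such condition is needed: at u = q = 1, r = t = 0 the vertex merely has
    the colour of its partner class, and the value is 0. *)
Lemma degree_loss_ge (R : realFieldType) (u q r t : R) :
  0 <= u <= 1 -> 0 <= q <= 1 -> 0 <= r <= 1 -> 0 <= t <= 1 ->
  q <= 1 - u + 1 / 20 -> r <= 1 - u + 1 / 20 -> t <= 1 - u + 1 / 20 ->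
  (u + q + r + t) / 10 <= degree_loss u q r t.
Proof.
case/andP=> u0 u1 /andP[q0 q1] /andP[r0 r1] /andP[t0 t1] hq hr ht.
(* The difference is a nonnegative combination of the products below, which were
   selected by linear programming. *)
rewrite /degree_loss.
have {u1} : 0 <= 1 - u by lra.
have {q1} : 0 <= 1 - q by lra.
have {r1} : 0 <= 1 - r by lra.
have {t1} : 0 <= 1 - t by lra.
have {hq} : 0 <= 21 / 20 - u - q by lra.
have {hr} : 0 <= 21 / 20 - u - r by lra.
have {ht} : 0 <= 21 / 20 - u - t by lra.
set pt := 21 / 20 - u - t; set pr := 21 / 20 - u - r; set pq := 21 / 20 - u - q.
set t' := 1 - t; set r' := 1 - r; set q' := 1 - q; set u' := 1 - u.
move=> ht hr hq t1 r1 q1 u1.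
have h0 : 0 <= r' * u by rewrite !mulr_ge0.
have h1 : 0 <= t' * u by rewrite !mulr_ge0.
have h2 : 0 <= q' * r' * u by rewrite !mulr_ge0.
have h3 : 0 <= q' * t' * u by rewrite !mulr_ge0.
have h4 : 0 <= q' * pr * r by rewrite !mulr_ge0.
have h5 : 0 <= q' * pt * t by rewrite !mulr_ge0.
have h6 : 0 <= r' * r' * r by rewrite !mulr_ge0.
have h7 : 0 <= t' * t' * t by rewrite !mulr_ge0.
have h8 : 0 <= r' * pr * q by rewrite !mulr_ge0.
have h9 : 0 <= t' * pt * q by rewrite !mulr_ge0.
have h10 : 0 <= r' * pt * u by rewrite !mulr_ge0.
have h11 : 0 <= t' * pr * u by rewrite !mulr_ge0.
have h12 : 0 <= r' * u * u by rewrite !mulr_ge0.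
have h13 : 0 <= t' * u * u by rewrite !mulr_ge0.
have h14 : 0 <= q * q * r by rewrite !mulr_ge0.
have h15 : 0 <= q * q * t by rewrite !mulr_ge0.
have h16 : 0 <= q' * q' * r' * q by rewrite !mulr_ge0.
have h17 : 0 <= q' * q' * t' * q by rewrite !mulr_ge0.
have h18 : 0 <= q' * q' * r' * r by rewrite !mulr_ge0.
have h19 : 0 <= q' * q' * t' * t by rewrite !mulr_ge0.
have h20 : 0 <= q' * q' * pr * r by rewrite !mulr_ge0.
have h21 : 0 <= q' * q' * pt * t by rewrite !mulr_ge0.
have h22 : 0 <= q' * q' * r * t by rewrite !mulr_ge0.
have h23 : 0 <= q' * r' * r' * q by rewrite !mulr_ge0.
have h24 : 0 <= q' * t' * t' * q by rewrite !mulr_ge0.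
have h25 : 0 <= q' * r' * r' * r by rewrite !mulr_ge0.
have h26 : 0 <= q' * t' * t' * t by rewrite !mulr_ge0.
have h27 : 0 <= q' * r' * pt * u by rewrite !mulr_ge0.
have h28 : 0 <= q' * t' * pr * u by rewrite !mulr_ge0.
have h29 : 0 <= q' * r' * r * u by rewrite !mulr_ge0.
have h30 : 0 <= q' * t' * t * u by rewrite !mulr_ge0.
have h31 : 0 <= q' * r' * u * u by rewrite !mulr_ge0.
have h32 : 0 <= q' * t' * u * u by rewrite !mulr_ge0.
have h33 : 0 <= q' * r * r * t by rewrite !mulr_ge0.
have h34 : 0 <= q' * t * t * r by rewrite !mulr_ge0.
have h35 : 0 <= r' * r' * t' * r by rewrite !mulr_ge0.
have h36 : 0 <= t' * t' * r' * t by rewrite !mulr_ge0.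
have h37 : 0 <= r' * r' * pq * q by rewrite !mulr_ge0.
have h38 : 0 <= t' * t' * pq * q by rewrite !mulr_ge0.
have h39 : 0 <= r' * r' * r * u by rewrite !mulr_ge0.
have h40 : 0 <= t' * t' * t * u by rewrite !mulr_ge0.
have h41 : 0 <= r' * t' * r * u by rewrite !mulr_ge0.
have h42 : 0 <= t' * r' * t * u by rewrite !mulr_ge0.
have h43 : 0 <= r' * pq * q * u by rewrite !mulr_ge0.
have h44 : 0 <= t' * pq * q * u by rewrite !mulr_ge0.
have h45 : 0 <= r' * pq * u * u by rewrite !mulr_ge0.
have h46 : 0 <= t' * pq * u * u by rewrite !mulr_ge0.
have h47 : 0 <= r' * pr * q * t by rewrite !mulr_ge0.
have h48 : 0 <= t' * pt * q * r by rewrite !mulr_ge0.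
have h49 : 0 <= r' * q * q * t by rewrite !mulr_ge0.
have h50 : 0 <= t' * q * q * r by rewrite !mulr_ge0.
have h51 : 0 <= r' * r * u * u by rewrite !mulr_ge0.
have h52 : 0 <= t' * t * u * u by rewrite !mulr_ge0.
have h53 : 0 <= u' * u' * u' * r by rewrite !mulr_ge0.
have h54 : 0 <= u' * u' * u' * t by rewrite !mulr_ge0.
have h55 : 0 <= u' * u' * r * r by rewrite !mulr_ge0.
have h56 : 0 <= u' * u' * t * t by rewrite !mulr_ge0.
have h57 : 0 <= u' * r * r * r by rewrite !mulr_ge0.
have h58 : 0 <= u' * t * t * t by rewrite !mulr_ge0.
have h59 : 0 <= pq * pq * pq * r by rewrite !mulr_ge0.
have h60 : 0 <= pq * pq * pq * t by rewrite !mulr_ge0.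
have h61 : 0 <= pq * r * r * t by rewrite !mulr_ge0.
have h62 : 0 <= pq * t * t * r by rewrite !mulr_ge0.
have h63 : 0 <= pr * pr * q * t by rewrite !mulr_ge0.
have h64 : 0 <= pt * pt * q * r by rewrite !mulr_ge0.
have h65 : 0 <= q * q * q * r by rewrite !mulr_ge0.
have h66 : 0 <= q * q * q * t by rewrite !mulr_ge0.
have h67 : 0 <= q * q * r * r by rewrite !mulr_ge0.
have h68 : 0 <= q * q * t * t by rewrite !mulr_ge0.
have h69 : 0 <= q * r * r * r by rewrite !mulr_ge0.
have h70 : 0 <= q * t * t * t by rewrite !mulr_ge0.
have h71 : 0 <= r * r * r * t by rewrite !mulr_ge0.
have h72 : 0 <= t * t * t * r by rewrite !mulr_ge0.
subst pt pr pq t' r' q' u'.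
lra.
Qed.

Section WeightedDegree.
Variable R : realFieldType.
Implicit Types a b s t u q r x y m : R.

(** The number of labelled copies of P3 + K1, degenerate ones included, through a vertex that sees
    a_i and misses b_i vertices of class i, in a blow-up whose joined classes are 1, 2 and 3, 4. *)
Definition degree_poly a1 a2 a3 a4 b1 b2 b3 b4 : R :=
  b1 * b2 * (b1 + b2) + b3 * b4 * (b3 + b4)
  + a1 ^+ 2 * (b1 + b3 + b4) + a2 ^+ 2 * (b2 + b3 + b4)
  + a3 ^+ 2 * (b3 + b1 + b2) + a4 ^+ 2 * (b4 + b1 + b2)
  + 2 * (a1 * a3 * (b1 + b3) + a1 * a4 * (b1 + b4)
         + a2 * a3 * (b2 + b3) + a2 * a4 * (b2 + b4))
  + 2 * ((a1 * b2 + a2 * b1) * (b3 + b4) + (a3 * b4 + a4 * b3) * (b1 + b2)).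

(** The vertex belongs to class 2, so it should see exactly class 1. *)
Definition degree_gain s1 s2 s3 s4 a1 a2 a3 a4 : R :=
  degree_poly s1 0 0 0 0 s2 s3 s4
  - degree_poly a1 a2 a3 a4 (s1 - a1) (s2 - a2) (s3 - a3) (s4 - a4).

Lemma prod3_near1 x y z d :
  `|x - 1| <= d -> `|y - 1| <= d -> `|z - 1| <= d -> d <= 1 / 16 ->
  `|x * y * z - 1| <= 4 * d.
Proof.
move=> hx hy hz hd.
have d0 : 0 <= d by exact: le_trans hx.
have -> : x * y * z - 1 = (x - 1) * (y * z) + (y - 1) * z + (z - 1) by ring.
have z1 : `|z| <= 17 / 16.
  have := ler_normD (z - 1) 1; rewrite subrK normr1; lra.
have y1 : `|y| <= 17 / 16.
  have := ler_normD (y - 1) 1; rewrite subrK normr1; lra.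
have h1 : `|(y - 1) * z| <= d * (17 / 16) by rewrite normrM ler_pM.
have h2 : `|(x - 1) * (y * z)| <= d * (17 / 16 * (17 / 16)).
  by rewrite normrM ler_pM // normrM ler_pM.
have := ler_normD ((x - 1) * (y * z) + (y - 1) * z) (z - 1).
have := ler_normD ((x - 1) * (y * z)) ((y - 1) * z).
lra.
Qed.

Lemma near1_mulr S x e D : `|S - 1| <= e -> `|x| <= 4 * D -> x - 4 * e * D <= S * x.
Proof.
move=> hS hx; have : `|(S - 1) * x| <= e * (4 * D) by rewrite normrM ler_pM.
have := ler_norm (- ((S - 1) * x)); rewrite normrN; lra.
Qed.

Lemma norm_prod3 x y z e : 0 <= x <= 1 -> 0 <= y <= 1 -> 0 <= z <= e ->
  `|x * y * z| <= e.
Proof.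
move=> /andP[x0 x1] /andP[y0 y1] /andP[z0 ze].
rewrite ger0_norm ?mulr_ge0 //; apply: le_trans ze.
by rewrite ler_piMl // mulr_ile1.
Qed.

Lemma norm_1Bprod3 x y z : 0 <= x <= 1 -> 0 <= y <= 1 -> 0 <= z <= 1 ->
  `|1 - x * y * z| <= (1 - x) + (1 - y) + (1 - z).
Proof.
move=> /andP[x0 x1] /andP[y0 y1] /andP[z0 z1].
rewrite ger0_norm ?subr_ge0 ?mulr_ile1 ?mulr_ge0 //.
have : 0 <= (1 - x) * (1 - y) by rewrite mulr_ge0 ?subr_ge0.
have : 0 <= (1 - x * y) * (1 - z) by rewrite mulr_ge0 ?subr_ge0 // mulr_ile1.
lra.
Qed.

Lemma norm_sum2 x y e : `|x| <= e -> `|y| <= e -> `|- (x + 2 * y)| <= 4 * e.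
Proof.
move=> hx hy; rewrite normrN; have := ler_normD x (2 * y).
by rewrite normrM (ger0_norm (ler0n R 2)); have := normr_ge0 y; lra.
Qed.

Lemma norm_le4 x e : `|x| <= e -> `|- x| <= 4 * e.
Proof. by rewrite normrN; have := normr_ge0 x; lra. Qed.

Lemma norm_cross x y z w e : 0 <= x <= e -> 0 <= y <= e -> 0 <= z <= 1 -> 0 <= w <= 1 ->
  forall v, 0 <= v <= 1 -> `|- (2 * ((x * z + y * w) * v))| <= 4 * e.
Proof.
move=> hx hy hz hw v hv; rewrite normrN.
have -> : 2 * ((x * z + y * w) * v) = 2 * (z * v * x) + 2 * (w * v * y) by ring.
have := ler_normD (2 * (z * v * x)) (2 * (w * v * y)).
have := norm_prod3 hz hv hx; have := norm_prod3 hw hv hy.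
rewrite !(normrM 2) !(ger0_norm (ler0n R 2)); lra.
Qed.

Lemma norm_1Bsquare2 x y e : 0 <= x <= 1 -> 0 <= y <= 1 -> x + y <= e ->
  `|1 - (1 - x) * (1 - x) * (1 - y)| <= 4 * e.
Proof.
move=> hx hy hz.
have hx' : 0 <= 1 - x <= 1 by lra.
have hy' : 0 <= 1 - y <= 1 by lra.
have := norm_1Bprod3 hx' hx' hy'; lra.
Qed.

Lemma norm_1Bsquare x y e : 0 <= x <= 1 -> 0 <= y <= 1 -> x + y <= e ->
  `|1 - (1 - x) * (1 - x) * (1 - y) - 2 * ((1 - x) * y * x)| <= 4 * e.
Proof.
move=> hx hy hz.
have hx' : 0 <= 1 - x <= 1 by lra.
have hy' : 0 <= 1 - y <= 1 by lra.
have xx : 0 <= x <= x by lra.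
have := norm_1Bprod3 hx' hx' hy'; have := norm_prod3 hx' hy xx.
have := ler_normB (1 - (1 - x) * (1 - x) * (1 - y)) (2 * ((1 - x) * y * x)).
rewrite (normrM 2) (ger0_norm (ler0n R 2)); lra.
Qed.

Lemma norm_2Bcross x y z e : 0 <= x <= 1 -> 0 <= y <= 1 -> 0 <= z <= 1 -> x + y + z
  <= e ->
  `|2 - 2 * (((1 - x) * (1 - y) + y * x) * (1 - z))| <= 4 * e.
Proof.
move=> hx hy hz hxyz.
have hx' : 0 <= 1 - x <= 1 by lra.
have hy' : 0 <= 1 - y <= 1 by lra.
have hz' : 0 <= 1 - z <= 1 by lra.
have xx : 0 <= x <= x by lra.
have -> : 2 - 2 * (((1 - x) * (1 - y) + y * x) * (1 - z)) =
  2 * (1 - (1 - x) * (1 - y) * (1 - z)) - 2 * (y * (1 - z) * x) by ring.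
have := norm_1Bprod3 hx' hy' hz'; have := norm_prod3 hy hz' xx.
have := ler_normB (2 * (1 - (1 - x) * (1 - y) * (1 - z))) (2 * (y * (1 - z) * x)).
rewrite !(normrM 2) (ger0_norm (ler0n R 2)); lra.
Qed.

(** The gain is a combination of twenty cubic monomials in the sizes, whose coefficients are at most
    4D in absolute value, D being the total error u + q + r + t. Replacing a monomial by 1 therefore
    costs an error proportional to D, not a constant, and the linear lower bound survives. *)
Lemma degree_gain_unit d s1 s2 s3 s4 u q r t : 32 * 100 * d <= 1 ->
  `|s1 - 1| <= d -> `|s2 - 1| <= d -> `|s3 - 1| <= d -> `|s4 - 1| <= d ->
  0 <= u <= 1 -> 0 <= q <= 1 -> 0 <= r <= 1 -> 0 <= t <= 1 ->
  q <= 1 - u + 1 / 20 -> r <= 1 - u + 1 / 20 -> t <= 1 - u + 1 / 20 ->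
  (u + q + r + t) / 10 <=
  degree_gain s1 s2 s3 s4 (s1 * (1 - u)) (s2 * q) (s3 * r) (s4 * t).
Proof.
move=> dl h1 h2 h3 h4 hu hq hr ht hqu hru htu.
have d16 : d <= 1 / 16 by move: dl; clear; lra.
have loss := degree_loss_ge hu hq hr ht hqu hru htu.
move: hqu hru htu => _ _ _.
have [D eD] : exists D, D = u + q + r + t by exists (u + q + r + t).
have S x y z Del : `|x - 1| <= d -> `|y - 1| <= d -> `|z - 1| <= d ->
    `|Del| <= 4 * D -> Del - 16 * d * D <= x * y * z * Del.
  move=> hx hy hz hD; have := near1_mulr (prod3_near1 hx hy hz d16) hD.
  by clear; lra.
have small : [/\ 0 <= u <= D, 0 <= q <= D, 0 <= r <= D & 0 <= t <= D].
  by rewrite eD; move: hu hq hr ht; clear; move=> *; split; lra.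
case: small => uD qD rD tD.
have c x : 0 <= x <= 1 -> 0 <= 1 - x <= 1 by clear; lra.
have hp := c _ hu; have hq' := c _ hq; have hr' := c _ hr; have ht' := c _ ht.
have rtD : r + t <= D by rewrite eD; move: hu hq; clear; lra.
have trD : t + r <= D by rewrite addrC.
have urD : u + r <= D by rewrite eD; move: hq ht; clear; lra.
have utD : u + t <= D by rewrite eD; move: hq hr; clear; lra.
have uqrD : u + q + r <= D by rewrite eD; move: ht; clear; lra.
have uqtD : u + q + t <= D by rewrite eD; move: hr; clear; lra.
have D0 : 0 <= D by move: rtD hr ht; clear; lra.
have e0 := S s1 s1 s2 _ h1 h1 h2
  (norm_le4 (norm_prod3 hu hq' uD)).
have e1 := S s1 s2 s2 _ h1 h2 h2
  (norm_le4 (norm_prod3 hq' hq' uD)).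
have e2 := S s3 s3 s4 _ h3 h3 h4
  (norm_1Bsquare2 hr ht rtD).
have e3 := S s3 s4 s4 _ h3 h4 h4
  (norm_1Bsquare2 ht hr trD).
have e4 := S s1 s1 s1 _ h1 h1 h1
  (norm_le4 (norm_prod3 hp hp uD)).
have e5 := S s2 s2 s2 _ h2 h2 h2
  (norm_le4 (norm_prod3 hq' hq qD)).
have e6 := S s3 s3 s3 _ h3 h3 h3
  (norm_le4 (norm_prod3 hr' hr rD)).
have e7 := S s4 s4 s4 _ h4 h4 h4
  (norm_le4 (norm_prod3 ht' ht tD)).
have e8 := S s1 s1 s3 _ h1 h1 h3
  (norm_1Bsquare hu hr urD).
have e9 := S s1 s3 s3 _ h1 h3 h3
  (norm_sum2 (norm_prod3 hr hu rD) (norm_prod3 hp hr' rD)).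
have e10 := S s2 s2 s3 _ h2 h2 h3
  (norm_sum2 (norm_prod3 hq hr' qD) (norm_prod3 hr hq' qD)).
have e11 := S s2 s3 s3 _ h2 h3 h3
  (norm_sum2 (norm_prod3 hr hq' rD) (norm_prod3 hq hr' rD)).
have e12 := S s1 s1 s4 _ h1 h1 h4
  (norm_1Bsquare hu ht utD).
have e13 := S s1 s4 s4 _ h1 h4 h4
  (norm_sum2 (norm_prod3 ht hu tD) (norm_prod3 hp ht' tD)).
have e14 := S s2 s2 s4 _ h2 h2 h4
  (norm_sum2 (norm_prod3 hq ht' qD) (norm_prod3 ht hq' qD)).
have e15 := S s2 s4 s4 _ h2 h4 h4
  (norm_sum2 (norm_prod3 ht hq' tD) (norm_prod3 hq ht' tD)).
have e16 := S s1 s2 s3 _ h1 h2 h3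
  (norm_2Bcross hu hq hr uqrD).
have e17 := S s1 s2 s4 _ h1 h2 h4
  (norm_2Bcross hu hq ht uqtD).
have e18 := S s1 s3 s4 _ h1 h3 h4
  (norm_cross rD tD ht' hr' hu).
have e19 := S s2 s3 s4 _ h2 h3 h4
  (norm_cross rD tD ht' hr' hq').
have -> : degree_gain s1 s2 s3 s4 (s1 * (1 - u)) (s2 * q) (s3 * r) (s4 * t) =
  s1 * s1 * s2 * (- (u * (1 - q) * u))
  + s1 * s2 * s2 * (- ((1 - q) * (1 - q) * u))
  + s3 * s3 * s4 * (1 - (1 - r) * (1 - r) * (1 - t))
  + s3 * s4 * s4 * (1 - (1 - t) * (1 - t) * (1 - r))
  + s1 * s1 * s1 * (- ((1 - u) * (1 - u) * u))
  + s2 * s2 * s2 * (- ((1 - q) * q * q))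
  + s3 * s3 * s3 * (- ((1 - r) * r * r))
  + s4 * s4 * s4 * (- ((1 - t) * t * t))
  + s1 * s1 * s3 * (1 - (1 - u) * (1 - u) * (1 - r) - 2 * ((1 - u) * r * u))
  + s1 * s3 * s3 * (- (r * u * r + 2 * ((1 - u) * (1 - r) * r)))
  + s2 * s2 * s3 * (- (q * (1 - r) * q + 2 * (r * (1 - q) * q)))
  + s2 * s3 * s3 * (- (r * (1 - q) * r + 2 * (q * (1 - r) * r)))
  + s1 * s1 * s4 * (1 - (1 - u) * (1 - u) * (1 - t) - 2 * ((1 - u) * t * u))
  + s1 * s4 * s4 * (- (t * u * t + 2 * ((1 - u) * (1 - t) * t)))
  + s2 * s2 * s4 * (- (q * (1 - t) * q + 2 * (t * (1 - q) * q)))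
  + s2 * s4 * s4 * (- (t * (1 - q) * t + 2 * (q * (1 - t) * t)))
  + s1 * s2 * s3 * (2 - 2 * (((1 - u) * (1 - q) + q * u) * (1 - r)))
  + s1 * s2 * s4 * (2 - 2 * (((1 - u) * (1 - q) + q * u) * (1 - t)))
  + s1 * s3 * s4 * (- (2 * ((r * (1 - t) + t * (1 - r)) * u)))
  + s2 * s3 * s4 * (- (2 * ((r * (1 - t) + t * (1 - r)) * (1 - q)))).
  by rewrite /degree_gain /degree_poly; ring.
apply: le_trans; last first.
  do 19 (apply: lerD; last by eassumption).
  by eassumption.
(* Twenty monomials cost 16 d D each. The sum of their coefficients is twice [degree_loss], hence at
   least D/5, of which D/10 remains. *)
have : 320 * d * D <= D / 10.
  by have := ler_wpM2r D0 dl; clear; lra.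
move: loss; rewrite -eD /degree_loss; clear; lra.
Qed.

(** Both sides are homogeneous of degree 3, so m can be scaled to 1. The comparisons of [s - 2 * a]
    say that colour 2 makes at most as many errors as any other; the denominator doubles because a
    scaled class may be larger than 1. *)
Lemma degree_gain_ge m d s1 s2 s3 s4 a1 a2 a3 a4 : 0 < m -> 32 * 100 * d <= 1 ->
  `|s1 - m| <= d * m -> `|s2 - m| <= d * m -> `|s3 - m| <= d * m -> `|s4 - m| <= d * m ->
  0 <= a1 <= s1 -> 0 <= a2 <= s2 -> 0 <= a3 <= s3 -> 0 <= a4 <= s4 ->
  s1 - 2 * a1 <= s2 - 2 * a2 -> s1 - 2 * a1 <= s3 - 2 * a3 ->
  s1 - 2 * a1 <= s4 - 2 * a4 ->
  m ^+ 2 * ((s1 - a1) + a2 + a3 + a4) / 20 <= degree_gain s1 s2 s3 s4 a1 a2 a3 a4.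
Proof.
move=> m0 dl.
have scale s : `|s - m| <= d * m -> exists2 x, s = m * x & `|x - 1| <= d.
  move=> h; exists (s / m); first by rewrite mulrC divfK ?gt_eqF.
  have -> : s / m - 1 = (s - m) / m by rewrite mulrBl divff ?gt_eqF.
  by rewrite normrM normfV (gtr0_norm m0) ler_pdivrMr.
have d1 : d <= 1 / 2 by move: dl; clear; lra.
have pos x : `|x - 1| <= d -> 1 / 2 <= x.
  by rewrite ler_norml => /andP[h _]; move: h d1; clear; lra.
have unit x a : 1 / 2 <= x -> 0 <= a <= m * x -> exists2 y, a = m * (x * y) & 0 <= y <= 1.
  move=> x2 /andP[a0 ax]; have x0 : 0 < x by apply: lt_le_trans x2; rewrite divr_gt0.
  exists (a / (m * x)); first by field; rewrite !gt_eqF.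
  apply/andP; split; first by rewrite divr_ge0 // ?mulr_ge0 ?ltW.
  by rewrite ler_pdivrMr ?mulr_gt0 // mul1r.
move=> /scale[x1 -> h1] /scale[x2 -> h2] /scale[x3 -> h3] /scale[x4 -> h4].
move=> /(unit _ _ (pos _ h1))[p -> hp] /(unit _ _ (pos _ h2))[q -> hq].
move=> /(unit _ _ (pos _ h3))[r -> hr] /(unit _ _ (pos _ h4))[t -> ht].
(* The comparison would give y <= p for equal sizes; sizes within d of 1 cost a multiple of d,
   absorbed in 1/20. *)
have close x y : `|x - 1| <= d -> 0 <= y <= 1 ->
    m * x1 - 2 * (m * (x1 * p)) <= m * x - 2 * (m * (x * y)) -> y <= p + 1 / 20.
  move=> hx hy.
  rewrite (_ : m * x1 - _ = m * (x1 - 2 * (x1 * p))); last by ring.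
  rewrite (_ : m * x - _ = m * (x - 2 * (x * y))); last by ring.
  rewrite ler_pM2l // => hxy; have x0 := pos _ hx.
  have x0' : 0 < x by apply: lt_le_trans x0; rewrite divr_gt0.
  rewrite -(ler_pM2l x0') mulrDr.
  have : (x1 - x) * p <= 2 * d.
    have x1x : x1 - x <= 2 * d.
      by move: h1 hx; rewrite !ler_norml => /andP[? ?] /andP[? ?]; lra.
    case/andP: hp => p0 p1; apply: le_trans (ler_wpM2r p0 x1x) _.
    by apply: ler_piMr => //; have := le_trans (normr_ge0 _) h1; lra.
  move: h1 hx; rewrite !ler_norml => /andP[l1 _] /andP[_ l2].
  by move: hxy l1 l2 x0 dl; clear; lra.
move=> /(close _ _ h2 hq) hqp /(close _ _ h3 hr) hrp /(close _ _ h4 ht) htp.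
have hu : 0 <= 1 - p <= 1 by move: hp; clear; lra.
have E : 1 - (1 - p) = p by ring.
have := @degree_gain_unit d x1 x2 x3 x4 (1 - p) q r t dl h1 h2 h3 h4 hu hq hr ht.
rewrite E => /(_ hqp hrp htp); rewrite -(ler_pM2l (exprn_gt0 3 m0)).
have -> : m ^+ 3 * degree_gain x1 x2 x3 x4 (x1 * p) (x2 * q) (x3 * r) (x4 * t) =
  degree_gain (m * x1) (m * x2) (m * x3) (m * x4) (m * (x1 * p)) (m * (x2 * q))
    (m * (x3 * r)) (m * (x4 * t)) by rewrite /degree_gain /degree_poly; ring.
apply: le_trans.
have le2 x y : `|x - 1| <= d -> 0 <= y -> x * y <= 2 * y.
  by rewrite ler_norml => /andP[_ hx] y0; rewrite ler_wpM2r //; move: hx d1; clear; lra.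
have -> : m ^+ 2 * (m * x1 - m * (x1 * p) + m * (x2 * q) + m * (x3 * r)
  + m * (x4 * t)) / 20
  = m ^+ 3 * ((x1 * (1 - p) + x2 * q + x3 * r + x4 * t) / 20) by ring.
rewrite ler_pM2l ?exprn_gt0 //.
have := le2 _ _ h1 (proj1 (andP hu)); have := le2 _ _ h2 (proj1 (andP hq)).
have := le2 _ _ h3 (proj1 (andP hr)); have := le2 _ _ h4 (proj1 (andP ht)).
clear; lra.
Qed.

End WeightedDegree.

(** * Reattaching a vertex *)

Section InjectiveCount.
Variables (R : realFieldType) (V : finType).
Implicit Types e r : rel V.

Definition P3K1_at e x y z w :=
  [&& e x y, e y z, ~~ e x z, ~~ e x w, ~~ e y w & ~~ e z w].

(* Every copy is counted twice, as the two leaves can be exchanged. *)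
Definition inj_count e : R :=
  Sum4 (fun x y z w => (P3K1_at e x y z w && (x != z))%:R).

Definition reattach e r (x : V) : rel V :=
  fun y z => if (y == x) || (z == x) then r y z else e y z.

Lemma reattach_sym e r x : symmetric e -> symmetric r -> symmetric (reattach e r x).
Proof. by move=> es rs y z; rewrite /reattach orbC es rs. Qed.

Lemma reattach_irr e r x : irreflexive e -> irreflexive r -> irreflexive (reattach e r x).
Proof. by move=> ei ri y; rewrite /reattach; case: ifP. Qed.

Definition copy_gain e r x y1 y2 y3 y4 : R :=
  (P3K1_at (reattach e r x) y1 y2 y3 y4 && (y1 != y3))%:R
  - (P3K1_at e y1 y2 y3 y4 && (y1 != y3))%:R.

Lemma sum_delta (F : V -> R) x : \sum_v F v * (v == x)%:R = F x.
Proof.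
rewrite (bigD1 x) //= eqxx mulr1 big1 ?addr0 // => v /negbTE ->.
by rewrite mulr0.
Qed.

Lemma P3K1_repeat e x y z w : symmetric e -> irreflexive e ->
  P3K1_at e x y z w -> x != z ->
  [/\ x != y, x != w, y != z, y != w & z != w].
Proof.
move=> es ei /and5P[xy yz xz xw /andP[yw zw]] _.
split; first by apply: contraTneq xy => ->; rewrite ei.
- by apply: contraNneq yw => <-; rewrite es.
- by apply: contraTneq yz => ->; rewrite ei.
- by apply: contraNneq xw => <-.
- by apply: contraNneq yw => <-.
Qed.

(** Tuples avoiding x are unaffected, and a counted tuple contains x exactly once or not at all
    because its entries are distinct. *)
Lemma inj_count_reattach e r x : symmetric e -> irreflexive e ->
  symmetric r -> irreflexive r ->
  let g := copy_gain e r x in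
  inj_count (reattach e r x) - inj_count e =
  \sum_y \sum_z \sum_w (g x y z w + g y x z w + g y z x w + g y z w x).
Proof.
move=> es ei rs ri g.
have rts := reattach_sym x es rs; have rti := reattach_irr x ei ri.
have -> : inj_count (reattach e r x) - inj_count e = Sum4 g.
  by rewrite /inj_count /Sum4 -sumrB; do 3 (apply: eq_bigr => ? _; rewrite -sumrB).
have -> : Sum4 g = Sum4 (fun y1 y2 y3 y4 => g y1 y2 y3 y4 * (y1 == x)%:R
   + g y1 y2 y3 y4 * (y2 == x)%:R + g y1 y2 y3 y4 * (y3 == x)%:R
   + g y1 y2 y3 y4 * (y4 == x)%:R).
  apply: eq_Sum4 => y1 y2 y3 y4; rewrite -!mulrDr -!natrD.
  set m := (_ + _ + _ + _)%N.
  (* [m] is the multiplicity of x in the tuple, so multiplying by it inserts the four indicator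
     terms without changing the gain. *)
  have once e' : symmetric e' -> irreflexive e' ->
      P3K1_at e' y1 y2 y3 y4 && (y1 != y3) -> (m <= 1)%N.
    move=> es' ei' /andP[H ne]; have [n1 n2 n3 n4 n5] := P3K1_repeat es' ei' H ne.
    have D a b : a != b -> ((a == x) + (b == x) <= 1)%N.
      move=> ab; case: (eqVneq a x) ab => [->|_] ab; last by case: eqP.
      by rewrite eq_sym (negbTE ab).
    rewrite /m; move: (D _ _ ne) (D _ _ n1) (D _ _ n2) (D _ _ n3) (D _ _ n4) (D _ _ n5).
    by case: (y1 == x); case: (y2 == x); case: (y3 == x); case: (y4 == x).
  have [m0|mpos] := posnP m.
    rewrite m0 mulr0; move: m0; rewrite /m /g /copy_gain /P3K1_at /reattach.
    by case: (y1 == x); case: (y2 == x); case: (y3 == x); case: (y4 == x); rewrite ?subrr.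
  have one e' : symmetric e' -> irreflexive e' ->
      (P3K1_at e' y1 y2 y3 y4 && (y1 != y3))%:R = (P3K1_at e' y1 y2 y3 y4
        && (y1 != y3))%:R * m%:R :> R.
    move=> es' ei'; case: (boolP (_ && _)) => [/(once _ es' ei') m1|_];
      last by rewrite mul0r.
    by rewrite (_ : m = 1%N) ?mulr1 //; apply/eqP; rewrite eqn_leq m1.
  by rewrite /g /copy_gain mulrBl -!one.
rewrite !Sum4D.
have d1 : Sum4 (fun y1 y2 y3 y4 => g y1 y2 y3 y4 * (y1 == x)%:R)
  = \sum_y \sum_z \sum_w g x y z w.
  rewrite /Sum4 -(sum_delta (fun y1 => \sum_y2 \sum_y3 \sum_y4 g y1 y2 y3 y4)).
  apply: eq_bigr => y1 _; rewrite mulr_suml; apply: eq_bigr => y2 _.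
  rewrite mulr_suml; apply: eq_bigr => y3 _; rewrite mulr_suml.
  by apply: eq_bigr => y4 _.
have d2 : Sum4 (fun y1 y2 y3 y4 => g y1 y2 y3 y4 * (y2 == x)%:R)
  = \sum_y \sum_z \sum_w g y x z w.
  apply: eq_bigr => y1 _.
  rewrite -(sum_delta (fun y2 => \sum_y3 \sum_y4 g y1 y2 y3 y4)).
  apply: eq_bigr => y2 _; rewrite mulr_suml; apply: eq_bigr => y3 _.
  by rewrite mulr_suml; apply: eq_bigr => y4 _.
have d3 : Sum4 (fun y1 y2 y3 y4 => g y1 y2 y3 y4 * (y3 == x)%:R)
  = \sum_y \sum_z \sum_w g y z x w.
  do 2 apply: eq_bigr => ? _.
  rewrite -(sum_delta (fun y3 => \sum_y4 g _ _ y3 y4)).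
  by apply: eq_bigr => y3 _; rewrite mulr_suml; apply: eq_bigr => y4 _.
have d4 : Sum4 (fun y1 y2 y3 y4 => g y1 y2 y3 y4 * (y4 == x)%:R)
  = \sum_y \sum_z \sum_w g y z w x.
  do 3 apply: eq_bigr => ? _.
  by rewrite -(sum_delta (fun y4 => g _ _ _ y4)).
rewrite {}d1 {}d2 {}d3 {}d4 -!big_split; apply: eq_bigr => y _.
rewrite -!big_split; apply: eq_bigr => z _.
by rewrite -!big_split.
Qed.

End InjectiveCount.

Section Reattach.
Variables (R : realFieldType) (V : finType) (e : rel V) (col : V -> 'I_4) (x : V).
Hypotheses (esym : symmetric e) (eirr : irreflexive e).
Local Notation n := (#|V|%:R : R).

Definition blow : rel V := fun y z => adj K2_K2 (col y) (col z).

Lemma blow_sym : symmetric blow.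
Proof. by move=> y z; rewrite /blow adjC. Qed.

Lemma blow_irr : irreflexive blow.
Proof. by move=> y; rewrite /blow adjxx. Qed.

(* The four terms are the copies in which the new vertex is a leaf (first or
   last on the path), the centre, and the isolated vertex. *)
Definition vertex_copies (r : rel V) (nu : V -> bool) (y z w : V) : nat :=
  ([&& nu y, r y z, ~~ nu z, ~~ nu w, ~~ r y w & ~~ r z w]
   + [&& nu y, nu z, ~~ r y z, ~~ r y w, ~~ nu w & ~~ r z w]
   + [&& r y z, nu z, ~~ nu y, ~~ r y w, ~~ r z w & ~~ nu w]
   + [&& r y z, r z w, ~~ r y w, ~~ nu y, ~~ nu z & ~~ nu w])%N.

Definition vertex_degree (nu : V -> bool) : R :=
  \sum_y \sum_z \sum_w (vertex_copies blow nu y z w)%:R.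

Local Notation D := (mismatch e col x).
Local Notation mis := (mismatch e col).
Local Notation g := (copy_gain R e blow x).
Local Notation degD := (\sum_v (D v)%:R : R).

(** Copies through x can be counted as if the rest of the graph were the exact blow-up. The two
    counts differ only when the triple contains both a mismatch at x and either a mismatch or a
    coincidence elsewhere. In that case every term is bounded by a constant, which 16 covers. *)
Lemma reattach_local (y z w : V) :
  (vertex_copies blow (blow x) y z w)%:R - (vertex_copies blow (e x) y z w)%:R
  - 16 * ((D y + D z + D w)%:R * (mis y z + mis y w + mis z w
      + (y == z) + (y == w) + (x == z) + (x == y))%:R)
  <= g x y z w + g y x z w + g y z x w + g y z w x.
Proof.
have rx v : reattach e blow x x v = blow x v by rewrite /reattach eqxx.
have rx' v : reattach e blow x v x = blow x v by rewrite /reattach eqxx orbT blow_sym.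
have [noD|someD] := posnP (D y + D z + D w)%N.
  have Dx : D x = false by rewrite /mismatch eirr -/(blow x x) blow_irr.
  have same a b : D a = false -> D b = false -> reattach e blow x a b = e a b.
    rewrite /reattach => /negbFE/eqP ea /negbFE/eqP eb.
    case: (eqVneq a x) => [->|_] /=; first by rewrite -/(blow x b) eb.
    by case: (eqVneq b x) => [->|//]; rewrite blow_sym esym -/(blow x a) ea.
  have {noD}[Dy Dz Dw] : [/\ D y = false, D z = false & D w = false].
    by move: noD; case: (D y); case: (D z); case: (D w).
  have eb v : D v = false -> blow x v = e x v by move/negbFE/eqP=> ->.
  rewrite /vertex_copies !(eb _ Dy) !(eb _ Dz) !(eb _ Dw) subrr Dy Dz Dw mul0r mulr0
    subr0.
  by rewrite /copy_gain /P3K1_at !same // !subrr !addr0.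
have [nomis|somemis] := posnP (mis y z + mis y w + mis z w
      + (y == z) + (y == w) + (x == z) + (x == y))%N.
  rewrite nomis mulr0 mulr0 subr0.
  have {nomis}[] : [/\ mis y z = false, mis y w = false & mis z w = false] /\
      [/\ y == z = false, y == w = false, x == z = false & x == y = false].
    by move: nomis; do 3 case: (mis _ _) => //; do 4 case: (_ == _) => //.
  case=> myz myw mzw [nyz nyw nxz nxy].
  have eb a b : mis a b = false -> e a b = blow a b by move/negbFE/eqP.
  have rb a b : mis a b = false -> reattach e blow x a b = blow a b.
    by move=> m; rewrite /reattach (eb _ _ m) if_same.
  rewrite /copy_gain /P3K1_at !rx !rx' !rb // !(esym _ x).
  rewrite (eb _ _ myz) (eb _ _ myw) (eb _ _ mzw) (eq_sym y x) nyz nyw nxz nxy !andbT.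
  rewrite /vertex_copies !natrD.
  lra.
have : 1 <= ((D y + D z + D w)%:R * (mis y z + mis y w + mis z w
      + (y == z) + (y == w) + (x == z) + (x == y))%:R) :> R.
  by rewrite -natrM ler1n muln_gt0 someD.
have g1 y1 y2 y3 y4 : -1 <= g y1 y2 y3 y4.
  by rewrite /copy_gain; case: (_ && _); case: (_ && _); rewrite /= ?mulr1n ?mulr0n; lra.
have := g1 x y z w; have := g1 y x z w; have := g1 y z x w; have := g1 y z w x.
have : (vertex_copies blow (blow x) y z w)%:R <= 4 :> R.
  rewrite ler_nat /vertex_copies.
  by do 4 case: [&& _, _, _, _, _ & _].
have : 0 <= (vertex_copies blow (e x) y z w)%:R :> R by [].
lra.
Qed.

Definition mis_degree (v : V) : nat := \sum_w mis v w.

Lemma mis_sym : symmetric mis.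
Proof. by move=> v w; rewrite /mismatch esym adjC. Qed.

Let Sum3 (F : V -> V -> V -> R) := \sum_y \sum_z \sum_w F y z w.

Let Sum3D F G : Sum3 (fun y z w => F y z w + G y z w) = Sum3 F + Sum3 G.
Proof.
rewrite /Sum3 -big_split; apply: eq_bigr => y _; rewrite -big_split.
by apply: eq_bigr => z _; exact: big_split.
Qed.

Let Sum3_12 (F : V -> V -> R) : Sum3 (fun y z _ => F y z) = n * \sum_y \sum_z F y z.
Proof.
rewrite /Sum3 mulr_sumr; apply: eq_bigr => y _; rewrite mulr_sumr.
by apply: eq_bigr => z _; rewrite sum_constV.
Qed.

Let Sum3_13 (F : V -> V -> R) : Sum3 (fun y _ w => F y w) = n * \sum_y \sum_z F y z.
Proof. by rewrite -Sum3_12; apply: eq_bigr => y _; rewrite exchange_big. Qed.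

Let Sum3_23 (F : V -> V -> R) : Sum3 (fun _ z w => F z w) = n * \sum_y \sum_z F y z.
Proof. by rewrite -Sum3_13 /Sum3 exchange_big. Qed.

Let Sum3_1x23 (f : V -> R) F :
  Sum3 (fun y z w => f y * F z w) = (\sum_y f y) * \sum_y \sum_z F y z.
Proof.
rewrite mulr_suml; apply: eq_bigr => y _; rewrite mulr_sumr.
by apply: eq_bigr => z _; rewrite mulr_sumr.
Qed.

Let Sum3_2x13 (f : V -> R) F :
  Sum3 (fun y z w => f z * F y w) = (\sum_y f y) * \sum_y \sum_z F y z.
Proof. by rewrite -Sum3_1x23 /Sum3 exchange_big. Qed.

Let Sum3_3x12 (f : V -> R) F :
  Sum3 (fun y z w => f w * F y z) = (\sum_y f y) * \sum_y \sum_z F y z.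
Proof. by rewrite -Sum3_2x13; apply: eq_bigr => y _; rewrite exchange_big. Qed.

Local Notation S := (\sum_v (D v)%:R * (mis_degree v)%:R : R).
Local Notation M := ((mismatches e col)%:R : R).

(** [S] collects the mismatch degrees of the vertices mismatched with x: it arises when the two
    mismatches share a vertex. Disjoint mismatches give [degD * M], coincidences give [n * degD]. *)
Lemma sum_local_error :
  Sum3 (fun y z w => (D y + D z + D w)%:R * (mis y z + mis y w + mis z w
      + (y == z) + (y == w) + (x == z) + (x == y))%:R)
  <= 6 * (n * S) + 3 * (degD * M) + 12 * (n * degD).
Proof.
have DS : \sum_y \sum_z (D y)%:R * (mis y z)%:R = S.
  by apply: eq_bigr => y _; rewrite -mulr_sumr /mis_degree natr_sum.
have DS' : \sum_y \sum_z (D z)%:R * (mis y z)%:R = S.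
  rewrite -DS exchange_big; apply: eq_bigr => y _; apply: eq_bigr => z _.
  by rewrite (mis_sym z y).
have MM : \sum_y \sum_z (mis y z)%:R = M.
  by rewrite /mismatches natr_sum; apply: eq_bigr => y _; rewrite natr_sum.
have Dx : D x = false by rewrite /mismatch eirr -/(blow x x) blow_irr.
have delta (f : V -> R) a : \sum_v f v * (a == v)%:R = f a.
  by rewrite -[RHS](sum_delta f); apply: eq_bigr => v _; rewrite eq_sym.
have delta2 (f : V -> V -> R) : \sum_y \sum_z f y z * (y == z)%:R = \sum_y f y y.
  by apply: eq_bigr => y _; exact: delta.
have dx : \sum_y \sum_z (D y)%:R * (x == z)%:R = degD.
  by apply: eq_bigr => y _; exact: (delta (fun=> (D y)%:R)).
have zero y : (D y)%:R * (x == y)%:R = 0 :> R.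
  by case: (eqVneq x y) => [<-|_]; rewrite ?Dx ?mul0r ?mulr0 //.
have one : \sum_(v : V) (x == v)%:R = 1 :> R.
  by rewrite -[RHS](delta (fun=> 1) x); apply: eq_bigr => v _; rewrite mul1r.
have eqs : \sum_(y : V) \sum_z (y == z)%:R = n :> R.
  transitivity (\sum_(y : V) \sum_z 1 * (y == z)%:R : R).
    by do 2 apply: eq_bigr => ? _; rewrite mul1r.
  by rewrite (delta2 (fun _ _ => 1)) sum_constV mulr1.
have oneV : \sum_(y : V) \sum_(z : V) (x == y)%:R = n :> R.
  by rewrite exchange_big /=; under eq_bigr do rewrite one; rewrite sum_constV mulr1.
have oneV' : \sum_(y : V) \sum_(z : V) (x == z)%:R = n :> R.
  by under eq_bigr do rewrite one; rewrite sum_constV mulr1.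
have -> : Sum3 (fun y z w => (D y + D z + D w)%:R * (mis y z + mis y w + mis z w
      + (y == z) + (y == w) + (x == z) + (x == y))%:R) =
  Sum3 (fun y z w =>
    (D y)%:R * (mis y z)%:R + (D y)%:R * (mis y w)%:R + (D y)%:R * (mis z w)%:R
    + (D z)%:R * (mis y z)%:R + (D z)%:R * (mis y w)%:R + (D z)%:R * (mis z w)%:R
    + (D w)%:R * (mis y z)%:R + (D w)%:R * (mis y w)%:R + (D w)%:R * (mis z w)%:R
    + (D y)%:R * (y == z)%:R + (D y)%:R * (y == w)%:R + (D y)%:R * (x == z)%:R
    + (D z)%:R * (y == z)%:R + (D z)%:R * (y == w)%:R + (D z)%:R * (x == y)%:R
    + (D w)%:R * (y == z)%:R + (D w)%:R * (y == w)%:R + (D w)%:R * (x == z)%:R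
    + (D w)%:R * (x == y)%:R).
  do 3 apply: eq_bigr => ? _; rewrite !natrD !(mulrDl, mulrDr) !zero; ring.
rewrite !Sum3D.
rewrite (Sum3_12 (fun y z => (D y)%:R * (mis y z)%:R)) DS.
rewrite (Sum3_13 (fun y z => (D y)%:R * (mis y z)%:R)) DS.
rewrite (Sum3_1x23 (fun y => (D y)%:R) (fun y z => (mis y z)%:R)) MM.
rewrite (Sum3_12 (fun y z => (D z)%:R * (mis y z)%:R)) DS'.
rewrite (Sum3_2x13 (fun y => (D y)%:R) (fun y z => (mis y z)%:R)) MM.
rewrite (Sum3_23 (fun y z => (D y)%:R * (mis y z)%:R)) DS.
rewrite (Sum3_3x12 (fun y => (D y)%:R) (fun y z => (mis y z)%:R)) MM.
rewrite (Sum3_13 (fun y z => (D z)%:R * (mis y z)%:R)) DS'.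
rewrite (Sum3_23 (fun y z => (D z)%:R * (mis y z)%:R)) DS'.
rewrite (Sum3_12 (fun y z => (D y)%:R * (y == z)%:R)) delta2.
rewrite (Sum3_13 (fun y z => (D y)%:R * (y == z)%:R)) delta2.
rewrite (Sum3_12 (fun y z => (D y)%:R * (x == z)%:R)) dx.
rewrite (Sum3_12 (fun y z => (D z)%:R * (y == z)%:R)) delta2.
rewrite (Sum3_2x13 (fun y => (D y)%:R) (fun y z => (y == z)%:R)) eqs.
rewrite (Sum3_2x13 (fun y => (D y)%:R) (fun y z => (x == y)%:R)) oneV.
rewrite (Sum3_3x12 (fun y => (D y)%:R) (fun y z => (y == z)%:R)) eqs.
rewrite (Sum3_13 (fun y z => (D z)%:R * (y == z)%:R)) delta2.
rewrite (Sum3_3x12 (fun y => (D y)%:R) (fun y z => (x == z)%:R)) oneV'.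
rewrite (Sum3_3x12 (fun y => (D y)%:R) (fun y z => (x == y)%:R)) oneV.
have : 0 <= n * degD by rewrite mulr_ge0 // sumr_ge0.
have : 0 <= degD * n by rewrite mulr_ge0 // sumr_ge0.
rewrite (mulrC degD n); lra.
Qed.

Lemma reattach_gain :
  vertex_degree (blow x) - vertex_degree (e x)
  - 16 * (6 * (n * S) + 3 * (degD * M) + 12 * (n * degD))
  <= inj_count R (reattach e blow x) - inj_count R e.
Proof.
rewrite (inj_count_reattach R x esym eirr blow_sym blow_irr).
apply: le_trans (lerB (lexx _) (ler_wpM2l _ sum_local_error)) _; rewrite ?ler0n //.
have -> : vertex_degree (blow x) - vertex_degree (e x) - 16 * Sum3 (fun y z w => (D y
  + D z + D w)%:R * (mis y z + mis y w + mis z w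
      + (y == z) + (y == w) + (x == z) + (x == y))%:R) =
   Sum3 (fun y z w => (vertex_copies blow (blow x) y z w)%:R - (vertex_copies blow (e
     x) y z w)%:R
  - 16 * ((D y + D z + D w)%:R * (mis y z + mis y w + mis z w
      + (y == z) + (y == w) + (x == z) + (x == y))%:R)).
  rewrite /vertex_degree /Sum3 mulr_sumr -!sumrB; apply: eq_bigr => y _.
  rewrite mulr_sumr -!sumrB; apply: eq_bigr => z _.
  by rewrite mulr_sumr -!sumrB.
by do 3 apply: ler_sum => ? _; exact: reattach_local.
Qed.

End Reattach.

(** * Counting by colour classes *)

Section ColourCounts.
Variables (R : realFieldType) (V : finType) (col : V -> 'I_4).
Local Notation n := (#|V|%:R : R).
Local Notation B := (adj K2_K2).

Definition colour_sum (f : V -> R) (i : 'I_4) : R := \sum_(v | col v == i) f v.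

Lemma sum_by_colour (phi : 'I_4 -> R) (f : V -> R) :
  \sum_v phi (col v) * f v = \sum_i phi i * colour_sum f i.
Proof.
rewrite (partition_big col xpredT) //=; apply: eq_bigr => i _.
by rewrite mulr_sumr; apply: eq_bigr => v /eqP ->.
Qed.

Lemma sum3_by_colour (phi : 'I_4 -> 'I_4 -> 'I_4 -> R) (f g h : V -> R) :
  \sum_y \sum_z \sum_w phi (col y) (col z) (col w) * (f y * g z * h w) =
  \sum_i \sum_j \sum_k phi i j k * (colour_sum f i * colour_sum g j * colour_sum h k).
Proof.
transitivity (\sum_y (\sum_j \sum_k phi (col y) j k * (colour_sum g j * colour_sum h
  k)) * f y).
  apply: eq_bigr => y _.
  transitivity (\sum_z (\sum_k phi (col y) (col z) k * colour_sum h k) * (f y * g z)).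
    apply: eq_bigr => z _.
    transitivity (\sum_w phi (col y) (col z) (col w) * (f y * g z * h w)) => //.
    rewrite -(sum_by_colour (fun k => phi (col y) (col z) k) h) mulr_suml.
    by apply: eq_bigr => w _; ring.
  rewrite (sum_by_colour (fun j => \sum_k phi (col y) j k * colour_sum h k)
    (fun z => f y * g z)).
  rewrite mulr_suml; apply: eq_bigr => j _.
  rewrite (_ : colour_sum (fun z => f y * g z) j = f y * colour_sum g j); last first.
    by rewrite /colour_sum mulr_sumr.
  by rewrite !mulr_suml; apply: eq_bigr => k _; ring.
rewrite (sum_by_colour (fun i => \sum_j \sum_k phi i j k * (colour_sum g j *
  colour_sum h k)) f).
apply: eq_bigr => i _; rewrite mulr_suml; apply: eq_bigr => j _.
by rewrite mulr_suml; apply: eq_bigr => k _; ring.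
Qed.

Lemma K2_K2_nth (i j : 'I_4) :
  B i j = nth false (nth [::] [:: [:: false; true; false; false]; [:: true; false;
    false; false];
     [:: false; false; false; true]; [:: false; false; true; false]] i) j.
Proof.
rewrite adj_K2_K2.
by case: i => [[|[|[|[|//]]]] ?]; case: j => [[|[|[|[|//]]]] ?].
Qed.

Definition i0 : 'I_4 := inord 0.
Definition i1 : 'I_4 := inord 1.
Definition i2 : 'I_4 := inord 2.
Definition i3 : 'I_4 := inord 3.

Lemma sum_I4 (F : 'I_4 -> R) : \sum_i F i = F i0 + F i1 + F i2 + F i3.
Proof.
rewrite !big_ord_recl big_ord0 addr0 !addrA.
by congr (F _ + F _ + F _ + F _); apply: val_inj; rewrite /= inordK.
Qed.

Variable nu : V -> bool.
Local Notation A := (colour_sum (fun v => (nu v)%:R)).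
Local Notation N := (colour_sum (fun v => (~~ nu v)%:R)).

Lemma vertex_degreeE : vertex_degree R col nu =
  degree_poly (A i0) (A i1) (A i2) (A i3) (N i0) (N i1) (N i2) (N i3).
Proof.
pose a v : R := (nu v)%:R; pose b v : R := (~~ nu v)%:R.
transitivity (
  \sum_y \sum_z \sum_w [&& B (col y) (col z), ~~ B (col y) (col w) & ~~ B (col z)
    (col w)]%:R * (a y * b z * b w)
  + \sum_y \sum_z \sum_w [&& ~~ B (col y) (col z), ~~ B (col y) (col w) & ~~ B (col z)
    (col w)]%:R * (a y * a z * b w)
  + \sum_y \sum_z \sum_w [&& B (col y) (col z), ~~ B (col y) (col w) & ~~ B (col z)
    (col w)]%:R * (b y * a z * b w)
  + \sum_y \sum_z \sum_w [&& B (col y) (col z), B (col z) (col w) & ~~ B (col y)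
    (col w)]%:R * (b y * b z * b w)).
  rewrite /vertex_degree -!big_split; apply: eq_bigr => y _.
  rewrite -!big_split; apply: eq_bigr => z _; rewrite -!big_split.
  apply: eq_bigr => w _; rewrite /vertex_copies /blow /a /b !natrD.
  rewrite -!natrM !mulnb; congr (_%:R + _%:R + _%:R + _%:R); congr nat_of_bool;
    by case: (nu y); case: (nu z); case: (nu w); rewrite /= ?(andbF, andbT).
rewrite (sum3_by_colour (fun i j k => [&& B i j, ~~ B i k & ~~ B j k]%:R)).
rewrite (sum3_by_colour (fun i j k => [&& B i j, ~~ B i k & ~~ B j k]%:R)).
rewrite (sum3_by_colour (fun i j k => [&& ~~ B i j, ~~ B i k & ~~ B j k]%:R)).
rewrite (sum3_by_colour (fun i j k => [&& B i j, B j k & ~~ B i k]%:R)).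
rewrite !sum_I4 !K2_K2_nth /i0 /i1 /i2 /i3 !inordK //= -/i0 -/i1 -/i2 -/i3.
rewrite /degree_poly; ring.
Qed.

End ColourCounts.

Section ColourClasses.
Variables (R : realFieldType) (V : finType) (col : V -> 'I_4).
Local Notation n := (#|V|%:R : R).
Local Notation B := (adj K2_K2).

Definition class_size (i : 'I_4) : R := colour_sum col (fun=> 1) i.
Local Notation s := class_size.

Lemma class_size_ge0 i : 0 <= s i.
Proof. by apply: sumr_ge0 => v _. Qed.

Lemma ord4P (i : 'I_4) : [\/ i = i0, i = i1, i = i2 | i = i3].
Proof.
case: i => [[|[|[|[|//]]]] hi]; [apply: Or41 | apply: Or42 | apply: Or43 | apply: Or44];
  by apply: val_inj; rewrite /= inordK.
Qed.

Lemma sum_class_size : s i0 + s i1 + s i2 + s i3 = n.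
Proof.
rewrite -sum_I4 (eq_bigr (fun i => 1 * s i)); last by move=> i _; rewrite mul1r.
rewrite -(sum_by_colour col (fun=> 1)) -[RHS]mulr1 -sum_constV.
by apply: eq_bigr => v _; rewrite mulr1.
Qed.

Lemma hom_count_blow : hom_count R (blow col) =
  (s i0 + s i1) * (s i2 + s i3) * (s i0 * s i1 + s i2 * s i3).
Proof.
pose one (v : V) : R := 1.
transitivity (\sum_x \sum_y \sum_z
   ([&& B (col x) (col y), B (col y) (col z) & ~~ B (col x) (col z)]%:R *
    \sum_l [&& ~~ B (col x) l, ~~ B (col y) l & ~~ B (col z) l]%:R * s l)
   * (one x * one y * one z)).
  do 3 apply: eq_bigr => ? _; rewrite !mulr1.
  rewrite -(sum_by_colour col (fun l => [&& ~~ B _ l, ~~ B _ l & ~~ B _ l]%:R)).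
  rewrite mulr_sumr; apply: eq_bigr => w _; rewrite mulr1 -natrM mulnb.
  by congr (nat_of_bool _)%:R; rewrite -!andbA.
rewrite (sum3_by_colour col (fun i j k => [&& B i j, B j k & ~~ B i k]%:R *
    \sum_l [&& ~~ B i l, ~~ B j l & ~~ B k l]%:R * s l)).
rewrite !sum_I4 -!/(class_size _) !K2_K2_nth /i0 /i1 /i2 /i3 !inordK //= -/i0 -/i1
  -/i2 -/i3.
ring.
Qed.

Variable nu : V -> bool.
Local Notation A := (colour_sum col (fun v => (nu v)%:R : R)).
Local Notation N := (colour_sum col (fun v => (~~ nu v)%:R : R)).

Definition class_errors (c : 'I_4) : R := \sum_v (nu v != B c (col v))%:R.

Lemma class_split i : N i = s i - A i.
Proof.
rewrite /s /colour_sum -sumrB; apply: eq_bigr => v _.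
by case: (nu v); rewrite ?subrr ?subr0.
Qed.

Lemma nbrs_in_class i : 0 <= A i <= s i.
Proof.
apply/andP; split; first by apply: sumr_ge0.
by rewrite -subr_ge0 -class_split; apply: sumr_ge0.
Qed.

Lemma class_errorsE c : class_errors c = \sum_i (if B c i then s i - A i else A i).
Proof.
rewrite /class_errors (partition_big col xpredT) //=; apply: eq_bigr => i _.
rewrite -class_split; case Bci: (B c i);
  by apply: eq_bigr => v /eqP ->; rewrite Bci; case: (nu v).
Qed.

Lemma blow_in_class c i :
  colour_sum col (fun v => (B c (col v))%:R : R) i = (B c i)%:R * s i.
Proof.
by rewrite /s /colour_sum mulr_sumr; apply: eq_bigr => v /eqP ->; rewrite mulr1.
Qed.

Lemma blow_out_class c i :
  colour_sum col (fun v => (~~ B c (col v))%:R : R) i = (~~ B c i)%:R * s i.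
Proof.
by rewrite /s /colour_sum mulr_sumr; apply: eq_bigr => v /eqP ->; rewrite mulr1.
Qed.

(** The minimality of [class_errors c] is exactly the three comparisons of [degree_gain_ge]. The
    four cases permute the classes so that the one joined to c comes first and c itself second. *)
Lemma vertex_degree_gain (m d : R) (c : 'I_4) : 0 < m -> 32 * 100 * d <= 1 ->
  (forall i, `|s i - m| <= d * m) ->
  (forall c', class_errors c <= class_errors c') ->
  m ^+ 2 * class_errors c / 20 <=
  vertex_degree R col (fun v => B c (col v)) - vertex_degree R col nu.
Proof.
move=> m0 dl hs hc.
rewrite !vertex_degreeE !blow_in_class !blow_out_class !class_split.
have := hc i0; have := hc i1; have := hc i2; have := hc i3;
  rewrite !class_errorsE !sum_I4.
rewrite !K2_K2_nth.
have [a0 a1 a2 a3] := And4 (nbrs_in_class i0) (nbrs_in_class i1) (nbrs_in_class i2)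
  (nbrs_in_class i3).
have [s0 s1 s2 s3] := And4 (hs i0) (hs i1) (hs i2) (hs i3).
have {hs hc} gain := @degree_gain_ge R m d.
case: (ord4P c) => ->; rewrite /i0 /i1 /i2 /i3 !inordK //= -/i0 -/i1 -/i2 -/i3
  => h3 h2 h1 h0.
- have := gain (s i1) (s i0) (s i2) (s i3) (A i1) (A i0) (A i2) (A i3) m0 dl s1 s0 s2
  s3 a1 a0 a2 a3.
  have -> : m ^+ 2 * (A i0 + (s i1 - A i1) + A i2 + A i3) / 20 =
    m ^+ 2 * (s i1 - A i1 + A i0 + A i2 + A i3) / 20 by ring.
  rewrite /degree_gain => {}gain.
  apply: le_trans; first by apply: gain; lra.
  by rewrite /degree_poly le_eqVlt; apply/orP; left; apply/eqP; ring.
- have := gain (s i0) (s i1) (s i2) (s i3) (A i0) (A i1) (A i2) (A i3) m0 dl s0 s1 s2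
  s3 a0 a1 a2 a3.
  rewrite /degree_gain => {}gain.
  apply: le_trans; first by apply: gain; lra.
  by rewrite /degree_poly le_eqVlt; apply/orP; left; apply/eqP; ring.
- have := gain (s i3) (s i2) (s i0) (s i1) (A i3) (A i2) (A i0) (A i1) m0 dl s3 s2 s0
  s1 a3 a2 a0 a1.
  have -> : m ^+ 2 * (A i0 + A i1 + A i2 + (s i3 - A i3)) / 20 =
    m ^+ 2 * (s i3 - A i3 + A i2 + A i0 + A i1) / 20 by ring.
  rewrite /degree_gain => {}gain.
  apply: le_trans; first by apply: gain; lra.
  by rewrite /degree_poly le_eqVlt; apply/orP; left; apply/eqP; ring.
- have := gain (s i2) (s i3) (s i0) (s i1) (A i2) (A i3) (A i0) (A i1) m0 dl s2 s3 s0
  s1 a2 a3 a0 a1.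
  have -> : m ^+ 2 * (A i0 + A i1 + (s i2 - A i2) + A i3) / 20 =
    m ^+ 2 * (s i2 - A i2 + A i3 + A i0 + A i1) / 20 by ring.
  rewrite /degree_gain => {}gain.
  apply: le_trans; first by apply: gain; lra.
  by rewrite /degree_poly le_eqVlt; apply/orP; left; apply/eqP; ring.
Qed.

End ColourClasses.

(** * Minimal colourings *)

Section Balance.
Variable R : realFieldType.

Lemma ler_norm_sqr (x y : R) : 0 <= y -> x ^+ 2 <= y ^+ 2 -> `|x| <= y.
Proof. by move=> y0; rewrite -(real_normK (num_real x)) ler_pXn2r ?nnegrE. Qed.

(** With p, q the sizes of the two components and x, y the differences inside them, [n^4] minus 32
    times the right-hand polynomial equals [(p - q)^4 + 8 p q (x^2 + y^2)]. A deficit of [z^4 n^4]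
    thus allows deviations of order [z n]. The case z = 0 also gives the uniqueness of the
    maximiser. *)
Lemma balanced_sizes (n z s0 s1 s2 s3 : R) : 0 < n -> 0 <= z <= 1 / 2 ->
  0 <= s0 -> 0 <= s1 -> 0 <= s2 -> 0 <= s3 -> s0 + s1 + s2 + s3 = n ->
  (1 / 32 - z ^+ 4 / 32) * n ^+ 4 <= (s0 + s1) * (s2 + s3) * (s0 * s1 + s2 * s3) ->
  [/\ `|s0 - n / 4| <= z * n, `|s1 - n / 4| <= z * n, `|s2 - n / 4| <= z * n
    & `|s3 - n / 4| <= z * n].
Proof.
move=> n0 /andP[z0 z1] s00 s10 s20 s30 sn big.
pose p := s0 + s1; pose q := s2 + s3; pose x := s0 - s1; pose y := s2 - s3.
have zn0 : 0 <= z * n by rewrite mulr_ge0 // ltW.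
have pq0 : 0 <= p * q by rewrite mulr_ge0 // addr_ge0.
have key : (p - q) ^+ 4 + 8 * (p * q) * (x ^+ 2 + y ^+ 2) <= (z * n) ^+ 4.
  move: big; rewrite -subr_ge0; set a := _ - _ => a0.
  have -> : (z * n) ^+ 4 = (p - q) ^+ 4 + 8 * (p * q) * (x ^+ 2 + y ^+ 2) + 32 * a.
    by rewrite /a -sn /p /q /x /y; field.
  lra.
have pq4 : 4 * (p * q) = n ^+ 2 - (p - q) ^+ 2 by rewrite -sn /p /q; ring.
have xy0 : 0 <= 8 * (p * q) * (x ^+ 2 + y ^+ 2).
  by rewrite mulr_ge0 ?mulr_ge0 ?addr_ge0 ?sqr_ge0.
have hpq : `|p - q| <= z * n.
  apply: ler_norm_sqr => //; rewrite -(ler_pXn2r (isT : (0 < 2)%N)) ?nnegrE ?sqr_ge0 //.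
  by rewrite -!exprM; lra.
have pq8 : n ^+ 2 <= 8 * (p * q).
  have : (p - q) ^+ 2 <= (z * n) ^+ 2.
    by rewrite -(real_normK (num_real (p - q))) ler_pXn2r ?nnegrE.
  have : (z * n) ^+ 2 <= (1 / 2 * n) ^+ 2.
    have h : z * n <= 1 / 2 * n by rewrite ler_wpM2r // ltW.
    by rewrite ler_pXn2r ?nnegrE //; exact: le_trans h.
  rewrite !exprMn; lra.
have hxy : x ^+ 2 + y ^+ 2 <= (z * n) ^+ 2.
  have n2 : 0 < n ^+ 2 by rewrite exprn_gt0.
  rewrite -(ler_pM2l n2).
  have : n ^+ 2 * (x ^+ 2 + y ^+ 2) <= 8 * (p * q) * (x ^+ 2 + y ^+ 2).
    by rewrite ler_wpM2r // addr_ge0 ?sqr_ge0.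
  have pq4' : 0 <= (p - q) ^+ 4 by rewrite (exprM _ 2 2) sqr_ge0.
  have : (z * n) ^+ 4 <= n ^+ 2 * (z * n) ^+ 2.
    rewrite (exprM _ 2 2) [X in X <= _]expr2 ler_wpM2r ?sqr_ge0 //.
    by rewrite ler_pXn2r ?nnegrE ?(ltW n0) // ler_piMl ?(ltW n0) //; lra.
  lra.
have hx : `|x| <= z * n by apply: ler_norm_sqr => //; have := sqr_ge0 y; lra.
have hy : `|y| <= z * n by apply: ler_norm_sqr => //; have := sqr_ge0 x; lra.
have e0 : s0 - n / 4 = (p - q) / 4 + x / 2 by rewrite -sn /p /q /x; field.
have e1 : s1 - n / 4 = (p - q) / 4 - x / 2 by rewrite -sn /p /q /x; field.
have e2 : s2 - n / 4 = - ((p - q) / 4) + y / 2 by rewrite -sn /p /q /y; field.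
have e3 : s3 - n / 4 = - ((p - q) / 4) - y / 2 by rewrite -sn /p /q /y; field.
move: hpq hx hy; rewrite !ler_norml => /andP[? ?] /andP[? ?] /andP[? ?].
by rewrite e0 e1 e2 e3; split; lra.
Qed.

End Balance.

Section Minimal.
Variables (R : realFieldType) (V : finType).
Local Notation n := (#|V|%:R : R).

(** A tuple lost in passing to the blow-up has a mismatch in one of its six pairs. *)
Lemma hom_count_blow_ge (e : rel V) col :
  hom_count R e - 6 * (n ^+ 2 * (mismatches e col)%:R) <= hom_count R (blow col).
Proof.
have MM : \sum_y \sum_z (mismatch e col y z)%:R = (mismatches e col)%:R :> R.
  by rewrite /mismatches natr_sum; apply: eq_bigr => y _; rewrite natr_sum.
have M1 : Sum4 (fun x y z w => (mismatch e col x y)%:R) = n ^+ 2 * (mismatches e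
  col)%:R :> R.
  rewrite -MM /Sum4 mulr_sumr; apply: eq_bigr => x _; rewrite mulr_sumr.
  by apply: eq_bigr => y _; rewrite !sum_constV mulrA.
rewrite lerBlDr.
apply: (@le_trans _ _ (Sum4 (fun x y z w => (P3K1_at (blow col) x y z w)%:R
   + (mismatch e col x y)%:R + (mismatch e col y z)%:R + (mismatch e col x z)%:R
   + (mismatch e col x w)%:R + (mismatch e col y w)%:R + (mismatch e col z w)%:R))).
  apply: ler_Sum4 => x y z w; rewrite -!natrD ler_nat /P3K1_at /mismatch
    -!/(blow col _ _).
  by do 6 (case: (e _ _) => //; case: (blow col _ _)).
rewrite !Sum4D M1.
have M2 : Sum4 (fun x y z w => (mismatch e col x z)%:R) = n ^+ 2 * (mismatches e
  col)%:R :> R.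
  by rewrite -M1 (Sum4_swap12 (fun x y z w => (mismatch e col x y)%:R)).
have M3 : Sum4 (fun x y z w => (mismatch e col x w)%:R) = n ^+ 2 * (mismatches e
  col)%:R :> R.
  by rewrite -M2 (Sum4_swap23 (fun x y z w => (mismatch e col x z)%:R)).
have M4 : Sum4 (fun x y z w => (mismatch e col y z)%:R) = n ^+ 2 * (mismatches e
  col)%:R :> R.
  by rewrite -M2 (Sum4_swap01 (fun x y z w => (mismatch e col x z)%:R)).
have M5 : Sum4 (fun x y z w => (mismatch e col y w)%:R) = n ^+ 2 * (mismatches e
  col)%:R :> R.
  by rewrite -M4 (Sum4_swap23 (fun x y z w => (mismatch e col y z)%:R)).
have M6 : Sum4 (fun x y z w => (mismatch e col z w)%:R) = n ^+ 2 * (mismatches e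
  col)%:R :> R.
  by rewrite -M5 (Sum4_swap12 (fun x y z w => (mismatch e col y w)%:R)).
rewrite M2 M3 M4 M5 M6 -/(hom_count R (blow col)).
have -> : Sum4 (fun x y z w => (P3K1_at (blow col) x y z w)%:R) = hom_count R (blow
  col) by [].
lra.
Qed.

Definition minimal_colouring (e : rel V) (col : V -> 'I_4) :=
  forall col', (mismatches e col <= mismatches e col')%N.

Lemma minimal_colouring_exists (e : rel V) : exists col, minimal_colouring e col.
Proof.
pose c := [arg min_(c < ([ffun=> ord0] : {ffun V -> 'I_4})) mismatches e c].
exists c => col'; rewrite /c; case: arg_minnP => // c' _ /(_ (finfun col') isT).
move=> h; apply: leq_trans h _; apply: leq_sum => v _; apply: leq_sum => w _.
by rewrite /mismatch !ffunE.
Qed.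

Variables (e : rel V) (col : V -> 'I_4).
Hypotheses (esym : symmetric e) (eirr : irreflexive e).

(** Recolouring x alone changes the mismatches by twice the change of its own errors, since ordered
    pairs are counted. *)
Lemma minimal_class_errors x c' : minimal_colouring e col ->
  class_errors R col (e x) (col x) <= class_errors R col (e x) c'.
Proof.
move=> /(_ (fun v => if v == x then c' else col v)) cmin.
rewrite /class_errors -!natr_sum ler_nat -leq_double -(leq_add2l (mismatches e col)).
pose col' v := if v == x then c' else col v.
pose m' w : nat := e x w != adj K2_K2 c' (col w).
apply: leq_trans (leq_add cmin (leqnn _)) _.
have d1 (f : V -> nat) : (\sum_v \sum_w (v == x) * f w = \sum_w f w)%N.
  rewrite (bigD1 x) //= [X in (_ + X)%N]big1 ?addn0 => [|v vx].
    by apply: eq_bigr => w _; rewrite eqxx mul1n.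
  by rewrite (negbTE vx) big1.
have d2 (f : V -> nat) : (\sum_v \sum_w (w == x) * f v = \sum_w f w)%N.
  by rewrite exchange_big d1.
rewrite -!addnn -{1}(d1 (fun w => e x w != adj K2_K2 (col x) (col w) : nat)).
rewrite -{1}(d2 (fun w => e x w != adj K2_K2 (col x) (col w) : nat)).
rewrite -{1}(d1 m') -{1}(d2 m').
rewrite /mismatches -!big_split; apply: leq_sum => v _.
rewrite -!big_split; apply: leq_sum => w _ /=.
rewrite /mismatch /m' -!/(col' _).
have [->|vx] := eqVneq v x; have [->|wx] := eqVneq w x; rewrite /col' ?eqxx ?adjxx ?eirr.
- by rewrite !mul1n; lia.
- by rewrite (negbTE wx) mul1n; lia.
- rewrite (negbTE vx) (esym v x) (adjC _ (col v) c') (adjC _ (col v) (col x)).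
  by rewrite !mul0n !mul1n !add0n addnC.
- by rewrite (negbTE vx) (negbTE wx) !mul0n.
Qed.

End Minimal.

Section Improvement.
Variables (R : realFieldType) (V : finType).
Local Notation n := (#|V|%:R : R).

Lemma inj_count_le_hom_count (e : rel V) : inj_count R e <= hom_count R e.
Proof.
apply: ler_Sum4 => x y z w; rewrite -/(P3K1_at e x y z w) ler_nat.
by case: (P3K1_at e x y z w) => //=; case: (x != z).
Qed.

(** Deviations of [size_tol * n] are deviations of [4 * size_tol] relative to n/4, and
    [degree_gain_ge] needs [32 * 100 * d <= 1]. *)
Definition size_tol : R := (128 * 100)^-1.
(** Chosen so that [12 * near_tol = size_tol^4 / 32]: half of it is the deficit of the count, half
    the six mismatch terms of [hom_count_blow_ge]. *)
Definition near_tol : R := size_tol ^+ 4 / 384.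

Lemma size_tol_gt0 : 0 < size_tol.
Proof. by rewrite invr_gt0 mulr_gt0. Qed.

Lemma near_tol_gt0 : 0 < near_tol.
Proof. by rewrite divr_gt0 // exprn_gt0 // size_tol_gt0. Qed.

Lemma near_tol_small : near_tol <= 1000^-1 * (1000^-1 * (1000^-1 * 1000^-1)).
Proof.
have h : size_tol <= 1000^-1 by rewrite lef_pV2 ?posrE ?mulr_gt0 //; lra.
have : size_tol ^+ 4 <= (1000^-1) ^+ 4.
  by apply: lerXn2r => //; rewrite nnegrE ?invr_ge0 // mulr_ge0.
have -> : (1000^-1) ^+ 4 = 1000^-1 * (1000^-1 * (1000^-1 * 1000^-1)) :> R by rewrite
  !exprS expr0 mulr1.
rewrite /near_tol; lra.
Qed.

Section Step.
Variables (e : rel V) (col : V -> 'I_4).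
Hypotheses (esym : symmetric e) (eirr : irreflexive e).
Hypothesis n_large : 256 * 1000 <= n.
Hypothesis inj_large : (1 / 32 - 6 * near_tol) * n ^+ 4 <= inj_count R e.
Hypothesis few : (mismatches e col)%:R <= near_tol * n ^+ 2.
Hypothesis cmin : minimal_colouring e col.

Let n_gt0 : 0 < n.
Proof. by apply: lt_le_trans n_large; rewrite mulr_gt0. Qed.

Lemma balanced_classes i : `|class_size R col i - n / 4| <= 4 * size_tol * (n / 4).
Proof.
have z4 : size_tol ^+ 4 / 32 = 12 * near_tol by rewrite /near_tol; field.
have z1 : 0 <= size_tol <= 1 / 2.
  by rewrite ltW ?size_tol_gt0 //= mul1r lef_pV2 ?posrE ?mulr_gt0 //; lra.
have -> : 4 * size_tol * (n / 4) = size_tol * n by field.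
have s0 := class_size_ge0 R col.
have [||h0 h1 h2 h3] := balanced_sizes n_gt0 z1 (s0 i0) (s0 i1) (s0 i2) (s0 i3).
- exact: sum_class_size.
- rewrite -hom_count_blow z4; apply: le_trans (hom_count_blow_ge R e col).
  apply: le_trans (lerB (inj_count_le_hom_count e) (lexx _)).
  have h : n ^+ 2 * (mismatches e col)%:R <= near_tol * n ^+ 4.
    have -> : near_tol * n ^+ 4 = n ^+ 2 * (near_tol * n ^+ 2) by ring.
    by rewrite ler_wpM2l // exprn_ge0.
  move: inj_large h; lra.
by case: (ord4P i) => ->.
Qed.

(** The main gain is [n^2 d / 320], from classes of size about n/4. The three errors of
    [reattach_gain] must leave a quarter of it: [n d] is small as n is large, [d M] as mismatches
    are few, and [n S] because d is the maximum mismatch degree. *)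
Lemma improvement_step : (0 < mismatches e col)%N ->
  exists2 x, (0 < mis_degree e col x)%N &
    n ^+ 2 * (mis_degree e col x)%:R / 1280
    <= inj_count R (reattach e (blow col) x) - inj_count R e.
Proof.
move=> pos.
have [v0 v0pos] : exists v, (0 < mis_degree e col v)%N.
  have [v hv|none] := pickP (fun v => 0 < mis_degree e col v)%N; first by exists v.
  move: pos; rewrite /mismatches big1 // => v _.
  by apply/eqP; rewrite -leqn0 leqNgt none.
pose x := [arg max_(x > v0) mis_degree e col x].
have xmax v : (mis_degree e col v <= mis_degree e col x)%N.
  by rewrite /x; case: arg_maxnP => // y _ /(_ v); exact.
have xpos : (0 < mis_degree e col x)%N by exact: leq_trans (xmax v0).
exists x => //; apply: le_trans (reattach_gain R col x esym eirr).
pose d : R := (mis_degree e col x)%:R; rewrite -/d.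
have dE : \sum_v (mismatch e col x v)%:R = d by rewrite /d /mis_degree natr_sum.
rewrite dE; set S := \sum_v _; set M := (mismatches e col)%:R.
have d0 : 0 < d by rewrite ltr0n.
have MS : M = \sum_v (mis_degree e col v)%:R by rewrite /M /mismatches natr_sum.
have SM : S <= M.
  by rewrite MS; apply: ler_sum => v _; rewrite -natrM ler_nat;
    case: (mismatch _ _ _ _); rewrite ?mul1n.
have Sd : S <= d * d.
  rewrite -{1}dE mulr_suml; apply: ler_sum => v _.
  by rewrite ler_wpM2l // ler_nat.
have S0 : 0 <= S by apply: sumr_ge0 => v _; rewrite mulr_ge0.
have M0 : 0 <= M by [].
have := @vertex_degree_gain R V col (e x) (n / 4) (4 * size_tol) (col x).
have -> : class_errors R col (e x) (col x) = d by rewrite -dE.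
rewrite -[fun v => adj K2_K2 (col x) (col v)]/(blow col x) => gain.
have {gain} : (n / 4) ^+ 2 * d / 20 <= vertex_degree R col (blow col x)
  - vertex_degree R col (e x).
  apply: gain; rewrite ?divr_gt0 //; last 2 first.
  - exact: balanced_classes.
  - by move=> c'; rewrite -[X in X <= _]dE; exact: minimal_class_errors.
  by rewrite /size_tol -[X in _ <= X](@divff _ (128 * 100)) ?mulf_neq0 ?pnatr_eq0 //; lra.
have -> : (n / 4) ^+ 2 * d / 20 = n ^+ 2 * d / 320 by field.
move: (vertex_degree _ _ _ - _) => g hg.
have nn : 0 < n ^+ 2 * d by rewrite mulr_gt0 // exprn_gt0.
have e3 : 192 * (n * d) <= n ^+ 2 * d / 1280.
  have -> : n ^+ 2 * d / 1280 = n * d * (n / 1280) by ring.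
  rewrite mulrC ler_pM2l ?mulr_gt0 //; move: n_large; lra.
have tol := near_tol_small.
have tol0 := near_tol_gt0.
have {}tol : near_tol * (n ^+ 2 * d) <= 1000^-1 * (1000^-1 * (1000^-1 * 1000^-1))
  * (n ^+ 2 * d).
  by rewrite ler_pM2r.
have e2 : 48 * (d * M) <= n ^+ 2 * d / (128 * 1000).
  have : d * M <= d * (near_tol * n ^+ 2) by rewrite ler_pM2l.
  lra.
have e1 : 96 * (n * S) <= 96 * (n ^+ 2 * d) / (128 * 1000).
  (* If d is small against n, then [S <= d^2] suffices; if d is of order n, then [S <= M], which is
     far below [n d]. *)
  have [small|large] := lerP (128 * 1000 * d) n.
    have : n * S <= n * (d * d) by rewrite ler_pM2l.
    have : n * d * (128 * 1000 * d) <= n * d * n by rewrite ler_pM2l ?mulr_gt0.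
    lra.
  have : n * S <= n * (near_tol * n ^+ 2).
    by rewrite ler_pM2l //; exact: le_trans SM few.
  have : near_tol * n ^+ 2 * n <= near_tol * n ^+ 2 * (128 * 1000 * d).
    by rewrite ler_pM2l; [exact: ltW | rewrite mulr_gt0 // exprn_gt0].
  lra.
lra.
Qed.

End Step.
End Improvement.

(** * Stability *)

Section Stability.
Variables (R : realFieldType) (V : finType).
Local Notation n := (#|V|%:R : R).

Lemma eq_inj_count (e e' : rel V) : e =2 e' -> inj_count R e = inj_count R e'.
Proof. by move=> ee; apply: eq_Sum4 => x y z w; rewrite /P3K1_at !ee. Qed.

Lemma mismatches_reattach (e : rel V) col x : symmetric e -> irreflexive e ->
  (0 < mis_degree e col x)%N ->
  (mismatches (reattach e (blow col) x) col < mismatches e col)%N.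
Proof.
move=> es ei dpos.
have le v w : (mismatch (reattach e (blow col) x) col v w <= mismatch e col v w)%N.
  rewrite /mismatch /reattach; case: ifP => // _.
  by rewrite -/(blow col v w) eqxx.
rewrite /mismatches (bigD1 x) //= [ltnRHS](bigD1 x) //= -addSn leq_add //; last first.
  by apply: leq_sum => v _; apply: leq_sum => w _.
rewrite big1 // => w _.
by rewrite /mismatch /reattach eqxx -/(blow col x w) eqxx.
Qed.

(** The changed pairs are the mismatches of [col] at x, in both orders, so any other colouring gains
    at most as many. *)
Lemma mismatches_reattach_ge (e : rel V) col col' x : symmetric e -> irreflexive e ->
  (mismatches e col' <=
   mismatches (reattach e (blow col) x) col' + 2 * mis_degree e col x)%N.
Proof.
move=> es ei.
have d1 : (\sum_v \sum_w (v == x) * mismatch e col x w = mis_degree e col x)%N.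
  rewrite (bigD1 x) //= [X in (_ + X)%N]big1 ?addn0 => [|v vx].
    by apply: eq_bigr => w _; rewrite eqxx mul1n.
  by rewrite (negbTE vx) big1.
have d2 : (\sum_v \sum_w (w == x) * mismatch e col x v = mis_degree e col x)%N.
  by rewrite exchange_big d1.
rewrite mul2n -addnn -{1}d1 -{1}d2 /mismatches -!big_split; apply: leq_sum => v _.
rewrite -!big_split; apply: leq_sum => w _ /=.
rewrite /mismatch /reattach; have [->|vx] /= := eqVneq v x.
  rewrite mul1n -/(blow col x w).
  by case: (e x w); case: (blow col x w); case: (adj _ _ _).
have [->|wx] /= := eqVneq w x; last by rewrite leq_addr.
rewrite mul1n -/(blow col x v) (es v x) (blow_sym col v x).
by case: (e x v); case: (blow col x v); case: (adj _ _ _).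
Qed.

(** Induction on the minimal number of mismatches, with a fresh minimal colouring after each step.
    The count grows and the mismatches drop, so the hypotheses persist. A gain of [n^2 d / 1280]
    pays for 2d mismatches, whence 2560. *)
Lemma stability_from_colouring k (e : rel V) col :
  symmetric e -> irreflexive e -> 256 * 1000 <= n ->
  (1 / 32 - 6 * near_tol R) * n ^+ 4 <= inj_count R e ->
  (mismatches e col)%:R <= near_tol R * n ^+ 2 ->
  minimal_colouring e col -> mismatches e col = k ->
  exists col' : V -> 'I_4, inj_count R e + n ^+ 2 * k%:R / 2560 <= inj_count R (blow
    col').
Proof.
elim/ltn_ind: k e col => k IH e col es ei nl il few cmin kE.
have [k0|kpos] := posnP k.
  exists col; rewrite k0 mulr0 mul0r addr0 (@eq_inj_count e (blow col)) // => v w.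
  apply/eqP; move: kE; rewrite k0 => /eqP; rewrite /mismatches sum_nat_eq0.
  move/forallP/(_ v); rewrite sum_nat_eq0 => /forallP/(_ w).
  by rewrite /mismatch /blow eqb0 negbK.
have [|x dpos gain] := @improvement_step R V e col es ei nl il few cmin;
  first by rewrite kE.
set e' := reattach e (blow col) x in gain.
have es' : symmetric e' by apply: reattach_sym => //; exact: blow_sym.
have ei' : irreflexive e' by apply: reattach_irr => //; exact: blow_irr.
have [col1 min1] := minimal_colouring_exists e'.
have k1 : (mismatches e' col1 < k)%N.
  by rewrite -kE; exact: leq_ltn_trans (min1 col) (mismatches_reattach es ei dpos).
have n2 : 0 <= n ^+ 2 by rewrite exprn_ge0.
have gain0 : 0 <= n ^+ 2 * (mis_degree e col x)%:R / 1280 by rewrite divr_ge0 ?mulr_ge0.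
have few1 : (mismatches e' col1)%:R <= near_tol R * n ^+ 2.
  by apply: le_trans few; rewrite ler_nat kE ltnW.
have il1 : (1 / 32 - 6 * near_tol R) * n ^+ 4 <= inj_count R e'.
  by apply: le_trans il _; rewrite -subr_ge0; exact: le_trans gain.
have [col' h] := IH _ k1 e' col1 es' ei' nl il1 few1 min1 erefl.
exists col'; apply: le_trans h.
have : k%:R <= (mismatches e' col1)%:R + 2 * (mis_degree e col x)%:R :> R.
  rewrite -natrM -natrD ler_nat -kE.
  by apply: leq_trans (cmin col1) _; exact: mismatches_reattach_ge.
move/(ler_wpM2l n2); move: gain; rewrite -/e' mulrDr; lra.
Qed.

(** With [eps = near_tol / (144 * 128 * 128)], this deficit is the one for which the slack is at
    most [eps^2 n^5] and [near_extremal_colouring] leaves at most [near_tol * n^2] mismatches. *)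
Definition stab_tol : R := (near_tol R / (144 * 128 * 128)) ^+ 2 / 2304.

Lemma stab_tol_gt0 : 0 < stab_tol.
Proof.
apply: divr_gt0 => //; apply: exprn_gt0; apply: divr_gt0; first exact: near_tol_gt0.
by rewrite !mulr_gt0.
Qed.

Lemma stab_tol_le : stab_tol <= 1 / 2304.
Proof.
rewrite ler_pM2r ?invr_gt0 // expr_le1 //; last first.
  by apply: divr_ge0; [exact: ltW (near_tol_gt0 R) | rewrite !mulr_ge0].
have K0 : 0 < 144 * 128 * 128 :> R by rewrite !mulr_gt0.
by rewrite ler_pdivrMr //; have := near_tol_small R; lra.
Qed.

Lemma stability (e : rel V) : symmetric e -> irreflexive e -> 256 * 1000 <= n ->
  (1 / 32 - stab_tol) * n ^+ 4 <= inj_count R e ->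
  exists col : V -> 'I_4, exists col' : V -> 'I_4,
    inj_count R e + n ^+ 2 * (mismatches e col)%:R / 2560 <= inj_count R (blow col').
Proof.
move=> es ei nl il.
have n0 : 0 < n by apply: lt_le_trans nl; rewrite mulr_gt0.
pose eps := near_tol R / (144 * 128 * 128).
have K0 : 0 < 144 * 128 * 128 :> R by rewrite !mulr_gt0.
have eps0 : 0 < eps by rewrite divr_gt0 ?near_tol_gt0.
have nt := near_tol_small R.
have epsE : 144 * 128 * 128 * eps = near_tol R by rewrite mulrC divfK ?gt_eqF.
have eps1 : eps <= (128 * 128)^-1 by move: epsE nt eps0; lra.
have st : 2304 * stab_tol = eps ^+ 2.
  by rewrite /stab_tol -/eps mulrC divfK // pnatr_eq0.
have near : 72 * n ^+ 5 - 2304 * (n * hom_count R e) <= eps ^+ 2 * n ^+ 5.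
  have : n * ((1 / 32 - stab_tol) * n ^+ 4) <= n * hom_count R e.
    by rewrite ler_pM2l //; exact: le_trans (inj_count_le_hom_count R e).
  have -> : n * ((1 / 32 - stab_tol) * n ^+ 4) = n ^+ 5 / 32 - stab_tol * n ^+ 5 by field.
  rewrite -st; lra.
have [col0 h0] := near_extremal_colouring es eps0 n0 near eps1.
have [col cmin] := minimal_colouring_exists e.
exists col.
apply: (stability_from_colouring es ei nl _ _ cmin erefl).
  apply: le_trans il; rewrite ler_wpM2r ?exprn_ge0 // lerB //.
  have : eps ^+ 2 <= eps * 1 by rewrite expr2 ler_pM2l //; move: epsE nt eps0; lra.
  by move: st epsE eps0; lra.
rewrite epsE in h0; apply: le_trans h0.
by rewrite ler_nat.
Qed.

End Stability.

(** * Copies, complements and the paw *)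

Lemma P3_K1_nth (i j : 'I_4) :
  adj P3_K1 i j = nth false (nth [::] [:: [:: false; true; false; false];
     [:: true; false; true; false]; [:: false; true; false; false];
     [:: false; false; false; false]] i) j.
Proof.
rewrite adj_graph_of_rel.
by case: i => [[|[|[|[|//]]]] ?]; case: j => [[|[|[|[|//]]]] ?].
Qed.

Lemma paw_nth (i j : 'I_4) :
  adj paw i j = nth false (nth [::] [:: [:: false; true; true; false];
     [:: true; false; true; false]; [:: true; true; false; true];
     [:: false; false; true; false]] i) j.
Proof.
rewrite adj_graph_of_rel.
by case: i => [[|[|[|[|//]]]] ?]; case: j => [[|[|[|[|//]]]] ?].
Qed.

Lemma induces_copyP (S T : finType) (F : sgraph S) (G : sgraph T) X :
  reflect (exists f : S -> T, [/\ injective f, (forall u v, adj G (f u) (f v) = adj F u v)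
             & (f @: [set: S])%SET = X])
          (induces_copy F G X).
Proof.
apply: (iffP existsP) => [[f /andP[/andP[/injectiveP fi /forallP fa] /eqP fX]]|].
  exists f; split => // u v; by move/forallP: (fa u) => /(_ v)/eqP.
case=> f [fi fa fX]; exists (finfun f); apply/andP; split.
  apply/andP; split; first by apply/injectiveP => x y; rewrite !ffunE; exact: fi.
  by apply/forallP => u; apply/forallP => v; rewrite !ffunE fa.
apply/eqP; rewrite -fX; apply/setP => y; apply/imsetP/imsetP => -[u _ ->]; exists u => //;
  by rewrite ffunE.
Qed.

Section Copies.
Variables (S S' T : finType).

Lemma induces_copy_iso (F : sgraph S) (F' : sgraph S') (G : sgraph T) X :
  iso F F' -> induces_copy F G X = induces_copy F' G X.
Proof.
move=> FF'; apply/induces_copyP/induces_copyP => -[f [fi fa <-]].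
  have /isoP[h hb ha] : iso F' F by rewrite iso_sym.
  exists (f \o h); split; first exact: inj_comp fi (bij_inj hb).
    by move=> u v; rewrite /= fa ha.
  case: hb => h' hK h'K; apply/setP => y; apply/imsetP/imsetP => -[u _ ->].
    by exists (h u).
  by exists (h' u) => //=; rewrite h'K.
have /isoP[h hb ha] := FF'.
exists (f \o h); split; first exact: inj_comp fi (bij_inj hb).
  by move=> u v; rewrite /= fa ha.
case: hb => h' hK h'K; apply/setP => y; apply/imsetP/imsetP => -[u _ ->].
  by exists (h u).
by exists (h' u) => //=; rewrite h'K.
Qed.

Lemma nb_copies_iso (F : sgraph S) (F' : sgraph S') (G : sgraph T) :
  iso F F' -> nb_copies F G = nb_copies F' G.
Proof. by move=> FF'; apply: eq_card => X; rewrite !inE (induces_copy_iso G X FF'). Qed.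

Lemma nb_copies_adj (F : sgraph S) (G G' : sgraph T) :
  adj G =2 adj G' -> nb_copies F G = nb_copies F G'.
Proof.
move=> GG'; apply: eq_card => X; rewrite !inE.
by apply/induces_copyP/induces_copyP => -[f [fi fa fX]]; exists f; split=> // u v;
  rewrite ?GG' // -GG'.
Qed.

End Copies.

Section Complement.
Variable T : finType.

Definition complement (G : sgraph T) : sgraph T := graph_of_rel (fun u v => ~~ adj G u v).

Lemma adj_complement G u v : adj (complement G) u v = (u != v) && ~~ adj G u v.
Proof. by rewrite adj_graph_of_rel adjC orbb. Qed.

Lemma adj_complementK G u v : adj (complement (complement G)) u v = adj G u v.
Proof.
by rewrite !adj_complement; have [->|] := eqVneq u v; rewrite ?adjxx ?negbK.
Qed.

End Complement.

Lemma nb_copies_complement (S T : finType) (F : sgraph S) (G : sgraph T) :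
  nb_copies (complement F) G = nb_copies F (complement G).
Proof.
apply: eq_card => X; rewrite !inE.
apply/induces_copyP/induces_copyP => -[f [fi fa fX]]; exists f; split=> // u v.
  by rewrite adj_complement fa adj_complement (inj_eq fi); case: eqVneq => [->|_] /=;
    rewrite ?adjxx ?negbK.
have := fa u v; rewrite !adj_complement (inj_eq fi).
by case: eqVneq => [->|_] /=; rewrite ?adjxx // => <-; rewrite negbK.
Qed.

Lemma iso_paw : iso paw (complement P3_K1).
Proof.
pose f (i : 'I_4) : 'I_4 := nth i0 [:: i0; i2; i3; i1] i.
pose g (i : 'I_4) : 'I_4 := nth i0 [:: i0; i3; i1; i2] i.
apply/isoP; exists f.
  exists g; case=> [[|[|[|[|//]]]] ?]; apply: val_inj; rewrite /f /g /i0 /i1 /i2 /i3 /=;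
  by rewrite !inordK.
move=> u v; rewrite adj_complement P3_K1_nth paw_nth /f /i0 /i1 /i2 /i3.
by case: u => [[|[|[|[|//]]]] ?]; case: v => [[|[|[|[|//]]]] ?];
  rewrite /= -val_eqE /= !inordK.
Qed.

Lemma nb_copies_paw (T : finType) (G : sgraph T) :
  nb_copies paw G = nb_copies P3_K1 (complement G).
Proof. by rewrite (nb_copies_iso G iso_paw) nb_copies_complement. Qed.

Section P3K1Copies.
Variables (R : realFieldType) (T : finType) (G : sgraph T).

Lemma induced_embedding_P3_K1 (f : {ffun 'I_4 -> T}) :
  induced_embedding P3_K1 G f =
  P3K1_at (adj G) (f i0) (f i1) (f i2) (f i3) && (f i0 != f i2).
Proof.
have as_ : symmetric (adj G) by move=> u v; rewrite adjC.
have ai : irreflexive (adj G) by move=> u; rewrite adjxx.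
apply/andP/andP => [[/injectiveP fi /forallP fa]|[H ne]].
  have e u v : adj G (f u) (f v) = adj P3_K1 u v by move/forallP: (fa u) => /(_ v)/eqP.
  split; first by rewrite /P3K1_at !e !P3_K1_nth /i0 /i1 /i2 /i3 !inordK.
  by rewrite (inj_eq fi) -val_eqE /= !inordK.
have [n1 n2 n3 n4 n5] := P3K1_repeat as_ ai H ne.
split.
  apply/injectiveP => u v.
  case: (ord4P u) => ->; case: (ord4P v) => -> // E; move: ne n1 n2 n3 n4 n5;
    by rewrite E eqxx.
case/and5P: H => a01 a12 /negbTE a02 /negbTE a03 /andP[/negbTE a13 /negbTE a23].
apply/forallP => u; apply/forallP => v; rewrite P3_K1_nth.
case: (ord4P u) => ->; case: (ord4P v) => ->; rewrite /i0 /i1 /i2 /i3 !inordK //= -/i0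
  -/i1 -/i2 -/i3;
  by rewrite ?ai // 1?as_ ?(a01, a12, a02, a03, a13, a23) // as_ ?(a01, a12, a02, a03,
    a13, a23).
Qed.

End P3K1Copies.

Section P3K1Count.
Variables (R : realFieldType) (T : finType) (G : sgraph T).

Lemma sum_ffun4 (F : T -> T -> T -> T -> R) :
  \sum_(f : {ffun 'I_4 -> T}) F (f i0) (f i1) (f i2) (f i3) = Sum4 F.
Proof.
rewrite /Sum4 (eq_bigr (fun x => \sum_(p : T * (T * T)) F x p.1 p.2.1 p.2.2)); last first.
  move=> x _; rewrite -(pair_bigA _ (fun y p => F x y p.1 p.2)) /=.
  by apply: eq_bigr => y _; rewrite -(pair_bigA _ (F x y)).
rewrite (pair_bigA _ (fun x p => F x p.1 p.2.1 p.2.2)) /=.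
pose h (p : T * (T * (T * T))) : {ffun 'I_4 -> T} :=
  [ffun i : 'I_4 => nth p.1 [:: p.1; p.2.1; p.2.2.1; p.2.2.2] i].
pose g (f : {ffun 'I_4 -> T}) := (f i0, (f i1, (f i2, f i3))).
have hg : cancel g h.
  by move=> f; apply/ffunP => i; rewrite ffunE; case: (ord4P i) => ->; rewrite /= inordK.
have gh : cancel h g.
  by move=> [x [y [z w]]]; rewrite /g /h !ffunE /i0 /i1 /i2 /i3 !inordK.
rewrite (reindex h) /=; last by exists g => ? _; [exact: gh | exact: hg].
by apply: eq_bigr => -[x [y [z w]]] _; rewrite /h !ffunE /i0 /i1 /i2 /i3 !inordK.
Qed.

Let E := [set f : {ffun 'I_4 -> T} | induced_embedding P3_K1 G f]%SET.

Lemma card_embeddings : #|E|%:R = inj_count R (adj G).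
Proof.
rewrite -sum1_card natr_sum big_mkcond /inj_count -sum_ffun4; apply: eq_bigr => f _.
by rewrite inE induced_embedding_P3_K1; case: (_ && _).
Qed.

Lemma P3_K1_centre (a b c : 'I_4) : adj P3_K1 a b -> adj P3_K1 a c -> b != c -> a = i1.
Proof.
rewrite !P3_K1_nth; case: (ord4P a) => ->; case: (ord4P b) => ->; case: (ord4P c) => ->;
  by rewrite ?eqxx /i0 /i1 /i2 /i3 !inordK.
Qed.

Lemma P3_K1_leaf (b : 'I_4) : adj P3_K1 i1 b -> b = i0 \/ b = i2.
Proof.
rewrite !P3_K1_nth; case: (ord4P b) => ->; rewrite /i0 /i1 /i2 /i3 !inordK //=;
  by [left|right].
Qed.

Definition swap_ends (f : {ffun 'I_4 -> T}) : {ffun 'I_4 -> T} :=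
  [ffun i : 'I_4 => nth (f i0) [:: f i2; f i1; f i0; f i3] i].

Lemma swap_endsE f : [/\ swap_ends f i0 = f i2, swap_ends f i1 = f i1,
  swap_ends f i2 = f i0 & swap_ends f i3 = f i3].
Proof. by rewrite !ffunE /i0 /i1 /i2 /i3 !inordK. Qed.

Lemma ffun4P (f g : {ffun 'I_4 -> T}) : f i0 = g i0 -> f i1 = g i1 -> f i2 = g i2 ->
  f i3 = g i3 -> f = g.
Proof. by move=> e0 e1 e2 e3; apply/ffunP => i; case: (ord4P i) => ->. Qed.

(** In P3 + K1 the centre is the only vertex of degree two and the isolated vertex the only one of
    degree zero, so an embedding is determined by its image up to exchanging the leaves. *)
Lemma same_image_embeddings (f g : {ffun 'I_4 -> T}) : f \in E ->
  ((g \in E) && (g @: [set: 'I_4] == f @: [set: 'I_4])%SET) = (g == f) || (g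
    == swap_ends f).
Proof.
rewrite inE => /[dup] fE /andP[/injectiveP fi /forallP fa].
have fe u v : adj G (f u) (f v) = adj P3_K1 u v by move/forallP: (fa u) => /(_ v)/eqP.
apply/andP/orP => [[]|].
  rewrite inE => /andP[/injectiveP gi /forallP ga] /eqP gf.
  have ge u v : adj G (g u) (g v) = adj P3_K1 u v by move/forallP: (ga u) => /(_ v)/eqP.
  have pre i : exists j, g i = f j.
    have : g i \in (f @: [set: 'I_4])%SET by rewrite -gf imset_f.
    by case/imsetP => j _ ->; exists j.
  have [j0 e0] := pre i0; have [j1 e1] := pre i1; have [j2 e2] := pre i2;
    have [j3 e3] := pre i3.
  have d (a b ja jb : 'I_4) : g a = f ja -> g b = f jb -> a != b -> ja != jb.
    by move=> ea eb; apply: contra_neq => jj; apply: gi; rewrite ea eb jj.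
  have n02 : i0 != i2 by rewrite -val_eqE /= !inordK.
  have n03 : i0 != i3 by rewrite -val_eqE /= !inordK.
  have n13 : i1 != i3 by rewrite -val_eqE /= !inordK.
  have n23 : i2 != i3 by rewrite -val_eqE /= !inordK.
  have a10 : adj P3_K1 j1 j0.
    by rewrite -fe -e1 -e0 ge P3_K1_nth /i0 /i1 !inordK.
  have a12 : adj P3_K1 j1 j2.
    by rewrite -fe -e1 -e2 ge P3_K1_nth /i2 /i1 !inordK.
  have j1E : j1 = i1 by apply: P3_K1_centre a10 a12 _; exact: d e0 e2 n02.
  have := d _ _ _ _ e0 e2 n02; have := d _ _ _ _ e0 e3 n03.
  have := d _ _ _ _ e1 e3 n13; have := d _ _ _ _ e2 e3 n23.
  move: a10 a12 e0 e1 e2 e3; rewrite j1E => /P3_K1_leaf a10 /P3_K1_leaf a12.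
  have [s0 s1 s2 s3] := swap_endsE f.
  case: a10 => ->; case: a12 => -> e0 e1 e2 e3; rewrite ?eqxx // => n0 n1 n2 n4;
    have j3E : j3 = i3 by case: (ord4P j3) n0 n1 n2 n4 => ->; rewrite ?eqxx.
    by left; apply/eqP; apply: ffun4P; rewrite ?e0 ?e1 ?e2 ?e3 ?j3E.
  by right; apply/eqP; apply: ffun4P; rewrite ?e0 ?e1 ?e2 ?e3 ?j3E ?s0 ?s1 ?s2 ?s3.
case=> /eqP ->; first by rewrite inE fE.
have [s0 s1 s2 s3] := swap_endsE f; split.
  rewrite inE induced_embedding_P3_K1 s0 s1 s2 s3.
  move: fE; rewrite induced_embedding_P3_K1 /P3K1_at.
  rewrite (adjC G (f i2) (f i1)) (adjC G (f i2) (f i0)) (eq_sym (f i2)) (adjC G (f i1)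
    (f i0)).
  case/andP=> /and5P[-> -> -> -> /andP[-> ->]] ->.
  by rewrite !andbT.
rewrite eqEsubset; apply/andP; split; apply/subsetP => y /imsetP[i _ ->]; apply/imsetP.
  case: (ord4P i) => ->; rewrite ?s0 ?s1 ?s2 ?s3;
  by [exists i0 | exists i1 | exists i2 | exists i3].
by case: (ord4P i) => ->; [exists i2 | exists i1 | exists i0 | exists i3].
Qed.

Lemma nb_copies_P3_K1 : 2 * (nb_copies P3_K1 G)%:R = inj_count R (adj G).
Proof.
rewrite -card_embeddings -natrM; congr _%:R.
pose im (f : {ffun 'I_4 -> T}) : {set T} := (f @: [set: 'I_4])%SET.
have -> : nb_copies P3_K1 G = #|(im @: E)%SET|.
  apply: eq_card => X; rewrite inE; apply/existsP/imsetP => -[f].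
    by case/andP => fE /eqP <-; exists f; rewrite ?inE.
  by rewrite inE => fE ->; exists f; rewrite fE /im eqxx.
rewrite -[RHS]sum1_card (partition_big_imset im) /= mulnC -sum_nat_const.
apply: eq_bigr => X /imsetP[f fE ->].
rewrite (eq_bigl (fun g => g \in [set f; swap_ends f]%SET)); last first.
  by move=> g; rewrite !inE -same_image_embeddings // inE.
rewrite sum1_card cards2; case: eqVneq => // e; exfalso.
have [s0 _ _ _] := swap_endsE f.
move: fE; rewrite inE induced_embedding_P3_K1 => /andP[_].
by rewrite -s0 -e eqxx.
Qed.

End P3K1Count.

Lemma iso_equivalence : {in [set: sgraph 'I_4]%SET & &, equivalence_rel (@iso 'I_4 'I_4)}.
Proof.
move=> F G H _ _ _; split.
  by apply/isoP; exists id => //; exact: inv_bij.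
by move=> FG; apply/idP/idP; apply: iso_trans => //; rewrite iso_sym.
Qed.

(** The transversal meets the isomorphism class of [F] in one graph, so [Lambda] has a single
    nonzero term. *)
Lemma unique_representative (F : sgraph 'I_4) :
  exists2 H0, iso H0 F &
    forall H, (H \in iso_representatives 4) && iso H F = (H == H0).
Proof.
pose P := equivalence_partition (@iso 'I_4 'I_4) [set: sgraph 'I_4]%SET.
have partP : partition P [set: sgraph 'I_4]%SET.
  exact: equivalence_partitionP iso_equivalence.
have /and3P[_ _ /forall_inP one] := transversalP partP.
have FP : F \in cover P by rewrite (cover_partition partP) inE.
have := one _ (pblock_mem FP) => /cards1P[H0 H0E].
have inblock H : (H \in pblock P F) = iso F H.
  by rewrite pblock_equivalence_partition ?inE //; exact: iso_equivalence.
have memE H : (H \in iso_representatives 4) && iso H F = (H == H0).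
  by rewrite iso_sym -inblock; have /setP/(_ H) := H0E; rewrite !inE => <-.
by exists H0 => //; have := memE H0; rewrite eqxx => /andP[].
Qed.

(** * Edit distance and elementary bounds *)

Lemma bigmin_leq (I : eqType) (s : seq I) (P : pred I) (F : I -> nat) x j :
  j \in s -> P j -> (\big[minn/x]_(i <- s | P i) F i <= F j)%N.
Proof.
elim: s => // i s IHs; rewrite inE big_cons => /orP[/eqP <- -> |js Pj].
  exact: geq_minl.
by case: ifP => _; rewrite ?geq_min IHs ?orbT.
Qed.

Lemma bigmin_leq_idx (I : Type) (s : seq I) (P : pred I) (F : I -> nat) x :
  (\big[minn/x]_(i <- s | P i) F i <= x)%N.
Proof.
elim: s => [|i s IHs]; first by rewrite big_nil.
by rewrite big_cons; case: ifP => _ //; rewrite geq_min IHs orbT.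
Qed.

Section Edits.
Variable T : finType.
Implicit Types G : sgraph T.

Lemma adj_blowup (c : T -> 'I_4) : adj (blowup K2_K2 c) =2 blow c.
Proof.
move=> u v; rewrite adj_graph_of_rel (adjC _ (c v)) orbb /blow.
by have [->|] := eqVneq u v; rewrite ?adjxx.
Qed.

Lemma edgeP G X : X \in edges G -> exists u v, X = [set u; v]%SET /\ adj G u v.
Proof.
move=> XG; have /forallP/(_ X)/implyP/(_ XG)/cards2P[u [v [uv XE]]] := valP G.
by exists u, v; split => //; rewrite /adj -XE.
Qed.

(** Each edited edge comes from a mismatched ordered pair. *)
Lemma nb_edits_leq G (c : T -> 'I_4) :
  (nb_edits G (blowup K2_K2 c) <= mismatches (adj G) c)%N.
Proof.
pose D := [set p : T * T | mismatch (adj G) c p.1 p.2]%SET.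
have -> : mismatches (adj G) c = #|D|.
  rewrite /mismatches pair_bigA -sum1_card [RHS]big_mkcond /=.
  by apply: eq_bigr => p _; rewrite inE; case: mismatch.
apply: leq_trans (leq_imset_card (fun p : T * T => [set p.1; p.2]%SET) D).
apply: subset_leq_card; apply/subsetP => X; rewrite !inE.
case/orP => /andP[nX /edgeP[u [v [XE uv]]]]; apply/imsetP; exists (u, v) => //.
  by rewrite inE /mismatch uv -/(blow c u v) -adj_blowup /adj -XE (negbTE nX).
rewrite inE /mismatch -/(blow c u v) -adj_blowup uv.
by rewrite /adj -XE (negbTE nX).
Qed.

End Edits.

Section Bounds.
Variables (R : realFieldType) (V : finType).
Local Notation n := (#|V|%:R : R).

Lemma inj_count_ge0 (e : rel V) : 0 <= inj_count R e.
Proof. by do 4 apply: sumr_ge0 => ? _. Qed.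

Lemma hom_count_le (e : rel V) : symmetric e -> hom_count R e <= n ^+ 4 / 32.
Proof.
move=> es; have [n0|npos] := posnP #|V|.
  rewrite /hom_count big1 ?n0 ?expr0n ?mul0r // => x _.
  by have := card0_eq n0 x; rewrite !inE.
have n0 : 0 < n by rewrite ltr0n.
have := hom_count_sos R es.
have sq0 t (F : V -> V -> V -> R) : 0 <= typed_sum e t (fun x y z => F x y z ^+ 2).
  by apply: typed_sum_ge0 => *; exact: sqr_ge0.
have := sq0 K2K1_type (ext R e diff12); have := sq0 K2K1_type (ext R e diff30).
have := sq0 K2K1_type (ext R e path_ext); have := sq0 K2K1_type (ext R e all_ext).
have := sq0 K3_type (ext R e two_ext) => s1 s2 s3 s4 s5 h.
rewrite -(ler_pM2l n0); have -> : n * (n ^+ 4 / 32) = n ^+ 5 / 32 by field.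
lra.
Qed.

(** The surplus tuples have x = z, and there are at most [n^3] of them. *)
Lemma hom_count_le_inj_count (e : rel V) : hom_count R e <= inj_count R e + n ^+ 3.
Proof.
have -> : n ^+ 3 = Sum4 (fun x y z w : V => (x == z)%:R) :> R.
  rewrite /Sum4; transitivity (\sum_(x : V) n * (n * (\sum_(z : V) (x == z)%:R)) : R).
    transitivity (\sum_(x : V) n ^+ 2 : R); first by rewrite sum_constV; ring.
    apply: eq_bigr => x _; rewrite (_ : \sum_z _ = 1) ?mulr1 //.
    by rewrite (bigD1 x) //= eqxx big1 ?addr0 // => z; rewrite eq_sym => /negbTE ->.
  apply: eq_bigr => x _; rewrite sum_constV; congr (_ * _).
  by rewrite mulr_sumr; apply: eq_bigr => z _; rewrite sum_constV.
rewrite /inj_count -Sum4D; apply: ler_Sum4 => x y z w.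
rewrite -natrD ler_nat -/(P3K1_at e x y z w).
by case: (P3K1_at e x y z w); case: (x == z).
Qed.

End Bounds.

Section Binomials.
Variable R : realFieldType.

Lemma bin4_ge (n : nat) : n%:R ^+ 4 - 6 * n%:R ^+ 3 <= 24 * 'C(n, 4)%:R :> R.
Proof.
have [n4|n4] := leqP 4 n; last first.
  apply: (@le_trans _ _ 0); last by rewrite mulr_ge0.
  rewrite exprS -mulrBl; apply: mulr_le0_ge0; last by rewrite exprn_ge0.
  by rewrite subr_le0 ler_nat (leq_trans (ltnW n4)).
have := bin_ffact n 4; rewrite /factorial /falling_factorial /=.
case: n n4 => [|[|[|[|m]]]] // _; rewrite /ffact_rec /= => h.
have -> : 24 * 'C(m.+4, 4)%:R = (m.+4 * (m.+3 * (m.+2 * (m.+1 * 1))))%:R :> R.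
  by rewrite -h natrM mulrC.
have e4 : m.+4%:R = m%:R + 4 :> R by rewrite -addn4 natrD.
have e3 : m.+3%:R = m%:R + 3 :> R by rewrite -addn3 natrD.
have e2 : m.+2%:R = m%:R + 2 :> R by rewrite -addn2 natrD.
have e1 : m.+1%:R = m%:R + 1 :> R by rewrite -addn1 natrD.
rewrite !natrM e4 e3 e2 e1 mulr1; have x0 : 0 <= m%:R :> R by [].
have : 0 <= m%:R ^+ 2 :> R by rewrite exprn_ge0.
lra.
Qed.

Lemma bin4_le (n : nat) : 24 * 'C(n, 4)%:R <= n%:R ^+ 4 :> R.
Proof.
rewrite -natrM -natrX ler_nat mulnC -[24%N]/(4`!)%N bin_ffact ffact_prod.
rewrite -[X in (_ <= _ ^ X)%N](card_ord 4) -prod_nat_const.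
by apply: leq_prod => i _; rewrite leq_subr.
Qed.

Lemma bin2_ge (n : nat) : (2 <= n)%N -> n%:R ^+ 2 <= 4 * 'C(n, 2)%:R :> R.
Proof.
move=> n2; rewrite -natrM -natrX ler_nat bin2.
have : ((n * n.-1)./2.*2 = n * n.-1)%N.
  by rewrite -[RHS]odd_double_half oddM; case: n n2 => // m _ /=; rewrite andNb.
by case: n n2 => // -[|m] // _ /=; rewrite -mul2n; nia.
Qed.

End Binomials.

Section BalancedColouring.
Variable R : realFieldType.

Definition mod4 (n : nat) (v : 'I_n) : 'I_4 := inord (v %% 4).

Lemma mod4_class (n : nat) (i : 'I_4) : n%:R / 4 - 1 <= class_size R (@mod4 n) i.
Proof.
have -> : class_size R (@mod4 n) i = #|[set v : 'I_n | mod4 v == i]%SET|%:R.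
  rewrite /class_size /colour_sum -sum1_card natr_sum; apply: eq_bigl => v.
  by rewrite inE.
have card_ge : (n %/ 4 <= #|[set v : 'I_n | mod4 v == i]%SET|)%N.
  have lt (k : 'I_(n %/ 4)) : (4 * k + i < n)%N.
    have := ltn_ord k; have := ltn_ord i; have := leq_trunc_div n 4; lia.
  rewrite -[X in (X <= _)%N]card_ord -(card_imset predT (f := fun k => Ordinal (lt k))).
    apply: subset_leq_card; apply/subsetP => v /imsetP[k _ ->].
    by rewrite inE /mod4 -val_eqE /= mulnC modnMDl inordK ?modn_small.
  by move=> k l /(congr1 val) /= /eqP; rewrite eqn_add2r eqn_mul2l => /eqP /val_inj.
have : n%:R <= 4 * #|[set v : 'I_n | mod4 v == i]%SET|%:R + 4 :> R.
  rewrite -natrM -natrD ler_nat; have := divn_eq n 4; have := ltn_pmod n (isT : (0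
    < 4)%N).
  lia.
lra.
Qed.

End BalancedColouring.

From mathcomp Require Import boolp classical_sets reals topology normedtype.
From mathcomp Require Import sequences.
Import numFieldNormedType.Exports.

Section Lambda.
Variable R : realType.
Local Notation pb := (inducibility_problem R P3_K1).

Lemma Lambda_P3_K1 (T : finType) (G : sgraph T) :
  Lambda pb G = (nb_copies P3_K1 G)%:R.
Proof.
have [H0 hH memE] := unique_representative P3_K1.
rewrite /Lambda (bigID (fun H : sgraph 'I_4 => iso H P3_K1)) /= [X in _
  + X]big1 ?addr0; last first.
  by move=> H /andP[_ /negbTE hH']; rewrite hH' mul0r.
rewrite (eq_bigl (pred1 H0)) => [|H]; last by rewrite memE.
by rewrite big_pred1_eq hH mul1r (nb_copies_iso G hH).
Qed.

Lemma lambda_P3_K1 (T : finType) (G : sgraph T) :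
  lambda pb G = inj_count R (adj G) / (2 * 'C(#|T|, 4)%:R).
Proof.
rewrite /lambda Lambda_P3_K1 -(nb_copies_P3_K1 R).
by rewrite -mulf_div divff ?mul1r // pnatr_eq0.
Qed.

End Lambda.

(** * The limit problem *)

Section Limits.
Variable R : realType.
Local Notation pb := (inducibility_problem R P3_K1).

Lemma adj_symmetric (T : finType) (G : sgraph T) : symmetric (adj G).
Proof. by move=> u v; rewrite adjC. Qed.

Lemma adj_irreflexive (T : finType) (G : sgraph T) : irreflexive (adj G).
Proof. by move=> u; rewrite adjxx. Qed.

Lemma lambda_le (n : nat) (G : sgraph 'I_n) :
  lambda pb G <= n%:R ^+ 4 / 32 / (2 * 'C(n, 4)%:R).
Proof.
rewrite lambda_P3_K1 card_ord ler_wpM2r ?invr_ge0 ?mulr_ge0 //.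
apply: le_trans (inj_count_le_hom_count R _) _.
by have := hom_count_le R (adj_symmetric G); rewrite card_ord.
Qed.

Lemma lambda_le_max (n : nat) (G : sgraph 'I_n) : lambda pb G <= lambda_max pb n.
Proof.
apply: sup_ubound; last by exists G.
by exists (n%:R ^+ 4 / 32 / (2 * 'C(n, 4)%:R)) => _ [H _ <-]; exact: lambda_le.
Qed.

Lemma lambda_max_le (n : nat) : lambda_max pb n <= n%:R ^+ 4 / 32 / (2 * 'C(n, 4)%:R).
Proof.
(* The supremum is taken over a nonempty set: the empty graph is a witness. *)
apply: ge_sup; first by exists (lambda pb (graph_of_rel (fun u v : 'I_n => false)));
  eexists.
by move=> _ [H _ <-]; exact: lambda_le.
Qed.

Lemma cvg_of_rate (u : nat -> R) (l K : R) (N : nat) :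
  (forall n, (N <= n)%N -> `|u n - l| <= K / n%:R) -> (u n @[n --> \oo] --> l)%classic.
Proof.
move=> h; apply/cvgrPdist_le => eps eps0; near=> n.
have nN : (N <= n)%N by near: n; exact: nbhs_infty_ge.
have n1 : (0 < n)%N by near: n; exact: nbhs_infty_gt.
have nK : K / eps <= n%:R by near: n; exact: nbhs_infty_ger.
rewrite distrC; apply: le_trans (h _ nN) _.
by rewrite ler_pdivrMr ?ltr0n // mulrC -ler_pdivrMr.
Unshelve. all: by end_near. Qed.

(** Colouring vertices by their residue modulo 4 gives classes of size at least t = n/4 - 1, hence
    [hom_count] at least [8 t^4]; the last [n^3] removes the degenerate tuples. *)
Lemma lambda_max_ge (n : nat) : (4 <= n)%N ->
  12 * ((n%:R ^+ 4 - 16 * n%:R ^+ 3) / 32 - n%:R ^+ 3) / n%:R ^+ 4 <= lambda_max pb n.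
Proof.
move=> n4; apply: le_trans (lambda_le_max (blowup K2_K2 (@mod4 n))).
rewrite lambda_P3_K1 card_ord (eq_inj_count R (adj_blowup _)).
have n0 : 0 < n%:R :> R by rewrite ltr0n (leq_trans _ n4).
have C0 : 0 < 'C(n, 4)%:R :> R by rewrite ltr0n bin_gt0.
have i_ge0 := inj_count_ge0 R (blow (@mod4 n)).
apply: (@le_trans _ _ (12 * inj_count R (blow (@mod4 n)) / n%:R ^+ 4)); last first.
  rewrite ler_pdivrMr ?exprn_gt0 // mulrAC ler_pdivlMr ?mulr_gt0 //.
  have := ler_wpM2l i_ge0 (bin4_le R n); lra.
rewrite ler_wpM2r ?invr_ge0 ?exprn_ge0 ?(ltW n0) // ler_wpM2l //.
rewrite lerBlDr; have := hom_count_le_inj_count R (blow (@mod4 n)); rewrite card_ord.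
apply: le_trans; rewrite hom_count_blow.
have := mod4_class R n i0; have := mod4_class R n i1; have := mod4_class R n i2;
  have := mod4_class R n i3.
move: (class_size R (@mod4 n) i0) (class_size R (@mod4 n) i1) (class_size R (@mod4 n) i2)
  (class_size R (@mod4 n) i3) => s0 s1 s2 s3.
have n4R : 4 <= n%:R :> R by rewrite ler_nat.
pose t : R := n%:R / 4 - 1; have t0 : 0 <= t by rewrite /t; lra.
rewrite -/t => h3 h2 h1 h0.
apply: (@le_trans _ _ ((t + t) * (t + t) * (t * t + t * t))).
  have -> : n%:R = 4 * (t + 1) by rewrite /t; field.
  rewrite !exprMn; have : 0 <= t ^+ 2 by rewrite exprn_ge0.
  lra.
have tt : 0 <= t + t by rewrite addr_ge0.
apply: ler_pM; first exact: mulr_ge0.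
- by rewrite addr_ge0 // mulr_ge0.
- by apply: ler_pM => //; apply: lerD.
- by apply: lerD; apply: ler_pM.
Qed.

End Limits.

(** * Perfect stability and the inducibility of the paw *)

Section Theorems.
Variable R : realType.
Local Notation pb := (inducibility_problem R P3_K1).

Lemma bin4_half (n : nat) : (12 <= n)%N -> n%:R ^+ 4 <= 48 * 'C(n, 4)%:R :> R.
Proof.
move=> n12; have n12R : 12 <= n%:R :> R by rewrite ler_nat.
have := bin4_ge R n.
have : 12 * n%:R ^+ 3 <= n%:R ^+ 4 :> R by rewrite (exprS _ 3) ler_wpM2r ?exprn_ge0.
lra.
Qed.

Lemma lambda_max_rate (n : nat) : (12 <= n)%N -> `|lambda_max pb n - 3 / 8| <= 18 / n%:R.
Proof.
move=> n12; have n4 : (4 <= n)%N by exact: leq_trans n12.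
have n0 : 0 < n%:R :> R by rewrite ltr0n (leq_trans _ n12).
have C0 : 0 < 'C(n, 4)%:R :> R by rewrite ltr0n bin_gt0.
rewrite ler_norml; apply/andP; split.
  have := lambda_max_ge R n4.
  have -> : 12 * ((n%:R ^+ 4 - 16 * n%:R ^+ 3) / 32 - n%:R ^+ 3) / n%:R ^+ 4 = 3 / 8
    - 18 / n%:R :> R.
    by field; rewrite gt_eqF.
  lra.
rewrite lerBlDr; apply: le_trans (lambda_max_le R n) _.
rewrite ler_pdivrMr ?mulr_gt0 //.
have h : n%:R ^+ 3 <= 48 * 'C(n, 4)%:R / n%:R :> R.
  by rewrite ler_pdivlMr // -exprSr; exact: bin4_half.
have := bin4_ge R n.
have -> : (18 / n%:R + 3 / 8) * (2 * 'C(n, 4)%:R) = 3 / 4 * (48 * 'C(n, 4)%:R / n%:R)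
  + 3 / 4 * 'C(n, 4)%:R :> R.
  by field; rewrite gt_eqF.
move: h; move: (48 * _ / _) => y.
have : 0 <= n%:R ^+ 3 :> R by rewrite exprn_ge0 ?ltW.
lra.
Qed.

Lemma lambda_max_cvg : (lambda_max pb n @[n --> \oo] --> (3 / 8 : R))%classic.
Proof. exact: cvg_of_rate lambda_max_rate. Qed.

Lemma max_density_paw (n : nat) : max_density R paw n = lambda_max pb n.
Proof.
have dens (G : sgraph 'I_n) : density R paw G = lambda pb (complement G).
  by rewrite /density /lambda Lambda_P3_K1 nb_copies_paw !card_ord.
congr sup; apply/seteqP; split => _ [G _ <-].
  by exists (complement G); rewrite ?dens.
exists (complement G) => //; rewrite dens /lambda !Lambda_P3_K1; congr (_%:R / _).
by apply: nb_copies_adj => u v; rewrite adj_complementK.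
Qed.

Lemma paw_inducibility : has_inducibility paw (3 / 8 : R).
Proof.
rewrite /has_inducibility (_ : max_density R paw = lambda_max pb);
  first exact: lambda_max_cvg.
by apply/funext => n; exact: max_density_paw.
Qed.

Lemma edit_distance_le1 (n : nat) (G : sgraph 'I_n) : edit_distance K2_K2 R G <= 1.
Proof.
rewrite /edit_distance card_ord; have [->|C0] := posnP 'C(n, 2).
  by rewrite invr0 mulr0.
by rewrite ler_pdivrMr ?ltr0n // mul1r ler_nat bigmin_leq_idx.
Qed.

Lemma edit_distance_le (n : nat) (G : sgraph 'I_n) (c : 'I_n -> 'I_4) : (2 <= n)%N ->
  edit_distance K2_K2 R G <= 4 * (mismatches (adj G) c)%:R / n%:R ^+ 2.
Proof.
move=> n2; rewrite /edit_distance card_ord.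
have C0 : 0 < 'C(n, 2)%:R :> R by rewrite ltr0n bin_gt0.
have n0 : 0 < n%:R :> R by rewrite ltr0n (leq_trans _ n2).
rewrite ler_pdivrMr // mulrAC ler_pdivlMr ?exprn_gt0 //.
apply: le_trans (_ : _ <= (mismatches (adj G) c)%:R * (4 * 'C(n, 2)%:R)) _; last first.
  by rewrite mulrA (mulrC _ 4).
apply: ler_pM; [by [] | by rewrite exprn_ge0 // ltW | | exact: bin2_ge].
rewrite ler_nat; apply: leq_trans (nb_edits_leq G c).
apply: bigmin_leq; first by rewrite mem_index_enum.
apply/existsP; exists (finfun c); apply/eqP; congr graph_of_rel.
by apply/funext => u; apply/funext => v; rewrite !ffunE.
Qed.

Lemma perfectly_stable_P3_K1 : perfectly_stable pb K2_K2.
Proof.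
pose tau := stab_tol R; have tau0 : 0 < tau := stab_tol_gt0 R.
(* The first summand is the constant of the final estimate, the second the order required by
   [stability]; [4 / tau] settles graphs far from extremal and makes 1/n at most [tau / 4]. *)
pose C : R := 1000 + 256 * 1000 + 4 / tau.
have t4 : 0 < 4 / tau by rewrite divr_gt0.
have C0 : 0 < C by rewrite /C; lra.
exists C => // n G Cn _.
have C1 : 256 * 1000 <= n%:R :> R by apply: le_trans Cn; rewrite /C; lra.
have C2 : 4 / tau <= n%:R by apply: le_trans Cn; rewrite /C; lra.
have n12 : (12 <= n)%N by rewrite -(ler_nat R); lra.
have n0 : 0 < n%:R :> R by rewrite ltr0n (leq_trans _ n12).
have B0 : 0 < 'C(n, 4)%:R :> R by rewrite ltr0n bin_gt0 (leq_trans _ n12).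
set delta := lambda_max pb n - lambda pb G.
have delta0 : 0 <= delta by rewrite subr_ge0 lambda_le_max.
(* The threshold [6 * tau] costs [tau / 2] after multiplication by [2 * 'C(n, 4)], about [n^4 / 12];
   the other half covers the terms in 1/n. *)
have [big|small] := lerP (6 * tau) delta.
  apply: le_trans (edit_distance_le1 G) _.
  apply: le_trans (_ : 1 <= 4 / tau * (6 * tau)) _.
    by rewrite mulrCA divfK ?gt_eqF //; lra.
  by apply: ler_pM => //; [exact: ltW | rewrite mulr_ge0 // ltW | rewrite /C; lra].
have lE : inj_count R (adj G) = lambda pb G * (2 * 'C(n, 4)%:R).
  by rewrite lambda_P3_K1 card_ord divfK // gt_eqF // mulr_gt0.
have large : (1 / 32 - tau) * n%:R ^+ 4 <= inj_count R (adj G).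
  rewrite lE.
  have rate := lambda_max_rate n12.
  have nt : 1 / n%:R <= tau / 4 by rewrite ler_pdivrMr //; move: C2;
    rewrite ler_pdivrMr //; lra.
  have l1 : 3 / 8 - 18 / n%:R - 6 * tau <= lambda pb G.
    move: rate small; rewrite ler_norml /delta => /andP[r1 _] r2.
    move: r1 r2; move: (18 / _) (lambda_max _ _) (lambda _ _) => y1 y2 y3; lra.
  have b4 := bin4_ge R n.
  have tau1 : tau <= 1 / 2304 := stab_tol_le R.
  move: nt l1; set x := 1 / n%:R => nt l1.
  have x0 : 0 <= x by rewrite divr_ge0 // ltW.
  have n3 : n%:R ^+ 3 = n%:R ^+ 4 * x :> R by rewrite /x; field; rewrite gt_eqF.
  rewrite -[18 / n%:R]/(18 * (n%:R)^-1) -[n%:R^-1]mul1r -/x in l1.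
  set A := 3 / 8 - 18 * x - 6 * tau in l1.
  have A0 : 0 <= A by rewrite /A; lra.
  have xA : 0 <= x * (3 / 8 - A) by rewrite mulr_ge0 // /A; lra.
  apply: le_trans (_ : _ <= A * (2 * 'C(n, 4)%:R)) _; last by rewrite ler_pM2r ?mulr_gt0.
  apply: le_trans (_ : A * ((n%:R ^+ 4 - 6 * n%:R ^+ 3) / 12) <= _); last first.
    by apply: ler_wpM2l => //; lra.
  rewrite n3 (_ : A * _ = (A - 6 * (x * A)) / 12 * n%:R ^+ 4); last by field.
  by apply: ler_wpM2r; [rewrite exprn_ge0 // ltW | rewrite /A in xA *; lra].
have := @stability R _ (adj G) (adj_symmetric G) (adj_irreflexive G).
rewrite card_ord => /(_ C1 large)[c [c' hc]].
have n2 : (2 <= n)%N by exact: leq_trans n12.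
apply: le_trans (edit_distance_le G c n2) _.
(* The improved blow-up is itself a competitor for [lambda_max pb n], so what it gains over [G] is
   bounded by [delta]. As [2 * 'C(n, 4) <= n^4 / 12], the edit distance is at most
   [4 * 2560 / 12 * delta], below [1000 * delta]. *)
have h : n%:R ^+ 2 * (mismatches (adj G) c)%:R / 2560 <= delta * (2 * 'C(n, 4)%:R).
  rewrite mulrBl -lE; have := lambda_le_max R (blowup K2_K2 c').
  rewrite lambda_P3_K1 card_ord (eq_inj_count R (adj_blowup _)) ler_pdivrMr ?mulr_gt0 //.
  lra.
apply: le_trans (_ : 1000 * delta <= _); last first.
  by rewrite ler_wpM2r // /C; lra.
have nn : 0 < n%:R ^+ 2 :> R by rewrite exprn_gt0.
rewrite ler_pdivrMr // -(ler_pM2l nn).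
have b4 := ler_wpM2l delta0 (bin4_le R n).
have -> : n%:R ^+ 2 * (1000 * delta * n%:R ^+ 2) = 1000 * (delta * n%:R ^+ 4)
  :> R by ring.
have : 0 <= delta * n%:R ^+ 4 by rewrite mulr_ge0 // exprn_ge0 // ltW.
move: h b4; clear; lra.
Qed.

End Theorems.

(** * Limit densities of blow-ups and their unique maximiser *)

Section BlowupLimits.
Variable R : realType.
Local Notation pb := (inducibility_problem R P3_K1).

Lemma class_size_tag (s : 'I_4 -> nat) (i : 'I_4) :
  class_size R (@tag 'I_4 (fun i => 'I_(s i))) i = (s i)%:R.
Proof.
rewrite /class_size /colour_sum.
have := @sig_big_dep R 0 +%R 'I_4 (fun i => 'I_(s i)) (pred1 i) (fun _ _
  => true) (fun _ _ => 1).
rewrite big_pred1_eq sumr_const card_ord => ->.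
by apply: eq_bigl => v; rewrite andbT.
Qed.

Definition blowup_density (x : 'I_4 -> R) : R :=
  (x i0 + x i1) * (x i2 + x i3) * (x i0 * x i1 + x i2 * x i3).

Lemma blowup_sizes_limit (a : 'rV[R]_4) : simplex a ->
  has_blowup_lambda pb K2_K2 a (12 * blowup_density (a 0)).
Proof.
move=> [a0 a1] s hs.
pose x i n : R := (s n i)%:R / n%:R.
have cx i : (x i n @[n --> \oo] --> a 0 i)%classic.
  have [c hc] := hs i; apply: (@cvg_of_rate R _ _ c 1) => n n1.
  have n0 : 0 < n%:R :> R by rewrite ltr0n.
  have -> : x i n - a 0 i = ((s n i)%:R - a 0 i * n%:R) / n%:R.
    by rewrite /x mulrBl mulfK // gt_eqF.
  by rewrite normrM normfV (gtr0_norm n0) ler_pM2r ?invr_gt0.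
(* The order of the n-th blow-up is [n * X n], not n; both the count and the binomial are therefore
   normalised by [n^4], and 12 = 24 / 2 is the ratio of their constants. *)
pose X n := x i0 n + x i1 n + x i2 n + x i3 n.
have cX : (X n @[n --> \oo] --> (1 : R))%classic.
  by rewrite -a1 sum_I4; do 3 (apply: cvgD; last exact: cx).
have ch : ((n%:R)^-1 @[n --> \oo] --> (0 : R))%classic.
  apply: (@cvg_of_rate R _ _ 1 1) => n n1.
  by rewrite subr0 ger0_norm ?invr_ge0 // mul1r.
pose V n := {i : 'I_4 & 'I_(s n i)}.
have NE n : #|{: V n}|%:R = (s n i0)%:R + (s n i1)%:R + (s n i2)%:R + (s n i3)%:R :> R.
  by rewrite -(sum_class_size R (@tag 'I_4 (fun i => 'I_(s n i)))) !class_size_tag.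
have NX n : (0 < n)%N -> #|{: V n}|%:R = n%:R * X n.
  move=> n0; rewrite NE /X /x; field.
  by rewrite pnatr_eq0 -lt0n.
pose I n := inj_count R (blow (@tag 'I_4 (fun i => 'I_(s n i)))).
have hcI n : (0 < n)%N -> blowup_density (x^~ n) - X n ^+ 3 / n%:R <= I n / n%:R ^+ 4
  <= blowup_density (x^~ n).
  move=> n1; have n0 : 0 < n%:R :> R by rewrite ltr0n.
  have n4 : 0 < n%:R ^+ 4 :> R by rewrite exprn_gt0.
  have hE : hom_count R (blow (@tag 'I_4 (fun i => 'I_(s n i)))) = blowup_density (x^~
    n) * n%:R ^+ 4.
    by rewrite hom_count_blow !class_size_tag /blowup_density /x; field; rewrite gt_eqF.
  rewrite ler_pdivrMr // ler_pdivlMr // -hE inj_count_le_hom_count andbT.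
  have := hom_count_le_inj_count R (blow (@tag 'I_4 (fun i => 'I_(s n i)))).
  rewrite NX // hE -/(I n) mulrBl -lerBlDr.
  by have -> : X n ^+ 3 / n%:R * n%:R ^+ 4 = (n%:R * X n) ^+ 3 by field; rewrite gt_eqF.
have cpos (P : nat -> Prop) : (forall n, (0 < n)%N -> P n) -> (\forall n \near \oo, P
  n)%classic.
  by move=> h; near=> n; apply: h; near: n; exact: nbhs_infty_gt.
have cp : (blowup_density (x^~ n) @[n --> \oo] --> blowup_density (a 0))%classic.
  by apply: cvgM; [apply: cvgM | apply: cvgD; apply: cvgM]; try (apply: cvgD); exact: cx.
have cXk k : (X n ^+ k @[n --> \oo] --> (1 : R))%classic.
  elim: k => [|k ih]; first exact: cvg_cst.
  have -> : (fun n => X n ^+ k.+1) = (fun n => X n * X n ^+ k).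
    by apply/funext => n; rewrite exprS.
  by have := cvgM cX ih; rewrite mulr1; apply.
have cX3 : (X n ^+ 3 / n%:R @[n --> \oo] --> (0 : R))%classic.
  by have := cvgM (cXk 3) ch; rewrite mulr0; apply.
have cI : (I n / n%:R ^+ 4 @[n --> \oo] --> blowup_density (a 0))%classic.
  apply: squeeze_cvgr; [exact: cpos hcI | | exact: cp].
  by have := cvgB cp cX3; rewrite subr0; apply.
have hcC n : (0 < n)%N -> X n ^+ 4 - 6 * (X n ^+ 3 / n%:R) <=
    24 * 'C(#|{: V n}|, 4)%:R / n%:R ^+ 4 <= X n ^+ 4.
  move=> n1; have n0 : 0 < n%:R :> R by rewrite ltr0n.
  have n4 : 0 < n%:R ^+ 4 :> R by rewrite exprn_gt0.
  rewrite ler_pdivrMr // ler_pdivlMr // mulrBl -exprMn.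
  have -> : 6 * (X n ^+ 3 / n%:R) * n%:R ^+ 4 = 6 * (n%:R * X n) ^+ 3 by field;
    rewrite gt_eqF.
  by rewrite [X n * _]mulrC -NX // bin4_ge bin4_le.
have cC : (24 * 'C(#|{: V n}|, 4)%:R / n%:R ^+ 4 @[n --> \oo] --> (1 : R))%classic.
  apply: squeeze_cvgr; [exact: cpos hcC | | exact: cXk].
  by have := cvgB (cXk 4) (cvgM (cvg_cst (6 : R)) cX3); rewrite mulr0 subr0; apply.
have := cvgM (cvg_cst (12 : R)) (cvgM cI (cvgV (oner_neq0 R) cC)).
rewrite invr1 mulr1.
move=> h; refine (cvg_trans _ (h _ _ _ _)); apply: near_eq_cvg; apply: cpos => n n1 /=.
rewrite lambda_P3_K1 (eq_inj_count R (adj_blowup _)) -/(I n).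
(* With fewer than four vertices both sides are 0, by the convention on division by 0. *)
have [->|C0] := eqVneq 'C(#|{: V n}|, 4) 0; first by rewrite /= !(mulr0, mul0r, invr0).
by field; rewrite !pnatr_eq0 C0 -lt0n n1.
Unshelve. all: by end_near. Qed.

Lemma blowup_lambdaE (a : 'rV[R]_4) : simplex a ->
  blowup_lambda pb K2_K2 a = 12 * blowup_density (a 0).
Proof.
move=> ha; apply: xget_unique => [|l hl]; first exact: blowup_sizes_limit.
(* Uniqueness of the value needs at least one admissible sequence of sizes, as [has_blowup_lambda]
   quantifies over all of them; rounding down provides it. *)
pose s n (i : 'I_4) := Num.truncn (a 0 i * n%:R).
have hs i : exists c : R, forall n, `|(s n i)%:R - a 0 i * n%:R| <= c.
  exists 1 => n; rewrite distrC; have /andP[h1 h2] : ((s n i)%:R <= a 0 i * n%:R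
    < (s n i).+1%:R).
    by apply: truncn_itv; rewrite mulr_ge0 //; apply: ha.1.
  by rewrite ger0_norm ?subr_ge0 // lerBlDr addrC -natr1 in h2 *; exact: ltW.
exact: (@cvg_unique _ (@norm_hausdorff _ R^o) _ _ _ _ (hl s hs) (blowup_sizes_limit ha
  hs)).
Qed.

Lemma has_blowup_lambda_K2_K2 (a : 'rV[R]_4) : simplex a ->
  has_blowup_lambda pb K2_K2 a (blowup_lambda pb K2_K2 a).
Proof. by move=> ha; rewrite blowup_lambdaE //; exact: blowup_sizes_limit. Qed.

Lemma unique_maximiser_K2_K2 :
  unique_maximiser (@simplex R 4) (blowup_lambda pb K2_K2) (const_mx (1 / 4 : R)).
Proof.
have hc : simplex (const_mx (1 / 4 : R) : 'rV_4).
  split=> [i|]; first by rewrite mxE; lra.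
  by rewrite sum_I4 !mxE; lra.
split=> // a ha ac; rewrite !blowup_lambdaE // /blowup_density !mxE ltNge.
apply/negP => big; apply: ac; have [a0 a1] := ha; rewrite sum_I4 in a1.
have z0 : 0 <= (0 : R) <= 1 / 2 by apply/andP; split; lra.
(* A vector at least as good as the uniform one has deficit 0, so z = 0 forces every entry to be
   1/4. *)
have := @balanced_sizes R 1 0 _ _ _ _ ltr01 z0 (a0 i0) (a0 i1) (a0 i2) (a0 i3) a1.
have pre : (1 / 32 - 0 ^+ 4 / 32) * 1 ^+ 4 <= (a 0 i0 + a 0 i1) * (a 0 i2 + a 0 i3) *
    (a 0 i0 * a 0 i1 + a 0 i2 * a 0 i3) :> R.
  by rewrite expr0n expr1n /=; move: big; lra.
case/(_ pre); rewrite mul0r !normr_le0 !subr_eq0 => /eqP h0 /eqP h1 /eqP h2 /eqP h3.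
apply/matrixP => u i; rewrite mxE (ord1 u).
by case: (ord4P i) => ->.
Qed.

End BlowupLimits.

Theorem theorem1p10 (R : realType) :
  let pb := inducibility_problem R P3_K1 in
  [/\ perfectly_stable pb K2_K2,
      (lambda_max pb n @[n --> \oo] --> (3 / 8 : R))%classic,
      has_inducibility paw (3 / 8 : R),
      (forall a : 'rV[R]_4, simplex a ->
         has_blowup_lambda pb K2_K2 a (blowup_lambda pb K2_K2 a)) &
      unique_maximiser (@simplex R 4) (blowup_lambda pb K2_K2)
        (const_mx (1 / 4 : R))].
Proof.
split.
- exact: perfectly_stable_P3_K1.
- exact: lambda_max_cvg.
- exact: paw_inducibility.
- exact: has_blowup_lambda_K2_K2.
- exact: unique_maximiser_K2_K2.
Qed.
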